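(* Let $P$ be a Metropolis-Hastings kernel targeting $\pi$ with proposal density $q(x,y)$, and let $\tilde{P}$ be the delayed-acceptance kernel derived from it through the approximation $\hat{\pi}$. If $P$ is geometrically ergodic then $$\tilde{P}\text{ is geometrically ergodic}\iff\tilde{P}\text{ is variance bounding}.$$
   Context: The state space is $(\mathcal{X},\mathcal{F})$ with $\mathcal{X}\subseteq\mathbb{R}^d$ Lebesgue measurable and $\mathcal{F}$ the $\sigma$-algebra of Lebesgue-measurable subsets of $\mathcal{X}$. The target $\pi$ and the approximation (surrogate) $\hat{\pi}$ are distributions with densities $\pi(x)$ and $\hat{\pi}(x)$ with respect to Lebesgue measure. The Metropolis-Hastings kernel is $P(x,\mathrm{d}y)=q(x,y)\alpha(x,y)\,\mathrm{d}y+[1-\overline{\alpha}(x)]\delta_x(\mathrm{d}y)$, where $\alpha(x,y)=1\wedge r(x,y)$, $r(x,y)=\frac{\pi(y)q(y,x)}{\pi(x)q(x,y)}$ and $\overline{\alpha}(x)=\int q(x,y)\alpha(x,y)\,\mathrm{d}y$. The delayed-acceptance kernel is $\tilde{P}(x,\mathrm{d}y)=q(x,y)\tilde{\alpha}(x,y)\,\mathrm{d}y+[1-\overline{\tilde{\alpha}}(x)]\delta_x(\mathrm{d}y)$, where $\tilde{\alpha}(x,y)=[1\wedge r_1(x,y)][1\wedge r_2(x,y)]$, $r_1(x,y)=\frac{\hat{\pi}(y)q(y,x)}{\hat{\pi}(x)q(x,y)}$, $r_2(x,y)=\frac{\pi(y)/\hat{\pi}(y)}{\pi(x)/\hat{\pi}(x)}$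 and $\overline{\tilde{\alpha}}(x)=\int q(x,y)\tilde{\alpha}(x,y)\,\mathrm{d}y$. A kernel $P$ with stationary distribution $\pi$ is geometrically ergodic if there exist $\rho\in(0,1)$ and $M:\mathcal{X}\to[0,\infty]$, finite $\pi$-almost everywhere, such that $|P^n(x,\mathcal{A})-\pi(\mathcal{A})|\le M(x)\rho^n$ for all $\mathcal{A}\in\mathcal{F}$, $x\in\mathcal{X}$ and $n\in\mathbb{N}$, where $P^n$ is the $n$-step transition kernel. For a kernel $P$ with stationary distribution $\pi$ and associated chain $\{X_t\}_{t\ge1}$ with $X_1\sim\pi$, the asymptotic variance of a functional $h$ is $\mathsf{var}(h,P):=\lim_{n\to\infty} n\,\mathrm{Var}\left[\frac1n\sum_{i=1}^n h(X_i)\right]$. $P$ is variance bounding if $\mathsf{var}(h,P)<\infty$ for all $h\in L^2(\pi)$. *)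

(* Defs.v *)
From HB Require Import structures.
From mathcomp Require Import all_boot all_order all_algebra.
From mathcomp Require Import all_classical all_reals all_analysis.
From mathcomp Require Import measurable_realfun.

Set Implicit Arguments.
Unset Strict Implicit.
Unset Printing Implicit Defensive.
Import Order.TTheory GRing.Theory Num.Theory.
Import numFieldNormedType.Exports.

Local Open Scope classical_set_scope.
Local Open Scope ring_scope.
Local Open Scope ereal_scope.

Definition tuple_cons T n (p : T * n.-tuple T) : n.+1.-tuple T :=
  [tuple of p.1 :: p.2].

Lemma measurable_tuple_cons d (T : measurableType d) n :
  measurable_fun [set: T * n.-tuple T] (@tuple_cons T n).
Proof. exact: measurable_cons. Qed.

Lemma behead_tuple_cons T n (p : T * n.-tuple T) :
  [tuple of behead (tuple_cons p)] = p.2 :> n.-tuple T.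
Proof. exact/val_inj. Qed.

Section lebesgue_step.
Context {R : realType} {n : nat}.
Variable m : {sigma_finite_measure set n.-tuple (measurableTypeR R) -> \bar R}.

Definition lebesgue_step : set (n.+1.-tuple (measurableTypeR R)) -> \bar R :=
  pushforward (@lebesgue_measure R \x m) (@tuple_cons (measurableTypeR R) n).

Let step0 : lebesgue_step set0 = 0.
Proof. by rewrite /lebesgue_step /pushforward preimage_set0 measure0. Qed.

Let step_ge0 A : 0 <= lebesgue_step A.
Proof. exact: (@measure_ge0 _ _ _ (@lebesgue_measure R \x m)). Qed.

Let step_sigma_additive : semi_sigma_additive lebesgue_step.
Proof.
move=> F mF tF mUF; have mc := @measurable_tuple_cons _ (measurableTypeR R) n.
rewrite /lebesgue_step /pushforward preimage_bigcup.
apply: measure_semi_sigma_additive.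
- by move=> k; rewrite -[X in measurable X]setTI; exact: mc.
- by move=> i j _ _ [p [Fi Fj]]; apply: tF => //; exists (tuple_cons p).
- by rewrite -preimage_bigcup -[X in measurable X]setTI; exact: mc.
Qed.

HB.instance Definition _ := isMeasure.Build _ _ _ lebesgue_step
  step0 step_ge0 step_sigma_additive.

Let step_sigma_finite : sigma_finite setT lebesgue_step.
Proof.
have [F FT Foo] := sigma_finiteT (@lebesgue_measure R).
have [G GT Goo] := sigma_finiteT m.
have /card_esym/ppcard_eqP[f] := card_nat2.
pose H k : set (n.+1.-tuple (measurableTypeR R)) :=
  [set t | F (f k).1 (thead t) /\ G (f k).2 [tuple of behead t]].
have HE k : @tuple_cons (measurableTypeR R) n @^-1` H k = F (f k).1 `*` G (f k).2.
  apply/seteqP; split => -[x t] /=; rewrite /H/= (_ : thead _ = x)//;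
    by rewrite behead_tuple_cons.
exists H.
  apply/esym/seteqP; split => // t _.
  have [i _ Fi] : (\bigcup_k F k) (thead t) by rewrite -FT.
  have [j _ Gj] : (\bigcup_k G k) [tuple of behead t] by rewrite -GT.
  by exists (f^-1%FUN (i, j)) => //=; rewrite /H/= invK ?inE.
move=> k; have [mF Fk] := Foo (f k).1; have [mG Gk] := Goo (f k).2.
split.
  rewrite [H k](_ : _ =
      (fun t : n.+1.-tuple (measurableTypeR R) => thead t) @^-1` F (f k).1 `&`
      (fun t : n.+1.-tuple (measurableTypeR R) =>
        [tuple of behead t] : n.-tuple _) @^-1` G (f k).2)//.
  apply: measurableI; rewrite -[X in measurable X]setTI.
    exact: (measurable_tnth ord0).
  exact: (@measurable_behead _ (measurableTypeR R) n).
rewrite /lebesgue_step/= /pushforward HE product_measure1E//.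
rewrite lte_mul_pinfty// ge0_fin_numE//.
Qed.

HB.instance Definition _ := @Measure_isSigmaFinite.Build _ _ _
  lebesgue_step step_sigma_finite.

End lebesgue_step.

(* Lebesgue measure on the Borel sigma-algebra of R^n, as the n-fold product of
   the one-dimensional Lebesgue measure. *)
Fixpoint borel_lebesgue (R : realType) n :
    {sigma_finite_measure set n.-tuple (measurableTypeR R) -> \bar R} :=
  match n with
  | 0 => \d_([tuple] : 0.-tuple (measurableTypeR R))
  | n'.+1 => lebesgue_step (borel_lebesgue R n')
  end.

(* R^n with the sigma-algebra of Lebesgue-measurable sets, i.e. the sets that
   are Caratheodory-measurable for the Lebesgue outer measure. *)
Definition euclidean (R : realType) (n : nat) : Type :=
  caratheodory_type (borel_lebesgue R n)^*%mu.
HB.instance Definition _ (R : realType) n := Measurable.on (euclidean R n).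

Definition lebesgue (R : realType) n : set (euclidean R n) -> \bar R :=
  @completed_measure_extension _ _ _ (borel_lebesgue R n).
HB.instance Definition _ (R : realType) n := Measure.on (@lebesgue R n).

Lemma lebesgue_sigma_finite (R : realType) n :
  sigma_finite setT (@lebesgue R n).
Proof. exact/completed_measure_extension_sigma_finite/sigma_finiteT. Qed.
HB.instance Definition _ (R : realType) n :=
  @Measure_isSigmaFinite.Build _ _ _ (@lebesgue R n)
    (@lebesgue_sigma_finite R n).

(* A measurableType is pointed, so the state space is taken
   nonempty; this is implied by the existence of a probability density on it. *)
Record state_space (R : realType) (n : nat) := StateSpace {
  carrier : set (euclidean R n) ;
  carrier_measurable : measurable carrier ;
  carrier_nonempty : carrier !=set0 }.

Definition state_type (R : realType) n (X : state_space R n) : Type :=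
  set_type (carrier X).
Coercion state_type : state_space >-> Sortclass.

Section state_space_measurable.
Context {R : realType} {n : nat} (X : state_space R n).

Let Xpoint : X :=
  let: exist x Xx := cid (carrier_nonempty X) in exist _ x (mem_set Xx).

HB.instance Definition _ := Choice.on X.
HB.instance Definition _ := isPointed.Build X Xpoint.

Definition state_val (x : X) : euclidean R n := val x.

(* The trace sigma-algebra: as the carrier is measurable, these are exactly the
   Lebesgue-measurable subsets of the state space. *)
Let Xmeasurable : set (set X) :=
  preimage_set_system setT state_val measurable.

Let Xmeasurable_sigma : sigma_algebra setT Xmeasurable.
Proof.
apply: sigma_algebra_preimage; exact: sigma_algebra_measurable.
Qed.

Let Xmeasurable0 : Xmeasurable set0.
Proof. by have [] := Xmeasurable_sigma. Qed.

Let XmeasurableC A : Xmeasurable A -> Xmeasurable (~` A).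
Proof. by have [_ + _] := Xmeasurable_sigma; move=> /[apply]; rewrite setTD. Qed.

Let Xmeasurable_bigcup (F : (set X)^nat) :
  (forall i, Xmeasurable (F i)) -> Xmeasurable (\bigcup_i F i).
Proof. by have [_ _] := Xmeasurable_sigma; exact. Qed.

HB.instance Definition _ := @isMeasurable.Build (preimage_display state_val)
  X Xmeasurable Xmeasurable0 XmeasurableC Xmeasurable_bigcup.

Definition lebesgue_on (A : set X) : \bar R := @lebesgue R n (state_val @` A).

Let state_val_inj : injective state_val.
Proof. exact: val_inj. Qed.

Let measurable_image (A : set X) : measurable A -> measurable (state_val @` A).
Proof.
move=> [B mB <-].
rewrite (_ : _ @` _ = carrier X `&` B).
  exact: measurableI (carrier_measurable X) mB.
apply/seteqP; split => [_ [x [_ /= Bx] <-]|x [Xx Bx]].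
  by split => //; exact: set_valP.
by exists (exist _ x (mem_set Xx)).
Qed.

Let lebesgue_on0 : lebesgue_on set0 = 0.
Proof. by rewrite /lebesgue_on image_set0 measure0. Qed.

Let lebesgue_on_ge0 A : 0 <= lebesgue_on A.
Proof. exact: (@measure_ge0 _ _ _ (@lebesgue R n)). Qed.

Let lebesgue_on_sigma_additive : semi_sigma_additive lebesgue_on.
Proof.
move=> F mF tF mUF; rewrite /lebesgue_on image_bigcup.
apply: measure_semi_sigma_additive.
- by move=> k; exact: measurable_image.
- move=> i j _ _ [_ [[x Fx <-] [y Fy /state_val_inj yx]]].
  by apply: tF => //; exists x; split => //; rewrite -yx.
- by rewrite -image_bigcup; exact: measurable_image.
Qed.

HB.instance Definition _ := isMeasure.Build _ _ _ lebesgue_on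
  lebesgue_on0 lebesgue_on_ge0 lebesgue_on_sigma_additive.

Let lebesgue_on_sigma_finite : sigma_finite setT lebesgue_on.
Proof.
have [F FT Foo] := sigma_finiteT (@lebesgue R n).
exists (fun k => state_val @^-1` F k).
  by rewrite -preimage_bigcup -FT preimage_setT.
move=> k; have [mF Fk] := Foo k; split; first by exists (F k); rewrite ?setTI.
apply: le_lt_trans Fk; apply: le_outer_measure.
by move=> _ [x Fx <-].
Qed.

HB.instance Definition _ := @Measure_isSigmaFinite.Build _ _ _
  lebesgue_on lebesgue_on_sigma_finite.

End state_space_measurable.

Arguments lebesgue_on {R n} X A.

Section densities.
Context d (T : measurableType d) (R : realType).
Variable mu : {measure set T -> \bar R}.

Record density := Density {
  density_fun :> T -> R ;
  measurable_density : measurable_fun setT density_fun ;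
  density_ge0 : forall x, (0 <= density_fun x)%R ;
  density_int1 : \int[mu]_x (density_fun x)%:E = 1 }.

(* q x y is the density at y of a move proposed from x. *)
Record proposal := Proposal {
  proposal_fun :> T -> T -> R ;
  measurable_proposal : measurable_fun setT (uncurry proposal_fun) ;
  proposal_ge0 : forall x y, (0 <= proposal_fun x y)%R ;
  proposal_int1 : forall x, \int[mu]_y (proposal_fun x y)%:E = 1 }.

Definition law (p : density) (A : set T) : \bar R :=
  \int[mu]_(x in A) (p x)%:E.

Section law_probability.
Variable p : density.

Let law0 : law p set0 = 0.
Proof. by rewrite /law integral_set0. Qed.

Let law_ge0 A : 0 <= law p A.
Proof. by apply: integral_ge0 => x _; rewrite lee_fin density_ge0. Qed.

Let law_sigma_additive : semi_sigma_additive (law p).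
Proof.
apply: semi_sigma_additive_nng_induced => [|x].
  by apply/measurable_EFinP; exact: measurable_density.
by rewrite lee_fin density_ge0.
Qed.

HB.instance Definition _ := isMeasure.Build _ _ _ (law p)
  law0 law_ge0 law_sigma_additive.

Let law_setT : law p setT = 1.
Proof. exact: density_int1. Qed.

HB.instance Definition _ := Measure_isProbability.Build _ _ _ (law p) law_setT.

End law_probability.
End densities.

Section acceptance.
Context d (T : measurableType d) (R : realType).

Record acceptance := Acceptance {
  acceptance_fun :> T -> T -> R ;
  measurable_acceptance : measurable_fun setT (uncurry acceptance_fun) ;
  acceptance_ge0 : forall x y, (0 <= acceptance_fun x y)%R ;
  acceptance_le1 : forall x y, (acceptance_fun x y <= 1)%R }.

End acceptance.

(* The kernel q(x,y) a(x,y) dy + [1 - abar(x)] delta_x(dy), where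
   abar(x) = \int q(x,y) a(x,y) dy. *)
Section accept_reject.
Context d (T : measurableType d) (R : realType).
Variable mu : {sigma_finite_measure set T -> \bar R}.
Variables (q : proposal mu) (a : acceptance T R).

Definition mean_acceptance (x : T) : \bar R := \int[mu]_y (q x y * a x y)%:E.

Definition accept_reject (x : T) (A : set T) : \bar R :=
  \int[mu]_(y in A) (q x y * a x y)%:E + (1 - mean_acceptance x) * \d_x A.

Let qa_ge0 x y : 0 <= (q x y * a x y)%:E.
Proof. by rewrite lee_fin mulr_ge0 ?proposal_ge0 ?acceptance_ge0. Qed.

Let measurable_qa :
  measurable_fun setT (fun z : T * T => (q z.1 z.2 * a z.1 z.2)%:E).
Proof.
rewrite (_ : (fun _ => _) = EFin \o (uncurry q \* uncurry a)%R); last first.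
  by apply/funext => -[].
apply/measurable_EFinP; apply: measurable_funM.
- exact: measurable_proposal.
- exact: measurable_acceptance.
Qed.

Let measurable_qax x : measurable_fun setT (fun y => (q x y * a x y)%:E).
Proof. exact: (measurable_fun_pair2 x measurable_qa). Qed.

Let mean_ge0 x : 0 <= mean_acceptance x.
Proof. exact: integral_ge0. Qed.

Let mean_le1 x : mean_acceptance x <= 1.
Proof.
rewrite -(proposal_int1 q x); apply: ge0_le_integral => //.
- apply/measurable_EFinP.
  exact: (measurable_fun_pair2 x (measurable_proposal q)).
- by move=> y _; rewrite lee_fin ler_piMr ?proposal_ge0 ?acceptance_le1.
Qed.

Let mean_fin x : mean_acceptance x \is a fin_num.
Proof. by rewrite ge0_fin_numE// (le_lt_trans (mean_le1 x)) ?ltry. Qed.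

Let accept_reject0 x : accept_reject x set0 = 0.
Proof. by rewrite /accept_reject integral_set0 measure0 mule0 adde0. Qed.

Let accept_reject_ge0 x A : 0 <= accept_reject x A.
Proof.
by rewrite adde_ge0 ?integral_ge0// mule_ge0// sube_ge0 ?mean_le1 ?mean_fin.
Qed.

Let accept_reject_sigma_additive x : semi_sigma_additive (accept_reject x).
Proof.
move=> F mF tF mUF; rewrite /accept_reject.
under eq_fun do rewrite big_split/= -ge0_sume_distrr//.
apply: cvgeD.
- by rewrite ge0_adde_def// inE ?integral_ge0// mule_ge0// sube_ge0 ?mean_fin.
- exact: semi_sigma_additive_nng_induced.
- apply: cvgeZl; first by rewrite fin_numB mean_fin.
  exact: measure_semi_sigma_additive.
Qed.

HB.instance Definition _ x := isMeasure.Build _ _ _ (accept_reject x)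
  (accept_reject0 x) (accept_reject_ge0 x) (@accept_reject_sigma_additive x).

Definition accept_reject_kernel : T -> {measure set T -> \bar R} :=
  accept_reject.

Let measurable_accept_reject A : measurable A ->
  measurable_fun setT (accept_reject_kernel ^~ A).
Proof.
move=> mA; apply: emeasurable_funD.
  under eq_fun do rewrite integral_mkcond/=.
  apply: (@measurable_fun_fubini_tonelli_F _ _ T T R mu
    (fun z => ((fun y => (q z.1 y * a z.1 y)%:E) \_ A) z.2)) => //=.
    rewrite (_ : (fun _ => _) =
      (fun z : T * T => (q z.1 z.2 * a z.1 z.2)%:E) \_ (setT `*` A)).
      apply/(measurable_restrictT _ _).1; first exact: measurableX.
      exact: measurable_funTS.
    apply/funext => -[x y]; rewrite !patchE/=.
    by congr (if _ then _ else _); apply/idP/idP; rewrite !inE//= => -[].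
  by move=> z; rewrite patchE; case: ifPn.
apply: emeasurable_funM; last exact: measurable_fun_dirac.
apply: emeasurable_funB => //.
exact: (@measurable_fun_fubini_tonelli_F _ _ T T R mu _ measurable_qa).
Qed.

HB.instance Definition _ := isKernel.Build _ _ _ _ _ accept_reject_kernel
  measurable_accept_reject.

Let accept_reject_setT x : accept_reject_kernel x setT = 1.
Proof.
rewrite /accept_reject_kernel/= /accept_reject diracT mule1.
by rewrite -/(mean_acceptance x) addeC subeK ?mean_fin.
Qed.

HB.instance Definition _ := Kernel_isProbability.Build _ _ _ _ _
  accept_reject_kernel accept_reject_setT.

End accept_reject.

(* Ratios use real division, for which u / 0 = 0. The value given to a ratio
   when q x y = 0 is irrelevant, as acceptance probabilities only occur
   multiplied by q x y. When pi x = 0, or when pihat x = 0 or pihat y = 0 (for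
   the delayed-acceptance kernel), the convention makes the acceptance
   probability zero. *)
Section metropolis_hastings.
Context d (T : measurableType d) (R : realType).
Variable mu : {sigma_finite_measure set T -> \bar R}.
Variables (pi pihat : density mu) (q : proposal mu).

Definition mh_ratio (p : density mu) (x y : T) : R :=
  ((p y * q y x) / (p x * q x y))%R.

Definition mh_prob (x y : T) : R := Num.min 1%R (mh_ratio pi x y).

Definition da_ratio2 (x y : T) : R :=
  ((pi y / pihat y) / (pi x / pihat x))%R.

Definition da_prob (x y : T) : R :=
  (Num.min 1 (mh_ratio pihat x y) * Num.min 1 (da_ratio2 x y))%R.

Lemma mh_ratio_ge0 p x y : (0 <= mh_ratio p x y)%R.
Proof. by rewrite divr_ge0 ?mulr_ge0 ?density_ge0 ?proposal_ge0. Qed.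

Lemma da_ratio2_ge0 x y : (0 <= da_ratio2 x y)%R.
Proof. by rewrite !divr_ge0 ?density_ge0. Qed.

Lemma measurable_ge0_div d' (U : measurableType d') (f g : U -> R) :
  (forall u, 0 <= g u)%R -> measurable_fun setT f -> measurable_fun setT g ->
  measurable_fun setT (fun u => f u / g u)%R.
Proof.
move=> g0 mf mg; apply: measurable_funM => //.
rewrite (_ : (fun _ => _) = (@powR R ^~ (-1)%R) \o g); last first.
  by apply/funext => u /=; rewrite powR_inv1.
exact: (measurableT_comp (@measurable_powR R (-1)%R) mg).
Qed.

Let m1 (p : density mu) : measurable_fun setT (fun z : T * T => p z.1).
Proof. exact: (measurableT_comp (measurable_density p)). Qed.

Let m2 (p : density mu) : measurable_fun setT (fun z : T * T => p z.2).
Proof. exact: (measurableT_comp (measurable_density p)). Qed.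

Lemma measurable_mh_ratio p : measurable_fun setT (uncurry (mh_ratio p)).
Proof.
have mq := measurable_proposal q.
rewrite (_ : uncurry _ = fun z : T * T =>
  ((p z.2 * q z.2 z.1) / (p z.1 * q z.1 z.2))%R); last by apply/funext => -[].
apply: measurable_ge0_div.
- by move=> z; rewrite mulr_ge0 ?density_ge0 ?proposal_ge0.
- apply: measurable_funM => //.
  exact: (measurableT_comp mq (@measurable_swap _ _ T T)).
- apply: measurable_funM => //.
  by rewrite (_ : (fun _ => _) = uncurry q)//; apply/funext => -[].
Qed.

Lemma measurable_da_ratio2 : measurable_fun setT (uncurry da_ratio2).
Proof.
rewrite (_ : uncurry _ = fun z : T * T =>
  ((pi z.2 / pihat z.2) / (pi z.1 / pihat z.1))%R); last by apply/funext => -[].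
apply: measurable_ge0_div; last 2 first.
- by apply: measurable_ge0_div => // z; exact: density_ge0.
- by apply: measurable_ge0_div => // z; exact: density_ge0.
- by move=> z; rewrite divr_ge0 ?density_ge0.
Qed.

Lemma measurable_mh_prob : measurable_fun setT (uncurry mh_prob).
Proof.
rewrite (_ : uncurry _ = (fun z => Num.min 1 (uncurry (mh_ratio pi) z))%R).
  by apply: measurable_minr => //; exact: measurable_mh_ratio.
by apply/funext => -[].
Qed.

Lemma mh_prob_ge0 x y : (0 <= mh_prob x y)%R.
Proof. by rewrite le_min ler01 mh_ratio_ge0. Qed.

Lemma mh_prob_le1 x y : (mh_prob x y <= 1)%R.
Proof. by rewrite ge_min lexx. Qed.

Definition mh_acceptance : acceptance T R :=
  Acceptance measurable_mh_prob mh_prob_ge0 mh_prob_le1.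

Lemma measurable_da_prob : measurable_fun setT (uncurry da_prob).
Proof.
rewrite (_ : uncurry _ = (fun z => Num.min 1 (uncurry (mh_ratio pihat) z) *
    Num.min 1 (uncurry da_ratio2 z))%R); last by apply/funext => -[].
apply: measurable_funM; apply: measurable_minr => //.
- exact: measurable_mh_ratio.
- exact: measurable_da_ratio2.
Qed.

Lemma da_prob_ge0 x y : (0 <= da_prob x y)%R.
Proof. by rewrite mulr_ge0// le_min ler01 ?mh_ratio_ge0 ?da_ratio2_ge0. Qed.

Lemma da_prob_le1 x y : (da_prob x y <= 1)%R.
Proof.
by rewrite mulr_ile1// ?ge_min ?lexx// le_min ler01 ?mh_ratio_ge0
  ?da_ratio2_ge0.
Qed.

Definition da_acceptance : acceptance T R :=
  Acceptance measurable_da_prob da_prob_ge0 da_prob_le1.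

Definition mh_kernel : R.-pker T ~> T := accept_reject_kernel q mh_acceptance.

Definition da_kernel : R.-pker T ~> T := accept_reject_kernel q da_acceptance.

End metropolis_hastings.

Section ergodicity.
Context d (T : measurableType d) (R : realType).

Fixpoint nstep (P : R.-pker T ~> T) (n : nat) (x : T) (A : set T) : \bar R :=
  match n with
  | 0 => \d_x A
  | n'.+1 => \int[P x]_y nstep P n' y A
  end.

Definition geometrically_ergodic (pi : probability T R) (P : R.-pker T ~> T) :=
  exists (rho : R) (M : T -> \bar R),
    [/\ (0 < rho < 1)%R,
        (forall x, 0 <= M x),
        {ae pi, forall x, M x < +oo} &
        forall (n : nat) (x : T) (A : set T), measurable A ->
          `|nstep P n x A - pi A| <= M x * (rho ^+ n)%:E].

End ergodicity.

Section chain_step.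
Context d0 d (S : measurableType d0) (T : measurableType d) (R : realType).
Context {n : nat}.
Variables (k1 : R.-pker S ~> T) (k2 : R.-pker T ~> n.-tuple T).

(* Law of (Y_1, ..., Y_n.+1) where Y_1 has law k1 x and, given Y_1 = y,
   (Y_2, ..., Y_n.+1) has law k2 y. *)
Definition chain_step (x : S) (A : set (n.+1.-tuple T)) : \bar R :=
  \int[k1 x]_y k2 y [set t | A (tuple_cons (y, t))].

Let sectionE (A : set (n.+1.-tuple T)) y :
  [set t | A (tuple_cons (y, t))] = xsection (@tuple_cons T n @^-1` A) y.
Proof. by rewrite xsectionE. Qed.

Let measurable_cons_preimage (A : set (n.+1.-tuple T)) :
  measurable A -> measurable (@tuple_cons T n @^-1` A).
Proof.
by move=> mA; rewrite -[X in measurable X]setTI; exact: measurable_tuple_cons.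
Qed.

Let measurable_section (A : set (n.+1.-tuple T)) y :
  measurable A -> measurable [set t | A (tuple_cons (y, t))].
Proof.
move=> mA; rewrite sectionE; apply: measurable_xsection.
exact: measurable_cons_preimage.
Qed.

Let measurable_k2_section (A : set (n.+1.-tuple T)) : measurable A ->
  measurable_fun setT (fun y => k2 y [set t | A (tuple_cons (y, t))]).
Proof.
move=> mA; under eq_fun do rewrite sectionE.
apply: measurable_fun_xsection_finite_kernel.
by rewrite inE; exact: measurable_cons_preimage.
Qed.

Let chain_step0 x : chain_step x set0 = 0.
Proof.
rewrite /chain_step; apply: integral0_eq => y _; rewrite -[RHS](measure0 (k2 y)).
by [].
Qed.

Let chain_step_ge0 x A : 0 <= chain_step x A.
Proof. exact: integral_ge0. Qed.

Let chain_step_sigma_additive x : semi_sigma_additive (chain_step x).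
Proof.
move=> F mF tF mUF.
have -> : chain_step x (\bigcup_i F i) = \sum_(i <oo) chain_step x (F i).
  rewrite /chain_step -integral_nneseries//; last first.
    by move=> i; exact: measurable_k2_section.
  apply: eq_integral => y _.
  rewrite [X in k2 y X](_ : _ =
    \bigcup_i [set t | F i (tuple_cons (y, t))])//.
  rewrite measure_semi_bigcup//; first by move=> i; exact: measurable_section.
    2: by apply: bigcup_measurable => i _; exact: measurable_section.
  by move=> i j _ _ [t [Fi Fj]]; apply: tF => //; exists (tuple_cons (y, t)).
by apply: is_cvg_nneseries => i _ _; exact: chain_step_ge0.
Qed.

HB.instance Definition _ x := isMeasure.Build _ _ _ (chain_step x)
  (chain_step0 x) (chain_step_ge0 x) (@chain_step_sigma_additive x).

Let chain_step_setT x : chain_step x setT = 1.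
Proof.
rewrite /chain_step [LHS](_ : _ = \int[k1 x]_y cst 1 y).
  by rewrite integral_cst// mul1e; exact: prob_kernel.
by apply: eq_integral => y _; exact: prob_kernel.
Qed.

HB.instance Definition _ x := Measure_isProbability.Build _ _ _ (chain_step x)
  (chain_step_setT x).

Definition chain_step_kernel : S -> {measure set n.+1.-tuple T -> \bar R} :=
  chain_step.

Let measurable_chain_step A : measurable A ->
  measurable_fun setT (chain_step_kernel ^~ A).
Proof.
move=> mA; apply: measurable_fun_integral_kernel => //.
- by move=> U mU; exact: measurable_kernel.
- exact: measurable_k2_section.
Qed.

HB.instance Definition _ := isKernel.Build _ _ _ _ _ chain_step_kernel
  measurable_chain_step.
HB.instance Definition _ := Kernel_isProbability.Build _ _ _ _ _
  chain_step_kernel chain_step_setT.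

End chain_step.

Section variance_bounding.
Context d (T : measurableType d) (R : realType).

(* Law of (X_2, ..., X_n.+1) given X_1 = x, for the chain with kernel P. *)
Fixpoint chain_path (P : R.-pker T ~> T) (n : nat) : R.-pker T ~> n.-tuple T :=
  match n with
  | 0 => kdirac (measurable_cst ([tuple] : 0.-tuple T))
  | n'.+1 => chain_step_kernel P (chain_path P n')
  end.

(* Law of (X_1, ..., X_n.+1) for the chain with kernel P and X_1 ~ pi. The
   probability kernel from unit is the initial distribution. *)
Definition chain_law (pi : probability T R) (P : R.-pker T ~> T) (n : nat) :
    probability (n.+1.-tuple T) R :=
  chain_step (kprobability (measurable_cst (pi : pprobability T R)))
    (chain_path P n) tt.

(* N Var[(1/N) sum_(1 <= i <= N) h(X_i)] with N = n.+1. *)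
Definition scaled_variance (pi : probability T R) (P : R.-pker T ~> T)
    (h : T -> R) (n : nat) : \bar R :=
  (n.+1%:R)%:E * 'V_(chain_law pi P n)
    [fun t => (n.+1%:R^-1 * \sum_(i < n.+1) h (tnth t i))%R].

Definition asymptotic_variance (pi : probability T R) (P : R.-pker T ~> T)
    (h : T -> R) : \bar R :=
  limn (scaled_variance pi P h).

(* The convergence requirement (in the extended reals) is needed because limn
   has an arbitrary value on divergent sequences. *)
Definition variance_bounding (pi : probability T R) (P : R.-pker T ~> T) :=
  forall h : T -> R, h \in Lfun pi 2%:E ->
    cvgn (scaled_variance pi P h) /\ asymptotic_variance pi P h < +oo.

End variance_bounding.

(* Main.v *)
(* Kernels are studied as operators on bounded measurable functions with the
   inner product of L^2(pi); both P and P~ are reversible, hence symmetric.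

   For a symmetric kernel, geometric ergodicity yields an L^2 contraction on
   mean-zero functions: Hahn decompositions of the laws of (X_0, X_n) against
   pi x pi turn the bound M(x) rho^n into decay of |K^n f|^2 for f in a dense
   class, and log-convexity of n |-> |K^n f|^2 transfers the rate to |K f|^2.
   A contraction makes the autocovariances decay geometrically, hence the scaled
   variances converge, by Cesaro summation.

   Conversely, if (f, K f) <= a |f|^2 on mean-zero functions fails for every
   a < 1, there are almost invariant functions f_k at the time scales 32^k, and
   a signed sum of them is an h in L^2 with unbounded scaled variances; so
   variance bounding keeps the spectrum of P~ away from 1. It is also kept away
   from -1: the delayed-acceptance probability is below that of P, so
   (f, P f) <= (f, P~ f) by Peskun's argument, and P has a spectral gap.

   Such a two-sided gap gives back geometric ergodicity: as Lebesgue measure has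
   no atoms (unless d = 0, when the state space is a point), rejection is almost
   surely not certain, so some power of P~ is the sum of a kernel dominated by a
   multiple of pi and of a remainder of small L^2 norm, and iterating this
   splitting produces the function M. *)

From HB Require Import structures.
Require Import Defs.
From mathcomp Require Import all_boot all_order all_algebra.
From mathcomp Require Import all_classical all_reals all_analysis.
From mathcomp Require Import measurable_realfun ring lra.

Set Implicit Arguments.
Unset Strict Implicit.
Unset Printing Implicit Defensive.
Import Order.TTheory GRing.Theory Num.Theory.
Import numFieldNormedType.Exports.
Local Open Scope classical_set_scope.
Local Open Scope ring_scope.

(** * Bounded measurable functions and their L2 structure *)

(** Geometric ergodicity asks for a bound at every state, so operators act on everywhere defined
    bounded functions instead of classes in L^2(pi), and spectral facts are phrased as inequalities
    between quadratic forms. The price is that an unbounded h in L^2 is reached only through limits: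
    of clipped functions in the variance formula, and of an almost surely convergent sequence for
    the signed sum.

    The right edge of the spectrum cannot be inherited from P: Peskun's comparison goes one way
    only, and the second stage may reject so often that P~ mixes arbitrarily slowly. This is the
    information that variance bounding supplies.

    On the way back to geometric ergodicity the obstacle is the Dirac part of the kernel. Where
    rejection has positive probability, no power of P~ started at x has a density with respect to
    pi, so a rate in L^2 says nothing at a fixed x. The dominated part of the splitting turns L^2
    decay into a pointwise bound, and only the remainder has to be propagated pointwise. The
    constants make the L^2 decay (at least 3^-n) faster than the bound 2^-n for the remainder, so
    that the accumulated errors still decay like 2^-n. *)

Record bfun d (T : measurableType d) (R : realType) := BFun {
  bfun_fun :> T -> R ;
  bfun_measurable : measurable_fun setT bfun_fun ;
  bfun_bounded : exists M, forall x, `|bfun_fun x| <= M }.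

Section bfun_theory.
Context d (T : measurableType d) (R : realType).
Local Notation V := (bfun T R).

HB.instance Definition _ := gen_eqMixin V.
HB.instance Definition _ := gen_choiceMixin V.

Lemma bfun_ext (f g : V) : f =1 g -> f = g.
Proof.
case: f g => [f mf bf] [g mg bg]/= /funext fg; subst g.
by congr BFun; exact: Prop_irrelevance.
Qed.

Lemma bfunB (f : V) : {M | 0 <= M & forall x, `|f x| <= M}.
Proof.
have [M fM] := cid (bfun_bounded f).
by exists M => //; exact: le_trans (fM point).
Qed.

Lemma bcst_subproof (a : R) : exists M, forall x : T, `|cst a x| <= M.
Proof. by exists `|a|. Qed.

Definition bcst (a : R) : V := BFun (measurable_cst a) (bcst_subproof a).

Lemma badd_subproof (f g : V) : exists M, forall x, `|f x + g x| <= M.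
Proof.
have [M M0 fM] := bfunB f; have [N N0 gN] := bfunB g.
by exists (M + N) => x; rewrite (le_trans (ler_normD _ _))// lerD.
Qed.

Definition badd (f g : V) : V :=
  BFun (measurable_funD (bfun_measurable f) (bfun_measurable g))
    (badd_subproof f g).

Lemma bmul_subproof (f g : V) : exists M, forall x, `|f x * g x| <= M.
Proof.
have [M M0 fM] := bfunB f; have [N N0 gN] := bfunB g.
by exists (M * N) => x; rewrite normrM ler_pM.
Qed.

Definition bmul (f g : V) : V :=
  BFun (measurable_funM (bfun_measurable f) (bfun_measurable g))
    (bmul_subproof f g).

Lemma babs_subproof (f : V) : exists M, forall x, `| `|f x| | <= M.
Proof. by have [M _ fM] := bfunB f; exists M => x; rewrite normr_id. Qed.

Lemma babs_measurable (f : V) : measurable_fun setT (fun x => `|f x|).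
Proof. exact: (measurableT_comp (@normr_measurable R setT) (bfun_measurable f)). Qed.

Definition babs (f : V) : V := BFun (babs_measurable f) (babs_subproof f).

Lemma bmin_subproof (a : R) (f : V) : exists M, forall x, `|Num.min a (f x)| <= M.
Proof.
have [M M0 fM] := bfunB f; exists (`|a| + M) => x.
by rewrite /Num.min; case: ifP => _; [rewrite lerDl|rewrite ler_wpDl].
Qed.

Definition bmin (a : R) (f : V) : V :=
  BFun (measurable_minr (measurable_cst a) (bfun_measurable f))
    (bmin_subproof a f).

Lemma bind_subproof (A : set T) : exists M, forall x, `|(\1_A x : R)| <= M.
Proof. by exists 1 => x; rewrite indicE; case: (_ \in _); rewrite ?normr1 ?normr0. Qed.

Definition bind (A : set T) (mA : measurable A) : V :=
  BFun (measurable_indic mA) (bind_subproof A).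

Program Definition bfun_zmod := @GRing.isZmodule.Build V (bcst 0)
  (fun f => bmul (bcst (-1)) f) badd _ _ _ _.
Next Obligation. by move=> f g h; apply: bfun_ext => x /=; rewrite addrA. Qed.
Next Obligation. by move=> f g; apply: bfun_ext => x /=; rewrite addrC. Qed.
Next Obligation. by move=> f; apply: bfun_ext => x /=; rewrite add0r. Qed.
Next Obligation. by move=> f; apply: bfun_ext => x /=; rewrite /cst; ring. Qed.
HB.instance Definition _ := bfun_zmod.

Program Definition bfun_lmod := @GRing.Zmodule_isLmodule.Build R V
  (fun a f => bmul (bcst a) f) _ _ _ _.
Next Obligation. by move=> a b f; apply: bfun_ext => x /=; rewrite /cst mulrA. Qed.
Next Obligation. by move=> f; apply: bfun_ext => x /=; rewrite /cst mul1r. Qed.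
Next Obligation. by move=> a f g; apply: bfun_ext => x /=; rewrite /cst; ring. Qed.
Next Obligation. by move=> f a b; apply: bfun_ext => x /=; rewrite /cst; ring. Qed.
HB.instance Definition _ := bfun_lmod.

Lemma bfunD (f g : V) x : (f + g) x = f x + g x. Proof. by []. Qed.
Lemma bfunN (f : V) x : (- f) x = - f x. Proof. exact: mulN1r. Qed.
Lemma bfunB_ (f g : V) x : (f - g) x = f x - g x.
Proof. by rewrite bfunD bfunN. Qed.
Lemma bfunZ a (f : V) x : (a *: f) x = a * f x. Proof. by []. Qed.
Lemma bfun0 x : (0 : V) x = 0. Proof. by []. Qed.
Lemma bmulE (f g : V) x : bmul f g x = f x * g x. Proof. by []. Qed.
Lemma bcstE a x : bcst a x = a. Proof. by []. Qed.
Lemma babsE (f : V) x : babs f x = `|f x|. Proof. by []. Qed.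
Lemma bminE a (f : V) x : bmin a f x = Num.min a (f x). Proof. by []. Qed.
Definition bfunE := (bfunB_, bfunD, bfunN, bfunZ, bfun0, bmulE, bcstE, babsE, bminE).

Lemma bfun_sum I r (P : pred I) (F : I -> V) x :
  (\sum_(i <- r | P i) F i) x = \sum_(i <- r | P i) F i x.
Proof. by elim/big_rec2: _ => //= i a b _ <-. Qed.

End bfun_theory.
Arguments bcst {d T R}.

Section expect.
Context d (T : measurableType d) (R : realType).
Variable P : probability T R.
Local Notation V := (bfun T R).

Lemma bfun_integrable (f : V) : P.-integrable setT (EFin \o f).
Proof.
have [M M0 fM] := bfunB f.
apply: (@le_integrable _ _ _ P setT measurableT _ (EFin \o cst M)) => //.
- exact/measurable_EFinP/(bfun_measurable f).
- by move=> x _ /=; rewrite lee_fin (le_trans (fM x))// ler_norm.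
- exact: finite_measure_integrable_cst.
Qed.
Local Hint Resolve bfun_integrable : core.

Definition Ex (f : V) : R := \int[P]_x f x.

Lemma ExE (f : V) : (Ex f)%:E = (\int[P]_x (f x)%:E)%E.
Proof. by rewrite /Ex /Rintegral fineK//; exact: integrable_fin_num (bfun_integrable f). Qed.

Lemma ExD f g : Ex (f + g) = Ex f + Ex g.
Proof. by rewrite /Ex -RintegralD. Qed.

Lemma ExZ a f : Ex (a *: f) = a * Ex f.
Proof. by rewrite /Ex -RintegralZl. Qed.

Lemma Ex_is_linear : linear_for *%R Ex.
Proof. by move=> a f g; rewrite ExD ExZ. Qed.

HB.instance Definition _ := GRing.isLinear.Build R V R *%R Ex Ex_is_linear.

Lemma ExB f g : Ex (f - g) = Ex f - Ex g. Proof. exact: raddfB. Qed.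

Lemma Ex_cst a : Ex (bcst a) = a.
Proof. by rewrite /Ex /= Rintegral_cst//= probability_setT mulr1. Qed.

Lemma Ex_ge0 (f : V) : (forall x, 0 <= f x) -> 0 <= Ex f.
Proof. by move=> f0; apply: Rintegral_ge0. Qed.

Lemma Ex_le (f g : V) : (forall x, f x <= g x) -> Ex f <= Ex g.
Proof. by move=> fg; apply: le_Rintegral. Qed.

Lemma Ex_abs (f : V) : `|Ex f| <= Ex (babs f).
Proof.
rewrite ler_norml; apply/andP; split; last by apply: Ex_le => x; rewrite bfunE ler_norm.
rewrite -raddfN/=; apply: Ex_le => x; rewrite !bfunE.
by rewrite lerNl -normrN ler_norm.
Qed.

Lemma Ex_ind A (mA : measurable A) : (Ex (bind R mA))%:E = P A.
Proof. by rewrite ExE /= integral_indic// setIT. Qed.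

Definition dot (f g : V) : R := Ex (bmul f g).
(** The square of the L^2 norm; contraction rates therefore appear squared wherever [nrm] is
    compared. *)
Definition nrm (f : V) : R := dot f f.

Lemma dotC f g : dot f g = dot g f.
Proof. by congr Ex; apply: bfun_ext => x /=; rewrite mulrC. Qed.

Lemma dotDl f g h : dot (f + g) h = dot f h + dot g h.
Proof. by rewrite -ExD; congr Ex; apply: bfun_ext => x; rewrite !bfunE; ring. Qed.
Lemma dotZl a f h : dot (a *: f) h = a * dot f h.
Proof. by rewrite -ExZ; congr Ex; apply: bfun_ext => x; rewrite !bfunE; ring. Qed.
Lemma dotNl f h : dot (- f) h = - dot f h.
Proof. by rewrite -scaleN1r dotZl mulN1r. Qed.
Lemma dotBl f g h : dot (f - g) h = dot f h - dot g h.
Proof. by rewrite dotDl dotNl. Qed.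
Lemma dot0l h : dot 0 h = 0.
Proof. by rewrite -(scale0r 0) dotZl mul0r. Qed.
Lemma dotDr f g h : dot h (f + g) = dot h f + dot h g.
Proof. by rewrite !(dotC h) dotDl. Qed.
Lemma dotZr a f h : dot h (a *: f) = a * dot h f.
Proof. by rewrite !(dotC h) dotZl. Qed.
Lemma dotNr f h : dot h (- f) = - dot h f.
Proof. by rewrite !(dotC h) dotNl. Qed.
Lemma dotBr f g h : dot h (f - g) = dot h f - dot h g.
Proof. by rewrite !(dotC h) dotBl. Qed.
Lemma dot0r h : dot h 0 = 0. Proof. by rewrite dotC dot0l. Qed.
Definition dotE := (dotDl, dotDr, dotBl, dotBr, dotNl, dotNr, dotZl, dotZr, dot0l, dot0r).

Lemma dot1l f : dot (bcst 1) f = Ex f.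
Proof. by congr Ex; apply: bfun_ext => x; rewrite !bfunE mul1r. Qed.

Lemma nrm_ge0 f : 0 <= nrm f.
Proof. by apply: Ex_ge0 => x; rewrite bfunE -expr2 sqr_ge0. Qed.

Lemma nrmZ a f : nrm (a *: f) = a ^+ 2 * nrm f.
Proof. by rewrite /nrm !dotE; ring. Qed.

Lemma nrmN f : nrm (- f) = nrm f.
Proof. by rewrite /nrm !dotE; ring. Qed.

Lemma nrmD f g : nrm (f + g) = nrm f + 2 * dot f g + nrm g.
Proof. by rewrite /nrm !dotE (dotC g f); ring. Qed.

Lemma nrmB f g : nrm (f - g) = nrm f - 2 * dot f g + nrm g.
Proof. by rewrite /nrm !dotE (dotC g f); ring. Qed.

Lemma dot_le (f g h k : V) : (forall x, f x * g x <= h x * k x) -> dot f g <= dot h k.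
Proof. by move=> H; apply: (@Ex_le (bmul f g) (bmul h k)) => x; exact: H. Qed.

Lemma cauchy_schwarz f g : dot f g ^+ 2 <= nrm f * nrm g.
Proof.
have H a b : 0 <= a ^+ 2 * nrm f + 2 * (a * b * dot f g) + b ^+ 2 * nrm g.
  by have := nrm_ge0 (a *: f + b *: g); rewrite nrmD !nrmZ !dotE; lra.
have f0 := nrm_ge0 f; have g0 := nrm_ge0 g.
have [fp|fn] := ltP 0 (nrm f).
  by have := H (- dot f g) (nrm f); nra.
(* [nrm] vanishes on functions that are null almost everywhere, so the degenerate case needs test
   points of its own. *)
have f00 : nrm f = 0 by apply: le_anti; rewrite fn f0.
rewrite f00 mul0r.
have [gp|gn] := ltP 0 (nrm g).
  by have := H (- nrm g) (dot f g); rewrite f00; nra.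
by have := H (- dot f g) 1; rewrite f00; nra.
Qed.

Lemma Ex_sqr_le f : Ex f ^+ 2 <= nrm f.
Proof.
have := cauchy_schwarz (bcst 1) f.
by rewrite {1}/nrm !dot1l Ex_cst mul1r.
Qed.

Lemma nrmD_le f g : nrm (f + g) <= 2 * nrm f + 2 * nrm g.
Proof. by have := nrm_ge0 (f - g); rewrite nrmB nrmD; lra. Qed.

Lemma nrm_le (f g : V) : (forall x, `|f x| <= `|g x|) -> nrm f <= nrm g.
Proof. by move=> fg; apply: dot_le => x; rewrite -!expr2 -(real_normK (num_real (f x))) -(real_normK (num_real (g x))) lerXn2r ?nnegrE. Qed.

End expect.
Arguments dot {d T R}.
Arguments nrm {d T R}.

(** * Positive and symmetric operators, Markov operators, spectral gaps *)

Lemma iter_is_linear (R : pzRingType) (V : lmodType R) n (A : {linear V -> V}) :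
  linear (iter n A).
Proof. by elim: n => [//|n IH] a f g; rewrite !iterS IH linearP. Qed.

HB.instance Definition _ (R : pzRingType) (V : lmodType R) n
  (A : {linear V -> V}) := GRing.isLinear.Build R V V *:%R (iter n A)
    (iter_is_linear n A).

Lemma expr_small (R : realType) (z e : R) : 0 <= z < 1 -> 0 < e ->
  exists n, z ^+ n < e.
Proof.
move=> /andP[z0 z1] e0.
have /cvgrPdist_lt /(_ e e0) [n _ /(_ n (leqnn n))/=] := @cvg_expr R z (ltac:(by rewrite ger0_norm)).
rewrite sub0r normrN ger0_norm ?exprn_ge0// => H.
by exists n.
Qed.

Section operators.
Context d (T : measurableType d) (R : realType) (pi : probability T R).
Local Notation V := (bfun T R).
Local Notation Ex := (Ex pi).
Local Notation dot := (dot pi).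
Local Notation nrm := (nrm pi).
Local Notation one := (bcst 1 : V).
Implicit Types (f g h : V) (A B K : {linear V -> V}).

Definition nonneg f := forall x, 0 <= f x.
Definition symop (A : V -> V) := forall f g, dot f (A g) = dot (A f) g.
Definition posop (A : V -> V) := forall f, nonneg f -> nonneg (A f).
Definition leop (A B : V -> V) := forall f, nonneg f -> forall x, A f x <= B f x.

Lemma iter_symop A n : symop A -> symop (iter n A).
Proof. by move=> sA; elim: n => [//|n IH] f g; rewrite iterS sA IH -iterSr. Qed.

Lemma iter_posop A n : posop A -> posop (iter n A).
Proof. by move=> pA; elim: n => [//|n IH] f f0; apply: pA; exact: IH. Qed.

Lemma posop_le A f g : posop A -> (forall x, f x <= g x) ->
  forall x, A f x <= A g x.
Proof.
move=> pA fg x; rewrite -subr_ge0 -bfunB_ -linearB; apply: pA => y.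
by rewrite bfunE subr_ge0.
Qed.

Lemma posop_abs A f x : posop A -> `|A f x| <= A (babs f) x.
Proof.
move=> pA; rewrite ler_norml; apply/andP; split; last first.
  by apply: posop_le => // y; rewrite bfunE ler_norm.
rewrite -bfunN -linearN; apply: posop_le => // y; rewrite !bfunE.
by rewrite lerNl -normrN ler_norm.
Qed.

Lemma iter_leop A B n : posop A -> posop B -> leop A B ->
  leop (iter n A) (iter n B).
Proof.
move=> pA pB AB f f0; elim: n => [//|n IH] x; rewrite !iterS.
apply: (le_trans (posop_le pA IH x)); apply: AB.
exact: iter_posop.
Qed.

Lemma nrm_triangle f g (a b : R) : 0 <= a -> 0 <= b ->
  nrm f <= a ^+ 2 -> nrm g <= b ^+ 2 -> nrm (f + g) <= (a + b) ^+ 2.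
Proof.
move=> a0 b0 fa gb; rewrite nrmD.
have H : dot f g <= a * b.
  apply: (le_trans (ler_norm _)).
  rewrite -ler_sqr ?nnegrE ?mulr_ge0// real_normK ?num_real//.
  by rewrite (le_trans (cauchy_schwarz _ _ _))// exprMn ler_pM ?nrm_ge0.
nra.
Qed.

(* The numerical radius of a symmetric operator bounds its norm, by polarization
   at f and A f / r. *)
Lemma symop_norm_le A (W : V -> Prop) (r : R) : 0 < r -> symop A ->
  (forall f, W f -> W (A f)) ->
  (forall a f g, W f -> W g -> W (a *: f + g)) ->
  (forall f, W f -> `|dot f (A f)| <= r * nrm f) ->
  forall f, W f -> nrm (A f) <= r ^+ 2 * nrm f.
Proof.
move=> r0 sA WA Wl rA f Wf.
have Wp a : W (a *: A f + f) by apply: Wl => //; exact: WA.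
have := rA _ (Wp r^-1); have := rA _ (Wp (- r^-1)).
have LA c : A (c *: A f + f) = c *: A (A f) + A f by rewrite linearP.
rewrite !ler_norml !LA => /andP[+ _] /andP[_ +].
rewrite !nrmD !nrmZ !dotE.
have -> : dot (A f) (A (A f)) = dot (A (A f)) (A f) by rewrite dotC.
rewrite (sA f (A f)) -/(nrm (A f)) -/(nrm f) (dotC pi (A (A f))).
have nA := nrm_ge0 pi (A f).
set a := nrm (A f) in nA *; set b := nrm f; set c := dot (A f) (A (A f)).
set e := dot f (A f); rewrite (dotC pi (A f) f) -/e => H1 H2.
have rV : r * r^-1 = 1 by rewrite mulfV// gt_eqF.
have H : 4 * r^-1 * a <= r * (2 * b + 2 * r^-1 ^+ 2 * a) by lra.
have : r * (4 * r^-1 * a) <= r * (r * (2 * b + 2 * r^-1 ^+ 2 * a)).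
  by rewrite ler_pM2l.
have -> : r * (4 * r^-1 * a) = 4 * a * (r * r^-1) by ring.
have -> : r * (r * (2 * b + 2 * r^-1 ^+ 2 * a)) =
  2 * (r ^+ 2 * b) + 2 * a * (r * r^-1) ^+ 2 by ring.
rewrite rV; lra.
Qed.

(* nrm (A^n f) is log-convex in n, so its asymptotic decay rate bounds its
   first ratio. *)
Lemma symop_decay A f (rho C : R) : 0 < rho -> symop A ->
  (forall n, nrm (iter n A f) <= C * (rho ^+ 2) ^+ n) ->
  nrm (A f) <= rho ^+ 2 * nrm f.
Proof.
move=> r0 sA dec; rewrite leNgt; apply/negP => lt1.
pose u n := nrm (iter n A f).
have u0 n : 0 <= u n by exact: nrm_ge0.
have conv n : u n.+1 ^+ 2 <= u n * u n.+2.
  have -> : u n.+1 = dot (iter n A f) (iter n.+2 A f).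
    by rewrite [RHS]sA.
  exact: cauchy_schwarz.
have f0 : 0 < nrm f.
  rewrite lt_neqAle nrm_ge0 andbT; apply/negP => /eqP f0.
  have := conv 0%N; rewrite /u/= -f0 mul0r => H.
  by move: lt1; rewrite -f0 mulr0; have := sqr_ge0 (nrm (A f)); nra.
pose th := nrm (A f) / nrm f.
have thr : rho ^+ 2 < th by rewrite /th ltr_pdivlMr.
have r2 : 0 < rho ^+ 2 by rewrite exprn_gt0.
have th0 : 0 < th by exact: lt_trans thr.
have grow n : 0 < u n /\ th * u n <= u n.+1.
  elim: n => [|n [un IH]].
    by split=> //; rewrite /th /u/= mulfVK// gt_eqF.
  have un1 : 0 < u n.+1 by apply: lt_le_trans IH; rewrite mulr_gt0.
  split=> //; rewrite -(ler_pM2l un) (le_trans _ (conv n))//.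
  by rewrite expr2 mulrA ler_pM2r// mulrC.
have lb n : th ^+ n * nrm f <= u n.
  elim: n => [|n IH]; first by rewrite expr0 mul1r.
  have [_ +] := grow n; apply: le_trans.
  by rewrite exprS -mulrA ler_pM2l.
have C0 : 0 < C.
  have := dec 0%N; rewrite expr0 mulr1 /=; exact: lt_le_trans.
have [n] := @expr_small R (rho ^+ 2 / th) (nrm f / C) (ltac:(by
  rewrite divr_ge0 ?ltW//= ltr_pdivrMr// mul1r)) (divr_gt0 f0 C0).
rewrite expr_div_n ltr_pdivlMr// mulrAC ltr_pdivrMr ?exprn_gt0//.
have := le_trans (lb n) (dec n); lra.
Qed.

Section markov.
Variable K : {linear V -> V}.
Hypotheses (pK : posop K) (sK : symop K) (K1 : K one = one).

Lemma iter_markov1 n : iter n K one = one.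
Proof. by elim: n => //= n ->. Qed.

Lemma Ex_markov f : Ex (K f) = Ex f.
Proof. by rewrite -!(dot1l pi) sK K1. Qed.

Lemma Ex_iter_markov n f : Ex (iter n K f) = Ex f.
Proof. by elim: n => //= n <-; rewrite Ex_markov. Qed.

Lemma markov_cst a : K (bcst a) = bcst a.
Proof.
have -> : bcst a = a *: one by apply: bfun_ext => x; rewrite !bfunE mulr1.
by rewrite linearZ/= K1.
Qed.

(** Positivity is applied to the square [(f - a)^2] centered at [a = K f x], expanded so that
    [K 1 = 1] finishes the computation. *)
Lemma markov_jensen f x : K f x ^+ 2 <= K (bmul f f) x.
Proof.
set a := K f x.
have /(_ x) : nonneg (K (bmul f f - (2 * a) *: f + bcst (a ^+ 2))).
  apply: pK => y; rewrite !bfunE; have := sqr_ge0 (f y - a); nra.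
rewrite linearD linearB linearZ/= markov_cst !bfunE -/a; nra.
Qed.

Lemma nrm_markov f : nrm (K f) <= nrm f.
Proof.
rewrite -[leRHS]Ex_markov; apply: Ex_le => x; rewrite bfunE -expr2.
exact: markov_jensen.
Qed.

Lemma nrm_iter_markov n f : nrm (iter n K f) <= nrm f.
Proof. by elim: n => //= n; apply: le_trans; exact: nrm_markov. Qed.

Lemma markov_bound f (a : R) : (forall x, `|f x| <= a) -> forall x, `|K f x| <= a.
Proof.
move=> fa x; apply: (le_trans (posop_abs f x pK)).
by rewrite -[leRHS](bcstE a x) -(markov_cst a); apply: posop_le.
Qed.

Lemma iter_markov_bound n f (a : R) : (forall x, `|f x| <= a) ->
  forall x, `|iter n K f x| <= a.
Proof. by move=> fa; elim: n => //= n IH; exact: markov_bound. Qed.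

Definition centered f : V := f - bcst (Ex f).

Lemma Ex_center f : Ex (centered f) = 0.
Proof. by rewrite ExB Ex_cst subrr. Qed.

Lemma dot_cstl a f : dot (bcst a) f = a * Ex f.
Proof.
have -> : bcst a = a *: one by apply: bfun_ext => x; rewrite !bfunE mulr1.
by rewrite dotZl dot1l.
Qed.

Lemma dot_cstr a f : dot f (bcst a) = a * Ex f.
Proof. by rewrite dotC dot_cstl. Qed.

Lemma nrm_center f : nrm (centered f) = nrm f - Ex f ^+ 2.
Proof. by rewrite nrmB dot_cstr /nrm dot_cstl Ex_cst; ring. Qed.

Lemma iter_markov_cst n a : iter n K (bcst a) = bcst a.
Proof. by elim: n => //= n ->; exact: markov_cst. Qed.

Lemma iter_center n f : iter n K (centered f) = centered (iter n K f).
Proof. by rewrite linearB/= iter_markov_cst /centered Ex_iter_markov. Qed.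

Lemma dot_iter_center n f g :
  dot (centered f) (iter n K (centered g)) = dot f (iter n K g) - Ex f * Ex g.
Proof.
rewrite iter_center /centered !dotE !dot_cstr !dot_cstl Ex_iter_markov Ex_cst.
ring.
Qed.

(** A Rayleigh quotient near 1 makes [f] almost fixed: [|f - K f|^2 <= 2 e |f|^2]. As [K] contracts,
    [|f - K^k f|] is at most [k] times as large as this bound on [|f - K f|], hence at most
    [|f| / 2] by the assumption on [e], and Cauchy-Schwarz concludes. *)
Lemma iter_almost_fixed f k (e : R) : 2 * k%:R ^+ 2 * e <= 4^-1 ->
  (1 - e) * nrm f <= dot f (K f) -> 2^-1 * nrm f <= dot f (iter k K f).
Proof.
move=> ke fe; set e1 := nrm f - dot f (K f).
have f0 := nrm_ge0 pi f.
have s0 : nrm (f - K f) <= 2 * e1.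
  by rewrite nrmB /e1; have := nrm_markov f; lra.
have e10 : 0 <= 2 * e1 by apply: le_trans s0; exact: nrm_ge0.
have sk : nrm (f - iter k K f) <= (k%:R * Num.sqrt (2 * e1)) ^+ 2.
  elim: k {ke} => [|k IH]; first by rewrite subrr mul0r expr0n /nrm dot0l.
  rewrite (_ : _ - _ = (f - iter k K f) + iter k K (f - K f)); last first.
    by rewrite linearB/= -iterSr/= addrA subrK.
  rewrite -natr1 mulrDl mul1r; apply: nrm_triangle; rewrite ?mulr_ge0 ?sqrtr_ge0//.
  by rewrite sqr_sqrtr// (le_trans (nrm_iter_markov _ _)).
have := cauchy_schwarz pi f (f - iter k K f); rewrite dotBr -/(nrm f).
rewrite exprMn sqr_sqrtr// in sk => H.
have e1e : e1 <= e * nrm f by rewrite /e1; lra.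
have H2 : nrm f * nrm (f - iter k K f) <= 4^-1 * nrm f ^+ 2.
  rewrite expr2 mulrA (mulrC 4^-1) -mulrA ler_wpM2l//.
  rewrite (le_trans sk)// mulrA.
  have k0 : 0 <= k%:R ^+ 2 * 2 :> R by rewrite mulr_ge0 ?sqr_ge0.
  rewrite (le_trans (ler_wpM2l k0 e1e))// mulrA ler_wpM2r//; lra.
set u := dot f (iter k K f) in H *; nra.
Qed.

Definition gap (g : R) := forall f, Ex f = 0 -> nrm (K f) <= g ^+ 2 * nrm f.

Lemma gap_iter (g : R) n f : gap g -> Ex f = 0 ->
  nrm (iter n K f) <= (g ^+ 2) ^+ n * nrm f.
Proof.
move=> gK f0; elim: n => [|n IH]; first by rewrite expr0 mul1r.
rewrite iterS; apply: (le_trans (gK _ _)); first by rewrite Ex_iter_markov.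
by rewrite [_ ^+ n.+1]exprS -mulrA ler_wpM2l ?sqr_ge0.
Qed.

Lemma gap_dot (g : R) n f : 0 <= g -> gap g -> Ex f = 0 ->
  `|dot f (iter n K f)| <= g ^+ n * nrm f.
Proof.
move=> g0 gK f0.
rewrite -ler_sqr ?nnegrE ?mulr_ge0 ?nrm_ge0 ?exprn_ge0// real_normK ?num_real//.
rewrite (le_trans (cauchy_schwarz _ _ _))// exprMn mulrC.
rewrite [(nrm f) ^+ 2]expr2 mulrA ler_wpM2r ?nrm_ge0//.
by rewrite exprAC; exact: gap_iter.
Qed.

Lemma two_sided_gap (a b : R) : 0 <= a < 1 -> 0 <= b < 1 ->
  (forall f, Ex f = 0 -> dot f (K f) <= a * nrm f) ->
  (forall f, Ex f = 0 -> - b * nrm f <= dot f (K f)) ->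
  exists2 r, 0 < r < 1 & gap r.
Proof.
move=> /andP[a0 a1] /andP[b0 b1] Ha Hb.
(* The floor 1/2 keeps [r] positive when [a] and [b] vanish, as the polarization in [symop_norm_le]
   divides by [r]. *)
pose r := Num.max (Num.max a b) 2^-1.
have r12 : 2^-1 <= r by rewrite le_max lexx orbT.
have ar : a <= r by rewrite !le_max lexx.
have br : b <= r by rewrite !le_max lexx orbT.
exists r.
  by rewrite (lt_le_trans _ r12)//= !gt_max a1 b1/=; lra.
move=> f f0; apply: (@symop_norm_le K (fun f => Ex f = 0)) => //; first lra.
- by move=> g g0; rewrite Ex_markov.
- by move=> c g h g0 h0; rewrite ExD ExZ g0 h0 mulr0 addr0.
- move=> g g0; have n0 := nrm_ge0 pi g; rewrite ler_norml.
  have := Ha _ g0; have := Hb _ g0; nra.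
Qed.

End markov.

End operators.

(** * A pointwise envelope from a spectral gap *)

(** The error budget of [dot_remainder_unit]: [a <= 2 q + (F - G) + 256 x], where each of the three
    terms is at most 1/8; the exponent 11 is there for the last one. *)
Lemma remainder_arith (R : realFieldType) (q m F G x a b c e : R) :
  q <= 16^-1 -> x <= 2^-1 ^+ 11 -> m <= q -> F - G <= 8^-1 ->
  - m <= e + b - G -> c + a - F <= q -> b <= 256 * x -> e <= c -> a <= 2^-1.
Proof. lra. Qed.

Section small_remainder.
Context d (T : measurableType d) (R : realType) (pi : probability T R).
Local Notation V := (bfun T R).
Local Notation Ex := (Ex pi).
Local Notation dot := (dot pi).
Local Notation nrm := (nrm pi).
Local Notation one := (bcst 1 : V).
Implicit Types (f g h : V).
(** In the application [K] is an accept-reject kernel, [C] is multiplication by its rejection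
    probability, and [A] adds to [C] the accepted moves with their density truncated at [L] times
    the target density. *)
Variables K A C : {linear V -> V}.
Hypotheses (pK : posop K) (sK : symop pi K) (K1 : K one = one).
Hypotheses (pA : posop A) (sA : symop pi A) (AK : leop A K).
Hypotheses (pC : posop C) (sC : symop pi C) (CA : leop C A).
Variable L : R.
Hypothesis L0 : 0 <= L.
Hypothesis ACL : forall f, nonneg f -> forall x, A f x - C f x <= L * Ex f.
Variable m : nat.

(* An m-step path using A - C at least once has transition density at most m L
   with respect to pi; the remainder collects the other paths. *)
Definition smooth_part f : V := iter m A f - iter m C f.
Definition remainder f : V := iter m K f - smooth_part f.

Lemma smooth_part_is_linear : linear smooth_part.
Proof.
move=> a f g; rewrite /smooth_part !iter_is_linear scalerBr opprD.
by rewrite addrACA.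
Qed.
HB.instance Definition _ :=
  GRing.isLinear.Build R V V *:%R smooth_part smooth_part_is_linear.

Lemma remainder_is_linear : linear remainder.
Proof.
move=> a f g; rewrite /remainder iter_is_linear smooth_part_is_linear opprD.
rewrite (scalerBr a (iter m K f) (smooth_part f)).
by rewrite addrACA.
Qed.
HB.instance Definition _ :=
  GRing.isLinear.Build R V V *:%R remainder remainder_is_linear.

Lemma iter_split f : iter m K f = smooth_part f + remainder f.
Proof. by rewrite /remainder addrC subrK. Qed.

Lemma smooth_part_pos : posop smooth_part.
Proof.
move=> f f0 x; rewrite bfunE subr_ge0.
exact: iter_leop.
Qed.

Lemma remainder_pos : posop remainder.
Proof.
move=> f f0 x; rewrite !bfunE opprB addrCA addr_ge0//.
  exact: (iter_posop _ pC).
by rewrite subr_ge0; exact: iter_leop.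
Qed.

Lemma remainder_sym : symop pi remainder.
Proof.
move=> f g; rewrite !dotE.
by rewrite (iter_symop m sA) (iter_symop m sC) (iter_symop m sK).
Qed.

Lemma Ex_le_op B f : posop B -> leop B K -> nonneg f -> Ex (B f) <= Ex f.
Proof.
move=> pB BK f0; rewrite -[leRHS](Ex_markov sK K1); apply: Ex_le => x.
exact: BK.
Qed.

(** Telescoping [A^(n+1) - C^(n+1) = (A - C) A^n + C (A^n - C^n)]: each step costs [L * Ex f], since
    [A] does not increase means of nonnegative functions and [C], being below [K], does not increase
    constants. *)
Lemma smooth_part_le f x : nonneg f -> smooth_part f x <= m%:R * L * Ex f.
Proof.
move=> f0; rewrite bfunE.
have Ef0 : 0 <= Ex f by exact: Ex_ge0.
have CK : leop C K by move=> h h0 y; exact: le_trans (CA h0 y) (AK h0 y).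
elim: m x => [|n IH] x; first by rewrite subrr !mul0r.
have pAn : nonneg (iter n A f) by exact: iter_posop.
rewrite !iterS (_ : _ - _ = (A (iter n A f) x - C (iter n A f) x) +
  C (iter n A f - iter n C f) x); last by rewrite linearB bfunB_; ring.
rewrite -natr1 !mulrDl mul1r addrC lerD//.
  apply: (@le_trans _ _ (C (bcst (n%:R * L * Ex f)) x)).
    by apply: posop_le => // y; rewrite !bfunE.
  apply: (le_trans (CK _ _ x)).
    by move=> y; rewrite bfunE !mulr_ge0.
  by rewrite (markov_cst K1) bfunE.
rewrite (le_trans (ACL pAn x))// ler_wpM2l//.
rewrite -[leRHS](Ex_iter_markov sK K1 n); apply: Ex_le => y.
exact: iter_leop.
Qed.

(** The mass missing from [A^m 1] is lost one step at a time, at most [1 - Ex (A 1)] per step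
    because [A <= K] and [K] preserves means. *)
Lemma Ex_remainder1 :
  Ex (remainder one) <= m%:R * (1 - Ex (A one)) + Ex (iter m C one).
Proof.
rewrite /remainder /smooth_part !ExB (iter_markov1 K1) Ex_cst opprB addrCA.
rewrite addrC lerD2r.
have An1 n x : iter n A one x <= 1.
  apply: (le_trans (iter_leop n pA pK AK _ _)) => //.
  by rewrite iter_markov1.
have EA1 : Ex (A one) <= 1 by rewrite -[leRHS](Ex_cst pi 1); apply: Ex_le => x; exact: (An1 1).
elim: m => [|n IH]; first by rewrite Ex_cst subrr mul0r.
rewrite -natr1 mulrDl mul1r.
have -> : 1 - Ex (iter n.+1 A one) = Ex (A (one - iter n A one)) + (1 - Ex (A one)).
  by rewrite !linearB/=; ring.
rewrite lerD2r; apply: le_trans IH.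
rewrite (_ : 1 - _ = Ex (one - iter n A one)); last by rewrite ExB Ex_cst.
apply: Ex_le_op => //.
by move=> x; rewrite !bfunE subr_ge0.
Qed.

Variable q : R.
Hypothesis q0 : 0 <= q.
Hypothesis q16 : q <= 16^-1.
Hypothesis Kq : forall f, Ex f = 0 -> nrm (iter m K f) <= q ^+ 2 * nrm f.
Hypothesis R1 : Ex (remainder one) <= 2^-1 ^+ 11.

Lemma dot_center_bound f : `|dot f (iter m K f) - Ex f ^+ 2| <= q * nrm f.
Proof.
rewrite expr2 -(dot_iter_center sK K1).
apply: (@le_trans _ _ (q * nrm (centered pi f))); last first.
  by rewrite ler_wpM2l// nrm_center gerBl sqr_ge0.
set g := centered pi f; have g0 : Ex g = 0 by exact: Ex_center.
rewrite -ler_sqr ?nnegrE ?mulr_ge0 ?nrm_ge0// real_normK ?num_real//.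
rewrite (le_trans (cauchy_schwarz _ _ _))// exprMn mulrC.
by rewrite [(nrm g) ^+ 2]expr2 mulrA ler_wpM2r ?nrm_ge0//; exact: Kq.
Qed.

(* The remainder is small on the truncation g of f at 16, as it is small on the
   constant 1; the gap compares f and g because Ex f and Ex g are close. *)
Lemma dot_remainder_unit f : nonneg f -> nrm f = 1 ->
  dot f (remainder f) <= 2^-1.
Proof.
move=> f0 f1.
have E0 : 0 <= Ex f by exact: Ex_ge0.
have E1 : Ex f <= 1.
  by rewrite -(@ler_pXn2r _ 2%N)// ?nnegrE// expr1n -[leRHS]f1 Ex_sqr_le.
(* The level 16 balances two losses: truncation lowers the mean by at most 1/16, and the remainder
   of [g] costs a factor 16^2 = 256, once from [g <= 16] outside and once inside the remainder. *)
pose g := bmin 16 f.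
have g0 : nonneg g by move=> x; rewrite bfunE le_min f0 andbT; lra.
have gf x : g x <= f x by rewrite bfunE ge_min lexx orbT.
have g16 x : g x <= 16 by rewrite bfunE ge_min lexx.
have ng : nrm g <= 1 by rewrite -f1; apply: nrm_le => x; rewrite !ger0_norm.
have Eg0 : 0 <= Ex g by exact: Ex_ge0.
have Egf : Ex g <= Ex f by exact: Ex_le.
(* Pointwise [f - min(16, f) <= f^2 / 16], and [nrm f = 1]. *)
have Eg : Ex f - 16^-1 <= Ex g.
  rewrite lerBlDr -lerBlDl -ExB -[leRHS]mulr1 -[X in _ * X]f1 -ExZ.
  apply: Ex_le => x.
  rewrite !bfunE /Num.min; have := f0 x; have := sqr_ge0 (f x - 8).
  by case: ifPn; rewrite -?leNgt => *; nra.
have : dot g (smooth_part g) <= dot f (smooth_part f).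
  apply: dot_le => x; apply: ler_pM => //; first exact: smooth_part_pos.
  by apply: posop_le => //; exact: smooth_part_pos.
have : dot g (remainder g) <= 256 * Ex (remainder one).
  rewrite -ExZ; apply: Ex_le => x; rewrite bmulE bfunZ.
  have : remainder g x <= 16 * remainder one x.
    rewrite -bfunZ -linearZ; apply: posop_le; first exact: remainder_pos.
    by move=> y; rewrite [leRHS]mulr1.
  have := remainder_pos g0 x; have := g0 x; have := g16 x; nra.
have := dot_center_bound f; have := dot_center_bound g.
have sp h : dot h (iter m K h) = dot h (smooth_part h) + dot h (remainder h).
  by rewrite -dotDr -iter_split.
rewrite !sp !ler_norml => /andP[+ _] /andP[_].
have FG : Ex f ^+ 2 - Ex g ^+ 2 <= 8^-1 by nra.
have qg : q * nrm g <= q by rewrite ler_piMr.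
rewrite f1 mulr1 => H1 H2 H3 H4.
exact: remainder_arith q16 R1 qg FG H1 H2 H3 H4.
Qed.

(** Positivity of the remainder allows passing to [|f|], and homogeneity to norm 1; a function of
    norm 0 is handled by Cauchy-Schwarz. *)
Lemma dot_remainder_le f : `|dot f (remainder f)| <= 2^-1 * nrm f.
Proof.
apply: (@le_trans _ _ (dot (babs f) (remainder (babs f)))).
  apply: (le_trans (Ex_abs _ _)); apply: Ex_le => x.
  rewrite babsE !bmulE babsE normrM ler_wpM2l//.
  by apply: posop_abs; exact: remainder_pos.
have -> : nrm f = nrm (babs f).
  by congr Ex; apply: bfun_ext => x; rewrite !bfunE -!expr2 real_normK ?num_real.
have : nonneg (babs f) by move=> x; rewrite bfunE.
move: (babs f) => {}f f0.
have := nrm_ge0 pi f; rewrite le_eqVlt => /predU1P[n0|n0].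
  rewrite -n0 mulr0; apply: (le_trans (ler_norm _)).
  rewrite -ler_sqr ?nnegrE// real_normK ?num_real// expr0n/=.
  by rewrite (le_trans (cauchy_schwarz _ _ _))// -n0 mul0r.
pose s := Num.sqrt (nrm f); have s0 : 0 < s by rewrite sqrtr_gt0.
have s2 : s ^+ 2 = nrm f by rewrite sqr_sqrtr// ltW.
have := @dot_remainder_unit (s^-1 *: f).
have -> : remainder (s^-1 *: f) = s^-1 *: remainder f by rewrite linearZ.
rewrite dotZl dotZr nrmZ -s2 -exprMn mulVf ?gt_eqF// expr1n.
have -> : s^-1 * (s^-1 * dot f (remainder f)) = dot f (remainder f) / s ^+ 2.
  by rewrite expr2 invfM; ring.
rewrite ler_pdivrMr ?exprn_gt0//; apply => // x.
by rewrite bfunE mulr_ge0// invr_ge0 ltW.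
Qed.

Lemma nrm_remainder f : nrm (remainder f) <= 4^-1 * nrm f.
Proof.
have -> : 4^-1 = 2^-1 ^+ 2 :> R by rewrite exprVn -natrX.
apply: (@symop_norm_le _ _ _ pi remainder (fun=> True)) => //.
- exact: remainder_sym.
- by move=> g _; exact: dot_remainder_le.
Qed.

Lemma Ex_iter_remainder n : Ex (iter n remainder one) <= 2^-1 ^+ n.
Proof.
have n0 : 0 <= Ex (iter n remainder one).
  by apply: Ex_ge0; apply: iter_posop => //; exact: remainder_pos.
rewrite -ler_sqr ?nnegrE ?exprn_ge0// (le_trans (Ex_sqr_le _ _))//.
rewrite exprAC exprVn -natrX /=.
elim: n {n0} => [|n IH]; first by rewrite /nrm/= dot_cstl Ex_cst mulr1.
by rewrite iterS (le_trans (nrm_remainder _))// exprS ler_wpM2l.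
Qed.

Let a := m%:R * L.

(** A common pointwise majorant of the n-th iterates of [K^m] on all centered [g] with [|g| <= 1].
    The remainder transports the previous majorant; the smooth part sees only the mean of the
    absolute value of the previous iterate, which the gap bounds by [3^-1 ^+ n'], and multiplies it
    by at most [a = m L]. *)
Fixpoint envelope n : V :=
  if n is n'.+1 then remainder (envelope n') + (a * 3^-1 ^+ n') *: one else one.

Lemma iter_envelope g n : Ex g = 0 -> (forall x, `|g x| <= 1) ->
  forall x, `|iter n (iter m K) g x| <= envelope n x.
Proof.
move=> g0 g1.
have Qg k : Ex (iter k (iter m K) g) = 0 /\
    nrm (iter k (iter m K) g) <= (3^-1 ^+ k) ^+ 2.
  elim: k => [|k [IE IH]] /=.
    split=> //; rewrite expr1n -[leRHS](Ex_cst pi 1); apply: Ex_le => x.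
    have := g1 x; rewrite !bfunE ler_norml => /andP[]; nra.
  rewrite Ex_iter_markov//; split=> //; apply: (le_trans (Kq IE)).
  have q2 : q ^+ 2 <= 3^-1 ^+ 2 by rewrite lerXn2r ?nnegrE//; move: q16; lra.
  by rewrite [3^-1 ^+ k.+1]exprS exprMn ler_pM ?sqr_ge0 ?nrm_ge0.
elim: n => [|n IH] x; first exact: g1.
rewrite iterS iter_split bfunD (le_trans (ler_normD _ _))// addrC.
set u := iter n _ g in IH *.
rewrite -[envelope n.+1]/(remainder (envelope n) + (a * 3^-1 ^+ n) *: one).
rewrite bfunD lerD//.
  apply: (le_trans (posop_abs _ _ remainder_pos)).
  by apply: posop_le; [exact: remainder_pos|].
apply: (le_trans (posop_abs _ _ smooth_part_pos)).
apply: (le_trans (smooth_part_le _ _)).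
  by move=> y; rewrite bfunE.
rewrite bfunZ bfunE mulr1 ler_wpM2l// ?mulr_ge0//.
rewrite -ler_sqr ?nnegrE ?exprn_ge0// ?Ex_ge0//; last first.
  by move=> y; rewrite bfunE.
rewrite (le_trans (Ex_sqr_le _ _))//.
apply: le_trans (Qg n).2; apply: nrm_le => y.
by rewrite bfunE normr_id.
Qed.

(** Unfolding the envelope under an expectation produces iterates of the remainder, so the induction
    carries [iter k remainder]. The factor [6 a (1 - (2/3)^n)] is the closed form of the geometric
    sum of the terms [a 3^-i 2^-(n-1-i)], divided by [2^-n]. *)
Lemma Ex_envelope n : Ex (envelope n) <= (1 + 6 * a) * 2^-1 ^+ n.
Proof.
have a0 : 0 <= a by rewrite mulr_ge0.
suff H k : Ex (iter k remainder (envelope n)) <=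
    (1 + 6 * a * (1 - (2 / 3) ^+ n)) * 2^-1 ^+ (n + k).
  rewrite (le_trans (H 0%N))// addn0 ler_wpM2r ?exprn_ge0// lerD2l.
  by rewrite ler_piMr ?mulr_ge0// gerBl exprn_ge0.
elim: n k => [|n IH] k /=.
  by rewrite expr0 subrr mulr0 addr0 mul1r; exact: Ex_iter_remainder.
rewrite linearD linearZ/= ExD ExZ -iterSr.
have := IH k.+1; have := Ex_iter_remainder k.
have t0 : 0 <= 3^-1 ^+ n :> R by rewrite exprn_ge0.
move=> /(ler_wpM2l (mulr_ge0 a0 t0)) H1 /lerD/(_ H1)/le_trans; apply.
rewrite addSnnS !exprD !exprS !exprMn.
set t := 3^-1 ^+ n; set u := 2^-1 ^+ n; set v := 2^-1 ^+ k; set w := 2 ^+ n.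
have wu : w * u = 1 by rewrite -exprMn mulfV// expr1n.
rewrite le_eqVlt; apply/orP; left; apply/eqP.
have -> : a * t * v = a * t * v * (w * u) by rewrite wu mulr1.
by field.
Qed.

End small_remainder.

(** * Kernels as operators *)

Section integral_density.
Context d (T : measurableType d) (R : realType).
Variables (mu nu : {measure set T -> \bar R}) (w : T -> R).
Hypotheses (mw : measurable_fun setT w) (w0 : forall x, 0 <= w x).
Hypothesis nuE : forall A, measurable A ->
  (nu A = \int[mu]_(x in A) (w x)%:E)%E.
Import HBNNSimple.
Local Open Scope ereal_scope.

Let ew0 x : 0 <= (w x)%:E. Proof. by rewrite lee_fin. Qed.
Let mew : measurable_fun setT (EFin \o w). Proof. exact/measurable_EFinP. Qed.

Let integral_density_nnsfun (f : {nnsfun T >-> R}) :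
  \int[nu]_x (f x)%:E = \int[mu]_x ((f x)%:E * (w x)%:E).
Proof.
have mf r : measurable (f @^-1` [set r]) by [].
under [LHS]eq_integral do rewrite fimfunE -fsumEFin//.
rewrite ge0_integral_fsum//; last 2 first.
  - by move=> r; exact/measurable_EFinP/measurableT_comp.
  - by move=> r z _; rewrite EFinM nnfun_muleindic_ge0.
under [RHS]eq_integral.
  move=> x _.
  rewrite fimfunE -fsumEFin// ge0_mule_fsuml; last first.
    by move=> r; rewrite EFinM nnfun_muleindic_ge0.
  over.
rewrite ge0_integral_fsum//; last 2 first.
  - move=> r; apply: emeasurable_funM => //.
    exact/measurable_EFinP/measurableT_comp.
  - by move=> r z _; rewrite mule_ge0// EFinM nnfun_muleindic_ge0.
apply: eq_fsbigr => r _.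
rewrite (integralZl_indic _ (fun r => f @^-1` [set r]))//; last first.
  by move=> r0; rewrite preimage_nnfun0.
rewrite integral_indic// setIT nuE//.
have [r0|r0] := leP 0%R r; last first.
  rewrite preimage_nnfun0// integral_set0 mule0 integral0_eq// => x _.
  by rewrite indic0 mulr0 mul0e.
under [RHS]eq_integral do rewrite EFinM -muleA.
rewrite ge0_integralZl//; last 2 first.
  - apply: emeasurable_funM => //.
    by apply/measurable_EFinP; exact: measurable_indic.
  - by move=> x _; rewrite mule_ge0// lee_fin.
congr (_ * _); rewrite integral_mkcond; apply: eq_integral => x _.
by rewrite patchE indicE; case: ifPn => _; rewrite ?mul1e ?mul0e.
Qed.

Lemma integral_density (f : T -> \bar R) : (forall x, 0 <= f x) ->
  measurable_fun setT f -> \int[nu]_x f x = \int[mu]_x (f x * (w x)%:E).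
Proof.
move=> f0 mf; pose f_ := nnsfun_approx measurableT mf.
transitivity (\int[nu]_x lim ((f_ n x)%:E @[n --> \oo])).
  by apply/eq_integral => x _; apply/esym/cvg_lim => //; exact: cvg_nnsfun_approx.
rewrite monotone_convergence//; last 3 first.
  by move=> n; exact/measurable_EFinP.
  by move=> n x _; rewrite lee_fin.
  by move=> x _ a b ab; rewrite lee_fin; exact/lefP/nd_nnsfun_approx.
under eq_fun do rewrite integral_density_nnsfun.
rewrite -monotone_convergence//; last 3 first.
  by move=> n; apply: emeasurable_funM => //; exact/measurable_EFinP.
  by move=> n x _; rewrite mule_ge0// lee_fin.
  move=> x _ a b ab; rewrite lee_wpmul2r// lee_fin.
  exact/lefP/nd_nnsfun_approx.
apply: eq_integral => x _; apply/cvg_lim => //.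
by apply: cvgeZr => //; exact: cvg_nnsfun_approx.
Qed.

End integral_density.

Section bfun_extension.
Context d (T : measurableType d) (R : realType).
Local Notation V := (bfun T R).

(** It extends to all bounded functions, by linearity, the identities obtained from Tonelli or
    monotone convergence for nonnegative ones. *)
Lemma bfun_shift (f : V) : exists g (a : R), [/\ nonneg g, 0 <= a & f = g - bcst a].
Proof.
have [M M0 fM] := bfunB f; exists (f + bcst M), M; split => //.
  by move=> x; rewrite !bfunE; have := fM x; rewrite ler_norml => /andP[]; lra.
by rewrite addrK.
Qed.

Lemma eq_nonneg_linear (U : lmodType R) (A B : {linear V -> U}) :
  (forall f, nonneg f -> A f = B f) -> A =1 B.
Proof.
move=> AB f; have [g [a [g0 a0 ->]]] := bfun_shift f.
by rewrite !linearB !AB// => x; rewrite bfunE.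
Qed.

End bfun_extension.

Section kernel_operator.
Context d d' (S : measurableType d) (T : measurableType d') (R : realType).
Variable P : R.-pker S ~> T.
Local Notation V := (bfun T R).

(** A name for [P x] that carries a canonical probability structure, so that [Ex] and its linearity
    apply to it. *)
Definition kernel_at (x : S) : set T -> \bar R := P x.

HB.instance Definition _ x := Measure.on (kernel_at x).
HB.instance Definition _ x := Measure_isProbability.Build _ _ _ (kernel_at x)
  (prob_kernel x).

Lemma kernel_Ex_measurable (f : V) :
  measurable_fun setT (fun x => Ex (kernel_at x) f).
Proof.
have [g [a [g0 a0 ->]]] := bfun_shift f.
under eq_fun do rewrite ExB Ex_cst.
apply: measurable_funB => //.
rewrite (_ : (fun _ => _) = fine \o (fun x => \int[P x]_y (g y)%:E)%E)//.
apply: measurableT_comp => //.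
apply: (@measurable_fun_integral_kernel _ _ _ _ _ P _ (EFin \o g)).
- by move=> U mU; exact: measurable_kernel.
- by move=> y; rewrite /= lee_fin.
- exact/measurable_EFinP/bfun_measurable.
Qed.

Lemma kernel_Ex_bounded (f : V) :
  exists M, forall x, `|Ex (kernel_at x) f| <= M.
Proof.
have [M M0 fM] := bfunB f; exists M => x.
rewrite (le_trans (Ex_abs _ _))// -[leRHS](Ex_cst (kernel_at x)).
exact: Ex_le.
Qed.

Definition kop (f : V) : bfun S R :=
  BFun (kernel_Ex_measurable f) (kernel_Ex_bounded f).

Lemma kop_is_linear : linear kop.
Proof. by move=> a f g; apply: bfun_ext => x /=; rewrite ExD ExZ. Qed.
HB.instance Definition _ := GRing.isLinear.Build R V (bfun S R) *:%R kop
  kop_is_linear.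

Lemma kop_pos f : nonneg f -> nonneg (kop f).
Proof. by move=> f0 x; exact: Ex_ge0. Qed.

Lemma kop_cst a : kop (bcst a) = bcst a.
Proof. by apply: bfun_ext => x /=; rewrite Ex_cst. Qed.

Lemma kopE f x : (kop f x)%:E = (\int[P x]_y (f y)%:E)%E.
Proof. by rewrite /= ExE. Qed.

End kernel_operator.

Lemma nstepE d (T : measurableType d) (R : realType) (P : R.-pker T ~> T)
    n x A (mA : measurable A) :
  nstep P n x A = (iter n (kop P) (bind R mA) x)%:E.
Proof.
elim: n x => [|n IH] x /=; first by [].
by rewrite ExE; apply: eq_integral => y _; rewrite IH.
Qed.

Section mul_operator.
Context d (T : measurableType d) (R : realType) (pi : probability T R).
Local Notation V := (bfun T R).
Variable c : V.

Lemma bmul_is_linear : linear (bmul c).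
Proof. by move=> a f g; apply: bfun_ext => x; rewrite !bfunE; ring. Qed.
HB.instance Definition _ := GRing.isLinear.Build R V V *:%R (bmul c)
  bmul_is_linear.

Lemma bmul_sym : symop pi (bmul c).
Proof. by move=> f g; congr Ex; apply: bfun_ext => x; rewrite !bfunE; ring. Qed.

Lemma bmul_pos : nonneg c -> posop (bmul c).
Proof. by move=> c0 f f0 x; rewrite mulr_ge0. Qed.

End mul_operator.

(** * Operators given by transition densities *)

Section density_operator.
Context d (T : measurableType d) (R : realType).
Variable mu : {sigma_finite_measure set T -> \bar R}.
Local Notation V := (bfun T R).

(** Density of a sub-Markov kernel: that of the accepted moves, [q a], and its truncations. *)
Record subdensity := SubDensity {
  sd_fun :> T -> T -> R ;
  sd_measurable : measurable_fun setT (uncurry sd_fun) ;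
  sd_ge0 : forall x y, 0 <= sd_fun x y ;
  sd_le1 : forall x, (\int[mu]_y (sd_fun x y)%:E <= 1)%E }.

Variable w : subdensity.

Lemma sd_measurable2 x : measurable_fun setT (w x).
Proof. exact: (measurable_fun_pair2 x (sd_measurable w)). Qed.

Lemma sd_integrable x (f : V) : mu.-integrable setT (EFin \o (fun y => w x y * f y)).
Proof.
have [M M0 fM] := bfunB f.
have i1 : mu.-integrable setT (EFin \o (fun y => M * w x y)).
  have -> : EFin \o (fun y => M * w x y) = (fun y => M%:E * (w x y)%:E)%E by [].
  apply: integrableZl => //; apply/integrableP; split.
    exact/measurable_EFinP/sd_measurable2.
  under eq_integral do rewrite gee0_abs ?lee_fin ?sd_ge0//.
  by rewrite (le_lt_trans (sd_le1 w x))// ltry.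
apply: (le_integrable _ _ _ i1) => //.
  apply/measurable_EFinP/measurable_funM; first exact: sd_measurable2.
  exact: bfun_measurable.
move=> y _ /=; rewrite lee_fin !normrM mulrC ler_wpM2r//.
by rewrite (le_trans (fM y))// ler_norm.
Qed.
Local Hint Resolve sd_integrable : core.

Definition opw_fun (f : V) x := \int[mu]_y (w x y * f y).

Lemma opw_funE f x : (opw_fun f x)%:E = (\int[mu]_y (w x y * f y)%:E)%E.
Proof. by rewrite /opw_fun /Rintegral fineK//; exact: integrable_fin_num (sd_integrable x f). Qed.

Lemma opw_funD f g x : opw_fun (f + g) x = opw_fun f x + opw_fun g x.
Proof.
rewrite /opw_fun -RintegralD//.
by apply: eq_Rintegral => y _; rewrite bfunE mulrDr.
Qed.

Lemma opw_funZ a f x : opw_fun (a *: f) x = a * opw_fun f x.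
Proof.
rewrite /opw_fun -RintegralZl//.
by apply: eq_Rintegral => y _; rewrite bfunE mulrCA.
Qed.

Lemma opw_fun_ge0 (f : V) x : nonneg f -> 0 <= opw_fun f x.
Proof. by move=> f0; apply: Rintegral_ge0 => y _; rewrite mulr_ge0 ?sd_ge0. Qed.

Lemma opw_fun_meas_ge0 (f : V) : nonneg f -> measurable_fun setT (opw_fun f).
Proof.
move=> f0; rewrite (_ : opw_fun f = fine \o (fun x => \int[mu]_y
  (fun z : T * T => (w z.1 z.2 * f z.2)%:E) (x, y))%E)//.
apply: measurableT_comp => //.
apply: (@measurable_fun_fubini_tonelli_F _ _ T T R mu
  (fun z => (w z.1 z.2 * f z.2)%:E)); last first.
  by move=> z; rewrite lee_fin mulr_ge0 ?sd_ge0.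
apply/measurable_EFinP/measurable_funM.
  rewrite (_ : (fun _ => _) = uncurry w); first exact: sd_measurable.
  by apply/funext => -[].
exact: measurableT_comp (bfun_measurable f) measurable_snd.
Qed.

Lemma opw_measurable f : measurable_fun setT (opw_fun f).
Proof.
have [g [a [g0 a0 ->]]] := bfun_shift f.
rewrite (_ : opw_fun _ = (fun x => opw_fun g x - opw_fun (bcst a) x)).
  by apply: measurable_funB; apply: opw_fun_meas_ge0 => // x.
apply/funext => x; rewrite opw_funD -scaleN1r opw_funZ; ring.
Qed.

Lemma opw_fun_abs (f : V) M x : (forall y, `|f y| <= M) -> `|opw_fun f x| <= M.
Proof.
move=> fM; have M0 : 0 <= M := le_trans (normr_ge0 _) (fM point).
apply: (le_trans (le_normr_Rintegral _ _)) => //.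
rewrite -lee_fin /Rintegral fineK; last first.
  exact: integrable_fin_num (integrable_norm (sd_integrable x f)).
apply: (@le_trans _ _ (\int[mu]_y (M%:E * (w x y)%:E)))%E.
  apply: ge0_le_integral => //.
  - apply/measurable_EFinP/measurableT_comp => //.
    apply: measurable_funM; first exact: sd_measurable2.
    exact: bfun_measurable.
  - apply: measurable_funeM; exact/measurable_EFinP/sd_measurable2.
  - move=> y _; rewrite lee_fin normrM mulrC (ger0_norm (sd_ge0 _ _ _)).
    by rewrite ler_wpM2r ?sd_ge0.
rewrite ge0_integralZl//.
- by rewrite -[leRHS]mule1 lee_wpmul2l ?lee_fin// sd_le1.
- exact/measurable_EFinP/sd_measurable2.
- by move=> y _; rewrite lee_fin sd_ge0.
Qed.

Lemma opw_bounded f : exists M, forall x, `|opw_fun f x| <= M.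
Proof. by have [M M0 fM] := bfunB f; exists M => x; exact: opw_fun_abs. Qed.

Definition opw (f : V) : V := BFun (opw_measurable f) (opw_bounded f).

Lemma opw_is_linear : linear opw.
Proof. by move=> a f g; apply: bfun_ext => x /=; rewrite opw_funD opw_funZ. Qed.
HB.instance Definition _ := GRing.isLinear.Build R V V *:%R opw opw_is_linear.

Lemma opw_pos : posop opw.
Proof. by move=> f f0 x; exact: opw_fun_ge0. Qed.

Lemma opw1_le x : opw (bcst 1) x <= 1.
Proof.
by apply: (le_trans (ler_norm _)); apply: opw_fun_abs => y; rewrite bfunE normr1.
Qed.

End density_operator.

Lemma cvgn_EFinP (R : realType) (u : R^nat) (l : R) :
  ((u n)%:E @[n --> \oo] --> l%:E)%E <-> u n @[n --> \oo] --> l.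
Proof.
split; first exact: fine_cvg.
by move=> ul; apply: cvg_EFin => //; exact: nearW.
Qed.

Section bounded_convergence.
Context d (T : measurableType d) (R : realType) (P : probability T R).

Lemma Ex_bounded_cvg (f_ : nat -> bfun T R) (f : bfun T R) (M : R) :
  (forall n x, `|f_ n x| <= M) ->
  {ae P, forall x, f_ n x @[n --> \oo] --> f x} ->
  Ex P (f_ n) @[n --> \oo] --> Ex P f.
Proof.
move=> fM ff; apply/cvgn_EFinP.
have := @dominated_convergence _ T R P setT measurableT
  (fun n => EFin \o f_ n) (EFin \o f) (EFin \o cst M).
case.
- by move=> n; exact/measurable_EFinP/bfun_measurable.
- exact/measurable_EFinP/bfun_measurable.
- apply: filterS ff => x fx _.
  exact/cvgn_EFinP.
- exact: finite_measure_integrable_cst.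
- by apply: aeW => x n _ /=; rewrite lee_fin.
move=> _ _; rewrite -(ExE P f) => H.
by under eq_fun do rewrite ExE.
Qed.

End bounded_convergence.

Section law_operator.
Context d (T : measurableType d) (R : realType).
Variable mu : {sigma_finite_measure set T -> \bar R}.
Local Notation V := (bfun T R).
Variable p : density mu.

Lemma Ex_law (f : V) : nonneg f ->
  (Ex (law p) f)%:E = (\int[mu]_x (f x * p x)%:E)%E.
Proof.
move=> f0; rewrite ExE (@integral_density _ _ _ mu (law p) p)//.
- exact: measurable_density.
- exact: density_ge0.
- exact/measurable_EFinP/bfun_measurable.
Qed.

Section symmetric.
Variable w : subdensity mu.
Hypothesis pw : forall x y, p x * w x y = p y * w y x.

Let F (f g : V) (z : T * T) := (f z.1 * g z.2 * (p z.1 * w z.1 z.2))%:E.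

Let dot_F f g : nonneg f -> nonneg g ->
  ((dot (law p) f (opw w g))%:E = \int[mu]_x \int[mu]_y F f g (x, y))%E.
Proof.
move=> f0 g0; rewrite Ex_law; last first.
  by move=> x; rewrite mulr_ge0//; exact: opw_pos.
apply: eq_integral => x _.
rewrite bmulE mulrAC EFinM [X in (_ * X)%E](opw_funE w) -ge0_integralZl//.
- by apply: eq_integral => y _; rewrite /F -EFinM/=; congr EFin; ring.
- apply/measurable_EFinP/measurable_funM; first exact: sd_measurable2.
  exact: bfun_measurable.
- by move=> y _; rewrite lee_fin mulr_ge0 ?sd_ge0.
- by rewrite lee_fin mulr_ge0 ?density_ge0.
Qed.

(** By Tonelli both sides are the same double integral, since [p x * w x y] is symmetric; this
    requires nonnegative [f] and [g], whence the reduction by shifts. *)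
Lemma opw_sym : symop (law p) (opw w).
Proof.
suff H f g : nonneg f -> nonneg g ->
    dot (law p) f (opw w g) = dot (law p) (opw w f) g.
  move=> f g; have [f' [a [f0 a0 ->]]] := bfun_shift f.
  have [g' [b [g0 b0 ->]]] := bfun_shift g.
  by rewrite !linearB/= !dotBl !dotBr !H.
move=> f0 g0; apply/EFin_inj; rewrite (dotC _ (opw w f)) (dot_F f0 g0) (dot_F g0 f0).
have mp : measurable_fun setT p := measurable_density p.
rewrite fubini_tonelli; last 2 first.
- apply/measurable_EFinP/measurable_funM; apply: measurable_funM.
  + exact: measurableT_comp (bfun_measurable f) measurable_fst.
  + exact: measurableT_comp (bfun_measurable g) measurable_snd.
  + exact: measurableT_comp mp measurable_fst.
  + rewrite (_ : (fun _ => _) = uncurry w); first exact: sd_measurable.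
    by apply/funext => -[].
- by move=> z; rewrite lee_fin !mulr_ge0 ?density_ge0 ?sd_ge0.
apply: eq_integral => y _; apply: eq_integral => x _; rewrite /F/= pw.
by rewrite (mulrC (f x)).
Qed.

End symmetric.

Section truncation.
Variable w : subdensity mu.
Variable L : R.
Hypothesis L0 : 0 <= L.

(** The cap [L * p y] makes [L] a bound on the density with respect to the target, and keeps
    detailed balance because [p x * (L * p y)] is symmetric in [x] and [y]. *)
Definition trunc (x y : T) : R := Num.min (w x y) (L * p y).

Lemma trunc_measurable : measurable_fun setT (uncurry trunc).
Proof.
rewrite (_ : uncurry trunc = (fun z => Num.min (uncurry w z) (L * p z.2))).
  apply: measurable_minr; first exact: sd_measurable.
  apply: measurable_funM => //.
  exact: measurableT_comp (measurable_density p) measurable_snd.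
by apply/funext => -[].
Qed.

Lemma trunc_ge0 x y : 0 <= trunc x y.
Proof. by rewrite le_min sd_ge0 mulr_ge0 ?density_ge0. Qed.

Lemma trunc_le x y : trunc x y <= w x y.
Proof. by rewrite ge_min lexx. Qed.

Lemma trunc_le1 x : (\int[mu]_y (trunc x y)%:E <= 1)%E.
Proof.
apply: le_trans (sd_le1 w x); apply: ge0_le_integral => //.
- by move=> y _; rewrite lee_fin trunc_ge0.
- exact/measurable_EFinP/(measurable_fun_pair2 x trunc_measurable).
- exact/measurable_EFinP/sd_measurable2.
- by move=> y _; rewrite lee_fin trunc_le.
Qed.

Definition trunc_sd := SubDensity trunc_measurable trunc_ge0 trunc_le1.

Lemma trunc_sym : (forall x y, p x * w x y = p y * w y x) ->
  forall x y, p x * trunc_sd x y = p y * trunc_sd y x.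
Proof.
move=> pw x y /=; rewrite /trunc !minr_pMr ?density_ge0// pw.
by congr Num.min; ring.
Qed.

Lemma opw_trunc_le (f : V) x : nonneg f -> opw trunc_sd f x <= L * Ex (law p) f.
Proof.
move=> f0; rewrite -lee_fin EFinM Ex_law//; rewrite [leLHS](opw_funE trunc_sd).
rewrite -ge0_integralZl//; last 2 first.
- by apply/measurable_EFinP/measurable_funM; [exact: bfun_measurable|exact: measurable_density].
- by move=> y _; rewrite lee_fin mulr_ge0 ?density_ge0.
apply: ge0_le_integral => //.
- by move=> y _; rewrite lee_fin mulr_ge0 ?trunc_ge0.
- apply/measurable_EFinP/measurable_funM; last exact: bfun_measurable.
  exact: (sd_measurable2 trunc_sd).
- apply: measurable_funeM; apply/measurable_EFinP/measurable_funM.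
    exact: bfun_measurable.
  exact: measurable_density.
- move=> y _; rewrite lee_fin mulrCA mulrC ler_wpM2l//.
  by rewrite ge_min lexx orbT.
Qed.

Lemma opw_trunc_leop : leop (opw trunc_sd) (opw w).
Proof.
move=> f f0 x; rewrite -lee_fin !opw_funE; apply: ge0_le_integral => //.
- by move=> y _; rewrite lee_fin mulr_ge0 ?trunc_ge0.
- apply/measurable_EFinP/measurable_funM; last exact: bfun_measurable.
  exact: (sd_measurable2 trunc_sd).
- apply/measurable_EFinP/measurable_funM; last exact: bfun_measurable.
  exact: sd_measurable2.
- by move=> y _; rewrite lee_fin ler_wpM2r// trunc_le.
Qed.

End truncation.

(** Where [p y > 0] the truncation is inactive once [L >= w x y / p y]; where [p y = 0] it gives 0,
    which is why [w] has to vanish there. Dominated convergence is used in [y], then in [x]. *)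
Lemma trunc_cvg (w : subdensity mu) (e : R) : 0 < e ->
  (forall x y, p y = 0 -> w x y = 0) ->
  exists (L : R) (L0 : 0 <= L),
    Ex (law p) (opw w (bcst 1)) - Ex (law p) (opw (trunc_sd w L0) (bcst 1)) <= e.
Proof.
move=> e0 wp0.
pose f_ n := opw (trunc_sd w (ler0n R n)) (bcst 1).
have : Ex (law p) (f_ n) @[n --> \oo] --> Ex (law p) (opw w (bcst 1)).
  apply: (@Ex_bounded_cvg _ _ _ _ _ _ 1).
    by move=> n x; apply: opw_fun_abs => y; rewrite bfunE normr1.
  apply: aeW => x; apply/cvgn_EFinP.
  rewrite [X in _ --> X](opw_funE w).
  rewrite (_ : (fun _ => _) = (fun n => \int[mu]_y (trunc w n%:R x y * 1)%:E)%E); last first.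
    by apply/funext => n; rewrite -(opw_funE (trunc_sd w (ler0n R n)) (bcst 1)).
  apply: (@dominated_cvg _ _ _ mu setT _ _ _ (fun y => (w x y * bcst 1 y)%:E)) => //.
  - move=> n; apply/measurable_EFinP/measurable_funM => //.
    exact: (sd_measurable2 (trunc_sd w (ler0n R n))).
  - move=> y _; apply/cvgn_EFinP.
    have [py|py] := eqVneq (p y) 0.
      rewrite (_ : (fun _ => _) = cst (w x y * 1)); first exact: cvg_cst.
      by apply/funext => n; rewrite /trunc py mulr0 wp0// minxx.
    apply: cvg_near_cst; near=> n; rewrite /= /trunc min_l//.
    rewrite -ler_pdivrMr ?lt_neqAle ?density_ge0 1?eq_sym ?py//.
    by near: n; exact: nbhs_infty_ger.
  - exact: sd_integrable.
  - move=> n y _ /=; rewrite lee_fin !mulr1 ger0_norm ?trunc_le//.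
    by rewrite trunc_ge0.
move=> /cvgrPdist_le/(_ e e0)[n _ /(_ n (leqnn n))/= H].
by exists n%:R, (ler0n R n); apply: le_trans H; exact: ler_norm.
Unshelve. all: by end_near. Qed.

End law_operator.

(** * Metropolis-Hastings and delayed-acceptance operators *)

Section subdensity_measure.
Context d (T : measurableType d) (R : realType).
Variable mu : {sigma_finite_measure set T -> \bar R}.
Variables (w : subdensity mu) (x : T).
Local Open Scope ereal_scope.

Definition sd_measure (A : set T) : \bar R := \int[mu]_(y in A) (w x y)%:E.

Let sd_measure0 : sd_measure set0 = 0.
Proof. exact: integral_set0. Qed.

Let sd_measure_ge0 A : 0 <= sd_measure A.
Proof. by apply: integral_ge0 => y _; rewrite lee_fin sd_ge0. Qed.

Let sd_measure_sigma_additive : semi_sigma_additive sd_measure.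
Proof.
apply: semi_sigma_additive_nng_induced => [|y].
  exact/measurable_EFinP/sd_measurable2.
by rewrite lee_fin sd_ge0.
Qed.

HB.instance Definition _ := isMeasure.Build _ _ _ sd_measure
  sd_measure0 sd_measure_ge0 sd_measure_sigma_additive.

Lemma integral_sd_measure (f : bfun T R) : nonneg f ->
  \int[sd_measure]_y (f y)%:E = (opw w f x)%:E.
Proof.
move=> f0; rewrite (@integral_density _ _ _ mu sd_measure (w x))//.
- rewrite [RHS](opw_funE w); apply: eq_integral => y _.
  by rewrite -EFinM mulrC.
- exact: sd_measurable2.
- exact: sd_ge0.
- exact/measurable_EFinP/bfun_measurable.
Qed.

End subdensity_measure.

Section accept_reject_operator.
Context d (T : measurableType d) (R : realType).
Variable mu : {sigma_finite_measure set T -> \bar R}.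
Variables (q : proposal mu) (a : acceptance T R).
Local Notation V := (bfun T R).

Let qa x y := q x y * a x y.

Let qa_measurable : measurable_fun setT (uncurry qa).
Proof.
rewrite (_ : uncurry qa = (uncurry q \* uncurry a)); last first.
  by apply/funext => -[].
by apply: measurable_funM; [exact: measurable_proposal|exact: measurable_acceptance].
Qed.

Let qa_ge0 x y : 0 <= qa x y.
Proof. by rewrite mulr_ge0 ?proposal_ge0 ?acceptance_ge0. Qed.

Let qa_le1 x : (\int[mu]_y (qa x y)%:E <= 1)%E.
Proof.
rewrite -(proposal_int1 q x); apply: ge0_le_integral => //.
- by move=> y _; rewrite lee_fin.
- exact/measurable_EFinP/(measurable_fun_pair2 x qa_measurable).
- exact/measurable_EFinP/(measurable_fun_pair2 x (measurable_proposal q)).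
- by move=> y _; rewrite lee_fin ler_piMr ?proposal_ge0 ?acceptance_le1.
Qed.

Definition move_sd := SubDensity qa_measurable qa_ge0 qa_le1.

Definition rejection : V := bcst 1 - opw move_sd (bcst 1).

Lemma rejection_ge0 : nonneg rejection.
Proof. by move=> x; rewrite bfunB_ bcstE subr_ge0; exact: opw1_le. Qed.

Lemma rejection_le1 x : rejection x <= 1.
Proof.
by rewrite bfunB_ bcstE gerBl; apply: opw_pos.
Qed.

Lemma mean_acceptanceE x : mean_acceptance q a x = (opw move_sd (bcst 1) x)%:E.
Proof.
rewrite [RHS](opw_funE move_sd); apply: eq_integral => y _.
by rewrite bcstE mulr1.
Qed.

Lemma kop_accept_reject (f : V) :
  kop (accept_reject_kernel q a) f = opw move_sd f + bmul rejection f.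
Proof.
pose B f := opw move_sd f + bmul rejection f.
have linB : linear B.
  move=> c g h; rewrite /B !linearP scalerDr.
  by rewrite addrACA.
pose lB := GRing.isLinear.Build R V V *:%R B linB.
pose B' : {linear V -> V} := HB.pack B lB.
apply: (@eq_nonneg_linear _ _ _ _ _ B') => {}f f0.
apply: bfun_ext => x; apply/EFin_inj; rewrite kopE /=.
rewrite (eq_measure_integral (measure_add (sd_measure move_sd x)
  (mscale (NngNum (rejection_ge0 x)) \d_x))).
  rewrite ge0_integral_measure_add//; last 2 first.
  - by move=> y _; rewrite lee_fin.
  - exact/measurable_EFinP/bfun_measurable.
  rewrite integral_sd_measure// ge0_integral_mscale//; last 2 first.
  - exact/measurable_EFinP/bfun_measurable.
  - by move=> y _; rewrite lee_fin.
  rewrite integral_dirac//; last exact/measurable_EFinP/bfun_measurable.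
  by rewrite diracT mul1e.
move=> A mA _; rewrite /measure_add/= /msum 2!big_ord_recl/= big_ord0 adde0.
by rewrite /accept_reject mean_acceptanceE /mscale/= mulN1r EFinB.
Qed.

End accept_reject_operator.

Section peskun.
Context d (T : measurableType d) (R : realType) (pi : probability T R).
Local Notation V := (bfun T R).

(* Removing off-diagonal mass (here W) and adding it to the diagonal increases
   the quadratic form. *)
Lemma dot_offdiagonal_le (W : {linear V -> V}) (f : V) :
  posop W -> symop pi W -> dot pi f (W f) <= dot pi (bmul f f) (W (bcst 1)).
Proof.
move=> pW sW.
have H : dot pi (bmul f f) (W (bcst 1)) = Ex pi (W (bmul f f)).
  by rewrite sW dotC dot1l.
suff : 2 * dot pi f (W f) <=
    dot pi (bmul f f) (W (bcst 1)) + Ex pi (W (bmul f f)) by rewrite -H; lra.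
rewrite -ExZ -ExD; apply: Ex_le => x; rewrite !(bfunD, bfunZ, bmulE).
(* Positivity of [W] on [(f - f x)^2], centered at the point of evaluation; integrating over [x]
   gives the Dirichlet form inequality. *)
have /(_ x) : nonneg (W (bmul f f - (2 * f x) *: f + (f x ^+ 2) *: bcst 1)).
  apply: pW => y; rewrite !bfunE; have := sqr_ge0 (f y - f x); nra.
rewrite linearD linearB !(linearZZ W).
rewrite bfunD bfunB_ !bfunZ.
set u := W _ x; set v := W _ x; set t := W _ x; lra.
Qed.

End peskun.

Section delayed_acceptance.
Context d (T : measurableType d) (R : realType).
Variable mu : {sigma_finite_measure set T -> \bar R}.
Variables (pi pihat : density mu) (q : proposal mu).
Local Notation V := (bfun T R).

Definition mh_sd := move_sd q (mh_acceptance pi q).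
Definition da_sd := move_sd q (da_acceptance pi pihat q).

(** The flow is the symmetric [min(pi u q(u,v), pi v q(v,u))]; when [pi u q(u,v) = 0] both sides
    vanish whatever value the ratio has. *)
Lemma mh_balance x y : pi x * mh_sd x y = pi y * mh_sd y x.
Proof.
suff H u v : pi u * mh_sd u v = Num.min (pi u * q u v) (pi v * q v u).
  by rewrite !H minC.
rewrite /= /mh_prob /mh_ratio mulrA.
have := proposal_ge0 q u v; have := density_ge0 pi u.
have := proposal_ge0 q v u; have := density_ge0 pi v.
move: (pi u) (pi v) (q u v) (q v u) => a b s t b0 t0 a0 s0.
rewrite minr_pMr ?mulr_ge0// mulr1.
have [->|as0] := eqVneq (a * s) 0; last first.
  by congr Num.min; rewrite mulrC mulfVK.
by rewrite mul0r min_l// min_l ?mulr_ge0.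
Qed.

(** Writing [pi u q(u,v)] as [pihat u q(u,v)] times [pi u / pihat u], each stage turns its own
    factor into a symmetric minimum. If [pihat] vanishes at either end, division by 0 returns 0 and
    the move is rejected in both directions. *)
Lemma da_balance x y : pi x * da_sd x y = pi y * da_sd y x.
Proof.
suff H u v : pi u * da_sd u v = if (pihat u == 0) || (pihat v == 0) then 0 else
    Num.min (pihat u * q u v) (pihat v * q v u) *
    Num.min (pi u / pihat u) (pi v / pihat v).
  by rewrite !H orbC; case: ifP => // _; rewrite minC (minC (pi x / _)).
rewrite /= /da_prob /mh_ratio /da_ratio2.
have := proposal_ge0 q u v; have := density_ge0 pi u.
have := proposal_ge0 q v u; have := density_ge0 pi v.
have := density_ge0 pihat u; have := density_ge0 pihat v.
move: (pihat u) (pihat v) (pi u) (pi v) (q u v) (q v u).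
move=> a b c e s t b0 a0 e0 t0 c0 s0.
have m10 : Num.min 1 0 = 0 :> R by rewrite min_r.
have [->|an0] := eqVneq a 0; first by rewrite mul0r invr0 mulr0 m10 mul0r !mulr0.
have [->|bn0] := eqVneq b 0; first by rewrite invr0 mulr0 mul0r m10 !mulr0.
rewrite /=.
have [->|sn0] := eqVneq s 0.
  by rewrite mul0r mulr0 mulr0 min_l ?mul0r// mulr_ge0.
have [->|cn0] := eqVneq c 0.
  by rewrite !mul0r (@min_l _ _ 0 (e / b)) ?mulr0// divr_ge0.
have ap : 0 < a by rewrite lt_neqAle eq_sym an0.
have sp : 0 < s by rewrite lt_neqAle eq_sym sn0.
have cp : 0 < c by rewrite lt_neqAle eq_sym cn0.
have -> : Num.min (a * s) (b * t) = a * s * Num.min 1 (b * t / (a * s)).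
  rewrite minr_pMr ?mulr_ge0 1?ltW// mulr1; congr Num.min.
  by rewrite [RHS]mulrC mulfVK// mulf_neq0.
have -> : Num.min (c / a) (e / b) = c / a * Num.min 1 (e / b / (c / a)).
  rewrite minr_pMr ?divr_ge0 1?ltW// mulr1; congr Num.min.
  by rewrite [RHS]mulrC mulfVK// mulf_neq0// invr_neq0.
set m1 := Num.min _ _; set m2 := Num.min _ _.
by field.
Qed.

(** The Metropolis-Hastings ratio is [r1 r2], and [(1 /\ r1)(1 /\ r2) <= 1 /\ r1 r2]. In the
    degenerate cases where the factorization fails, the left-hand side is 0. *)
Lemma da_le_mh x y : da_sd x y <= mh_sd x y.
Proof.
rewrite /= /da_prob /mh_prob /mh_ratio /da_ratio2.
have := proposal_ge0 q x y; have := density_ge0 pi x.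
have := proposal_ge0 q y x; have := density_ge0 pi y.
have := density_ge0 pihat x; have := density_ge0 pihat y.
move: (pihat x) (pihat y) (pi x) (pi y) (q x y) (q y x).
move=> a b c e s t b0 a0 e0 t0 c0 s0.
rewrite ler_wpM2l//.
have m10 : Num.min 1 0 = 0 :> R by rewrite min_r.
have r0 : 0 <= Num.min 1 (e * t / (c * s)).
  by rewrite le_min ler01 divr_ge0 ?mulr_ge0.
have [->|an0] := eqVneq a 0; first by rewrite mul0r invr0 mulr0 m10 mul0r.
have [->|bn0] := eqVneq b 0; first by rewrite invr0 mulr0 mul0r m10 mulr0.
have [->|cn0] := eqVneq c 0; first by rewrite !mul0r invr0 !mulr0 m10 mulr0.
set r1 := b * t / (a * s); set r2 := e / b / (c / a).
have r10 : 0 <= r1 by rewrite divr_ge0 ?mulr_ge0.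
have r20 : 0 <= r2 by rewrite !divr_ge0.
have -> : e * t / (c * s) = r1 * r2.
  rewrite /r1 /r2; have [->|sn0] := eqVneq s 0; last by field; rewrite ?an0 ?bn0 ?cn0.
  by rewrite !mulr0 invr0 !mulr0 mul0r.
rewrite le_min; apply/andP; split.
  by rewrite mulr_ile1// ?le_min ?ler01 ?ge_min ?lexx.
by rewrite ler_pM// ?le_min ?ler01 ?ge_min ?lexx ?orbT.
Qed.

Lemma da_zero x y : pi y = 0 -> da_sd x y = 0.
Proof.
move=> py; rewrite /= /da_prob /da_ratio2 py !mul0r.
by rewrite (@min_r _ _ 1 0)// !mulr0.
Qed.

Definition mh_op : {linear V -> V} := kop (mh_kernel pi q).
Definition da_op : {linear V -> V} := kop (da_kernel pi pihat q).

Lemma mh_opE f :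
  mh_op f = opw mh_sd f + bmul (rejection q (mh_acceptance pi q)) f.
Proof. exact: kop_accept_reject. Qed.

Lemma da_opE f :
  da_op f = opw da_sd f + bmul (rejection q (da_acceptance pi pihat q)) f.
Proof. exact: kop_accept_reject. Qed.

Lemma mh_op_sym : symop (law pi) mh_op.
Proof.
move=> f g; rewrite !mh_opE !dotE bmul_sym.
by rewrite (opw_sym mh_balance).
Qed.

Lemma da_op_sym : symop (law pi) da_op.
Proof.
move=> f g; rewrite !da_opE !dotE bmul_sym.
by rewrite (opw_sym da_balance).
Qed.

(** [W] is the off-diagonal mass that P has in excess of P~. Both kernels have total mass 1, so P~
    is P with this mass moved to the diagonal. *)
Lemma dot_mh_le_da f : dot (law pi) f (mh_op f) <= dot (law pi) f (da_op f).
Proof.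
pose W f := opw mh_sd f - opw da_sd f.
have linW : linear W.
  by move=> c g h; rewrite /W !opw_is_linear scalerBr opprD addrACA.
pose lW := GRing.isLinear.Build R V V *:%R W linW.
pose W' : {linear V -> V} := HB.pack W lW.
have pW : posop W'.
  move=> g g0 x; rewrite bfunB_ subr_ge0 -lee_fin.
  rewrite [leLHS](opw_funE da_sd) [leRHS](opw_funE mh_sd).
  apply: ge0_le_integral => //.
  - by move=> y _; rewrite lee_fin mulr_ge0 ?sd_ge0.
  - apply/measurable_EFinP/measurable_funM; last exact: bfun_measurable.
    exact: sd_measurable2.
  - apply/measurable_EFinP/measurable_funM; last exact: bfun_measurable.
    exact: sd_measurable2.
  - by move=> y _; rewrite lee_fin ler_wpM2r// da_le_mh.
have sW : symop (law pi) W'.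
  move=> g h; rewrite /= /W !dotBr !dotBl (opw_sym mh_balance).
  by rewrite (opw_sym da_balance).
have := dot_offdiagonal_le f pW sW.
rewrite /= /W !dotBr => H.
rewrite mh_opE da_opE !dotDr.
have dr a : dot (law pi) f (bmul (rejection q a) f) =
    dot (law pi) (bmul f f) (bcst 1) -
    dot (law pi) (bmul f f) (opw (move_sd q a) (bcst 1)).
  rewrite -dotBr; congr Ex; apply: bfun_ext => x.
  by rewrite !(bmulE, bfunB_, bcstE); ring.
rewrite !dr; move: H; rewrite /mh_sd /da_sd.
by do !move: (dot _ _ _) => ?; lra.
Qed.

End delayed_acceptance.

(** * From a spectral gap to geometric ergodicity *)

Section summable.
Context d (T : measurableType d) (R : realType) (P : probability T R).

Lemma ae_summable (u : nat -> bfun T R) (C z : R) : 0 <= z < 1 ->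
  (forall n, nonneg (u n)) -> (forall n, Ex P (u n) <= C * z ^+ n) ->
  {ae P, forall x, (\sum_(n <oo) (u n x)%:E < +oo)%E}.
Proof.
move=> /andP[z0 z1] u0 uC.
have C0 : 0 <= C.
  by have := uC 0%N; rewrite expr0 mulr1; apply: le_trans; exact: (Ex_ge0 P (u0 0%N)).
have un0 n x : (0 <= (u n x)%:E)%E by rewrite lee_fin; exact: u0.
have mu_ : measurable_fun setT (fun x => \sum_(n <oo) (u n x)%:E)%E.
  apply: ge0_emeasurable_sum => // n _.
  exact/measurable_EFinP/bfun_measurable.
have s0 x : (0 <= \sum_(n <oo) (u n x)%:E)%E by exact: nneseries_ge0.
have : P.-integrable setT (fun x => \sum_(n <oo) (u n x)%:E)%E.
  apply/integrableP; split => //.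
  under eq_integral do rewrite gee0_abs//.
  rewrite integral_nneseries//; last first.
    by move=> n; exact/measurable_EFinP/bfun_measurable.
  apply: (@le_lt_trans _ _ (C / (1 - z))%:E); last by rewrite ltry.
  apply: lime_le.
    by apply: is_cvg_nneseries => n _ _; exact: integral_ge0.
  apply: nearW => n.
  rewrite (eq_bigr (fun i => (Ex P (u i))%:E)); last by move=> i _; rewrite ExE.
  rewrite sumEFin lee_fin.
  apply: (@le_trans _ _ (\sum_(0 <= i < n) C * z ^+ i)); first exact: ler_sum.
  have -> : \sum_(0 <= i < n) C * z ^+ i = series (geometric C z) n by [].
  rewrite geometric_seriesE ?lt_eqF//= ler_wpM2r//.
    by rewrite invr_ge0 subr_ge0 ltW.
  by rewrite ler_piMr// gerBl exprn_ge0.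
move=> /(integrable_ae measurableT); apply: filterS => x /(_ I).
by rewrite ge0_fin_numE.
Qed.

End summable.

Lemma bernoulli_ge (R : realDomainType) (t : R) n : 0 <= t <= 1 ->
  1 - n%:R * t <= (1 - t) ^+ n.
Proof.
move=> /andP[t0 t1]; elim: n => [|n IH]; first by rewrite mul0r subr0.
rewrite exprS; have t2 : 0 <= 1 - t by rewrite subr_ge0.
apply: le_trans (ler_wpM2l t2 IH).
have : 0 <= n%:R * (t * t) by rewrite !mulr_ge0.
rewrite -natr1; lra.
Qed.

Lemma dist_unit_le1 (R : realDomainType) (u v : R) :
  0 <= u <= 1 -> 0 <= v <= 1 -> `|u - v| <= 1.
Proof. by move=> ? ?; rewrite ler_norml; apply/andP; split; lra. Qed.

Section gap_to_geometric.
Context d (T : measurableType d) (R : realType).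
Variable mu : {sigma_finite_measure set T -> \bar R}.
Variables (p : density mu) (q : proposal mu) (a : acceptance T R).
Local Notation V := (bfun T R).
Local Notation pi := (law p).
Local Notation w := (move_sd q a).
Local Notation c := (rejection q a).
Local Notation K := (kop (accept_reject_kernel q a)).
Hypothesis pw : forall x y, p x * w x y = p y * w y x.
Hypothesis pw0 : forall x y, p y = 0 -> w x y = 0.

Lemma accept_reject_sym : symop pi K.
Proof.
by move=> f g; rewrite !kop_accept_reject !dotE bmul_sym (opw_sym pw).
Qed.

Lemma Ex_iter_rejection_cvg : {ae pi, forall x, c x < 1} ->
  Ex pi (iter n (bmul c) (bcst 1)) @[n --> \oo] --> 0.
Proof.
move=> c1.
have cE n x : iter n (bmul c) (bcst 1) x = c x ^+ n.
  by elim: n => [//|n IH]; rewrite iterS bmulE IH exprS.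
rewrite -(Ex_cst pi 0).
apply: (@Ex_bounded_cvg _ _ _ _ _ _ 1).
  move=> n x; rewrite cE ger0_norm ?exprn_ge0 ?rejection_ge0//.
  by rewrite exprn_ile1 ?rejection_ge0 ?rejection_le1.
apply: filterS c1 => x cx.
under eq_fun do rewrite cE.
by apply: cvg_expr; rewrite ger0_norm ?rejection_ge0.
Qed.

(** The order of choices matters: [m] makes both [r ^+ m] and the mass of [m] consecutive rejections
    small, and only then is [L] taken so large that truncation loses at most [2^-12 / m] per step.
    The remainder thus has mass at most [2^-12 + 2^-12]. *)
Lemma gap_envelope (r : R) : 0 < r < 1 -> gap pi K r ->
  {ae pi, forall x, c x < 1} ->
  exists (m : nat) (B : nat -> V) (C : R), [/\ (0 < m)%N,
    forall n, nonneg (B n), forall n, Ex pi (B n) <= C * 2^-1 ^+ n &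
    forall n f, Ex pi f = 0 -> (forall x, `|f x| <= 1) ->
      forall x, `|iter n (iter m K) f x| <= B n x].
Proof.
move=> /andP[r0 r1] gK c1.
have e0 : 0 < 2^-1 ^+ 11 / 2 :> R by rewrite divr_gt0 ?exprn_gt0.
have [m [m0 rm cm]] : exists m, [/\ (0 < m)%N, r ^+ m <= 16^-1 &
    Ex pi (iter m (bmul c) (bcst 1)) <= 2^-1 ^+ 11 / 2].
  have /cvgrPdist_le H := Ex_iter_rejection_cvg c1.
  have [N _ HN] := H _ e0.
  have [N' HN'] := @expr_small R r 16^-1 (ltac:(by rewrite ltW)) (ltac:(by rewrite invr_gt0 ltr0n)).
  exists (maxn N (maxn N' 1)); split.
  - by rewrite !leq_max /= !orbT.
  - apply: le_trans (ltW HN'); apply: ler_wiXn2l; rewrite ?ltW//.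
    by rewrite !leq_max leqnn /= orbT.
  - have /= := HN (maxn N (maxn N' 1)) (leq_maxl _ _).
    by rewrite sub0r normrN; apply: le_trans; exact: ler_norm.
have m0' : 0 < m%:R :> R by rewrite ltr0n.
have [L [L0 HL]] := @trunc_cvg _ _ _ mu p w (2^-1 ^+ 11 / 2 / m%:R)
  (divr_gt0 e0 m0') pw0.
pose A f := opw (trunc_sd p w L0) f + bmul c f.
have linA : linear A.
  by move=> e g h; rewrite /A !linearP scalerDr addrACA.
pose lA := GRing.isLinear.Build R V V *:%R A linA.
pose A' : {linear V -> V} := HB.pack A lA.
have K1 : K (bcst 1) = bcst 1 by exact: kop_cst.
have pK : posop K by exact: kop_pos.
have sK : symop pi K by exact: accept_reject_sym.
have pC : posop (bmul c) by apply: bmul_pos; exact: rejection_ge0.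
have sC : symop pi (bmul c) by exact: bmul_sym.
have pA : posop A'.
  by move=> f f0 x; rewrite bfunD addr_ge0 ?pC//; exact: opw_pos.
have sA : symop pi A'.
  move=> f g; rewrite /= /A dotDr dotDl sC (opw_sym (w := trunc_sd p w L0))//.
  exact: trunc_sym.
have AK : leop A' K.
  move=> f f0 x; rewrite kop_accept_reject !bfunD lerD2r.
  exact: opw_trunc_leop.
have CA : leop (bmul c) A'.
  by move=> f f0 x; rewrite bfunD lerDr; exact: opw_pos.
have ACL f : nonneg f -> forall x, A' f x - bmul c f x <= L * Ex pi f.
  by move=> f0 x; rewrite bfunD addrK; exact: opw_trunc_le.
pose q0 := exprn_ge0 m (ltW r0).
have Kq f : Ex pi f = 0 -> nrm pi (iter m K f) <= (r ^+ m) ^+ 2 * nrm pi f.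
  by rewrite exprAC; exact: gap_iter.
have R1 : Ex pi (remainder K A' (bmul c) m (bcst 1)) <= 2^-1 ^+ 11.
  apply: (le_trans (Ex_remainder1 _ pK sK K1 pA AK _)).
  suff : m%:R * (1 - Ex pi (A' (bcst 1))) <= 2^-1 ^+ 11 / 2.
    move=> H; apply: (le_trans (lerD H cm)).
    by rewrite -splitr.
  rewrite mulrC -ler_pdivlMr//; apply: le_trans HL.
  have EA : Ex pi (A' (bcst 1)) =
      Ex pi (opw (trunc_sd p w L0) (bcst 1)) + Ex pi (bmul c (bcst 1)).
    exact: ExD.
  have EK : 1 = Ex pi (opw w (bcst 1)) + Ex pi (bmul c (bcst 1)).
    by rewrite -ExD -kop_accept_reject K1 Ex_cst.
  rewrite EA [X in X - _]EK opprD addrACA subrr addr0.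
  exact: lexx.
exists m, (envelope K A' (bmul c) L m), (1 + 6 * (m%:R * L)); split=> //.
- elim=> [x|n IH x]; first by rewrite bfunE.
  rewrite -[envelope _ _ _ _ _ n.+1]/(remainder K A' (bmul c) m (envelope K A' (bmul c) L m n)
    + (m%:R * L * 3^-1 ^+ n) *: bcst 1).
  rewrite bfunD addr_ge0//; first exact: remainder_pos.
  by rewrite bfunZ bfunE mulr1 !mulr_ge0.
- move=> n; exact: (Ex_envelope pK sK K1 pA sA AK pC sC CA L0 q0 rm Kq R1).
- move=> n f f0 f1 x.
  exact: (iter_envelope pK sK K1 pA AK pC CA L0 ACL q0 rm Kq).
Qed.

Theorem gap_geometrically_ergodic (r : R) : 0 < r < 1 -> gap pi K r ->
  {ae pi, forall x, c x < 1} ->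
  geometrically_ergodic pi (accept_reject_kernel q a).
Proof.
move=> r01 gK c1.
have [m [B [C [m0 B0 BC HB]]]] := gap_envelope r01 gK c1.
have m0' : 0 < m%:R :> R by rewrite ltr0n.
(* With [t = 1 / (3 m)], Bernoulli's inequality gives [(1 - t)^m >= 2/3], so [m] steps at rate [rho]
   dominate one factor 2/3. *)
pose t : R := 3^-1 / m%:R.
have tm : m%:R * t = 3^-1 by rewrite /t mulrCA mulfV ?mulr1 ?gt_eqF.
have t0 : 0 < t by rewrite divr_gt0.
have t1 : t <= 3^-1.
  by rewrite ler_pdivrMr// ler_peMr// ler1n.
pose rho := 1 - t.
have rho0 : 0 < rho by rewrite /rho; lra.
have rho1 : rho < 1 by rewrite /rho; lra.
have rhom : 2 / 3 <= rho ^+ m.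
  apply: le_trans (bernoulli_ge m _); first by rewrite tm; lra.
  by apply/andP; split; lra.
(* The weights [(3/2)^n] leave means of order [(3/4)^n], so [S] is finite almost everywhere, while
   each single term yields [B n x <= (2/3)^n S x]. *)
pose S x := (\sum_(n <oo) (((3 / 2) ^+ n *: B n) x)%:E)%E.
have U0 n : nonneg ((3 / 2) ^+ n *: B n).
  by move=> x; rewrite bfunZ mulr_ge0 ?exprn_ge0 ?B0.
have S0 x : (0 <= S x)%E by apply: nneseries_ge0 => n _ _; rewrite lee_fin U0.
exists rho, (fun x => (3 / 2)%:E * S x)%E; split.
- by rewrite rho0.
- by move=> x; rewrite mule_ge0// lee_fin.
- have : {ae pi, forall x, (S x < +oo)%E}.
    apply: (@ae_summable _ _ _ _ _ C (3 / 4)) => //; first lra.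
    move=> n; rewrite ExZ.
    have -> : C * (3 / 4) ^+ n = (3 / 2) ^+ n * (C * 2^-1 ^+ n).
      by rewrite mulrCA -exprMn; congr (_ * _ ^+ _); field.
    by rewrite ler_wpM2l// exprn_ge0.
  apply: filterS => x Sx.
  by rewrite lte_mul_pinfty// ?lee_fin.
- move=> N x A mA; rewrite nstepE -(Ex_ind pi mA) -EFinB.
  set f := bind R mA; pose g := centered pi f.
  have K1 : K (bcst 1) = bcst 1 by exact: kop_cst.
  have pK : posop K by exact: kop_pos.
  have sK : symop pi K by exact: accept_reject_sym.
  have -> : iter N K f x - Ex pi f = iter N K g x.
    rewrite /g (iter_center sK K1) /centered bfunB_ bcstE.
    by rewrite (Ex_iter_markov sK K1).
  have g1 y : `|g y| <= 1.
    have f0 z : 0 <= f z by rewrite /= indicE; case: (_ \in _).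
    have f1 z : f z <= 1 by rewrite /= indicE; case: (_ \in _).
    rewrite bfunB_ bcstE; apply: dist_unit_le1; first by rewrite f0 f1.
    rewrite (Ex_ge0 pi f0) -[leRHS](Ex_cst pi 1) /=; exact: Ex_le.
  set n := (N %/ m)%N.
  have iterE h : iter N K h = iter n (iter m K) (iter (N %% m) K h).
    rewrite {1}(divn_eq N m) iterD; move: (iter (N %% m) K h) => {}h.
    by rewrite -/n; elim: n => //= n <-; rewrite mulSn iterD.
  have gB : `|iter N K g x| <= B n x.
    rewrite iterE; apply: HB; first by rewrite (Ex_iter_markov sK K1) Ex_center.
    exact: iter_markov_bound.
  (* As [N < m (n + 1)], it is [(2/3)^(n+1)] that lies below [rho ^+ N]; the missing factor is the
     3/2 in front of [S]. *)
  have nN : (2 / 3) ^+ n <= 3 / 2 * rho ^+ N.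
    have : (2 / 3) ^+ n.+1 <= rho ^+ N.
      apply: (@le_trans _ _ ((rho ^+ m) ^+ n.+1)).
        by rewrite lerXn2r ?nnegrE ?exprn_ge0// ?ltW//; lra.
      rewrite -exprM ler_wiXn2l ?ltW// mulnC.
      by rewrite {1}(divn_eq N m) mulSn addnC leq_add2r ltnW// ltn_mod.
    rewrite exprS; set u := _ ^+ n; lra.
  have BS : (((3 / 2) ^+ n * B n x)%:E <= S x)%E.
    have := @nneseries_lim_ge R (fun n => (((3 / 2) ^+ n *: B n) x)%:E) xpredT 0 n.+1.
    move=> /(_ (fun n _ _ => U0 n x : (0 <= _%:E)%E)); apply: le_trans.
    rewrite big_nat_recr//= leeDr// sume_ge0// => i _; exact: U0.
  rewrite abse_EFin; apply: (@le_trans _ _ (((3 / 2)%:E *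
    ((3 / 2) ^+ n * B n x)%:E) * (rho ^+ N)%:E)%E); last first.
    apply: lee_wpmul2r; first by rewrite lee_fin exprn_ge0// ltW.
    by apply: lee_wpmul2l => //; rewrite lee_fin.
  rewrite -!EFinM lee_fin (le_trans gB)//.
  have uu : (2 / 3) ^+ n * (3 / 2) ^+ n = 1 :> R.
    by rewrite -exprMn (_ : _ * _ = 1) ?expr1n//; field.
  have b0 : 0 <= (3 / 2) ^+ n * B n x by exact: U0.
  have := ler_wpM2r b0 nN; rewrite mulrA uu mul1r; lra.
Qed.

End gap_to_geometric.

(** * Rejection is almost surely not certain *)

Section atomless.
Context d (T : measurableType d) (R : realType) (P : probability T R).
Variable g : T -> R.
Hypotheses (mg : measurable_fun setT g) (g0 : forall t, P (g @^-1` [set t]) = 0%E).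

Let mle s : measurable [set x | g x <= s].
Proof.
rewrite (_ : [set _ | _] = g @^-1` [set` `]-oo, s]]).
  by rewrite -[X in measurable X]setTI; exact: mg.
by apply/seteqP; split => x /=; rewrite in_itv.
Qed.

(* An atom of P would be concentrated on a single level set of g. *)
Lemma atomless_null (B : set T) : measurable B ->
  (forall A, measurable A -> A `<=` B -> P A = 0%E \/ P (~` A) = 0%E) -> P B = 0%E.
Proof.
move=> mB split01; apply: contrapT => PB.
pose lo s := P.-negligible (B `&` [set x | g x <= s]).
pose hi s := P.-negligible (B `&` [set x | s < g x]).
have dich s : lo s \/ hi s.
  have mA : measurable (B `&` [set x | g x <= s]) by exact: measurableI.
  have [A0|A0] := split01 _ mA (@subIsetl _ _ _); [left|right].
    exact/negligibleP.
  apply: (negligibleS _ ((negligibleP _ (measurableC mA)).2 A0)).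
  by move=> x [Bx /= sx] [_ /=]; rewrite leNgt sx.
have PBn : ~ P.-negligible B by move/(negligibleP _ mB).
have lo_le s t : s <= t -> lo t -> lo s.
  by move=> st; apply: negligibleS => x [Bx /= xs]; split=> //=; exact: le_trans st.
pose S := [set s | lo s].
have S0 : S !=set0.
  apply: contrapT => /forallNP nS; apply: PBn.
  apply: (negligibleS _ (negligible_bigcup (F := fun n : nat =>
    B `&` [set x | - n%:R < g x]) _)).
    move=> x Bx; exists (Num.bound (g x)) => //; split => //=.
    by rewrite ltrNl unstable.ltrNbound.
  by move=> n; have [/nS|] := dich (- n%:R).
have hS : has_ubound S.
  apply: contrapT => nS; apply: PBn.
  apply: (negligibleS _ (negligible_bigcup (F := fun n : nat =>
    B `&` [set x | g x <= n%:R]) _)).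
    move=> x Bx; exists (Num.bound (g x)) => //; split => //=.
    by rewrite ltW// unstable.ltr_bound.
  move=> n; apply: contrapT => nlo; apply: nS; exists n%:R => s Ss.
  by rewrite leNgt; apply/negP => ns; apply: nlo; apply: lo_le Ss; exact: ltW.
(* Below [t0] the lower part of [B] is null and above [t0] the upper part is, so [B] lies in the
   level set of [t0] up to countably many null sets. *)
pose t0 := sup S.
have lo0 s : s < t0 -> lo s.
  by move=> /(sup_gt S0)[u Su /ltW su]; exact: lo_le Su.
have hi0 s : t0 < s -> hi s.
  move=> ts; have [los|//] := dich s.
  by have := ub_le_sup hS los; rewrite leNgt ts.
apply: PBn.
pose I n : R := n.+1%:R^-1.
have Igt0 n : 0 < I n by rewrite invr_gt0.
have I0 e : 0 < e -> exists n, I n < e.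
  by move=> e0; exists (Num.trunc e^-1); rewrite invf_plt ?posrE// truncnS_gt.
apply: (@negligibleS _ _ _ _ ((\bigcup_n (B `&` [set x | g x <= t0 - I n])) `|`
  (\bigcup_n (B `&` [set x | t0 + I n < g x])) `|` g @^-1` [set t0])).
  move=> x Bx; have [xt|tx|xt] := ltgtP (g x) t0; last by right.
  - have [|n nI] := I0 (t0 - g x); first by rewrite subr_gt0.
    by left; left; exists n => //; split => //=; lra.
  - have [|n nI] := I0 (g x - t0); first by rewrite subr_gt0.
    by left; right; exists n => //; split => //=; lra.
apply: negligibleU; first apply: negligibleU.
- by apply: negligible_bigcup => n; apply: lo0; have := Igt0 n; lra.
- by apply: negligible_bigcup => n; apply: hi0; have := Igt0 n; lra.
- apply/negligibleP; last exact: g0.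
  rewrite -[X in measurable X]setTI; exact: mg.
Qed.

End atomless.

Section rejection_lt1.
Context d (T : measurableType d) (R : realType).
Variable mu : {sigma_finite_measure set T -> \bar R}.
Variables (p : density mu) (q : proposal mu) (a : acceptance T R).
Local Notation pi := (law p).
Local Notation c := (rejection q a).
Local Notation K := (kop (accept_reject_kernel q a)).

(* States with c = 1 are absorbing, so an indicator supported there is
   invariant, which a spectral gap only allows for null or conull sets. *)
Lemma gap_rejection_lt1 (r : R) (g : T -> R) : 0 < r < 1 ->
  symop pi K -> gap pi K r ->
  measurable_fun setT g -> (forall t, pi (g @^-1` [set t]) = 0%E) ->
  {ae pi, forall x, c x < 1}.
Proof.
move=> /andP[r0 r1] sK gK mg g0.
have pK : posop K by exact: kop_pos.
have K1 : K (bcst 1) = bcst 1 by exact: kop_cst.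
pose B := [set x | c x = 1].
have mB : measurable B.
  rewrite (_ : B = c @^-1` [set 1]) // -[X in measurable X]setTI.
  exact: (bfun_measurable c).
exists B; split => //; last first.
  move=> x /= /negP; rewrite -leNgt => cx; apply/le_anti.
  by rewrite cx rejection_le1.
apply: (atomless_null mg g0 mB) => A mA AB.
set f := bind R mA; set s := Ex pi f.
have s0 : 0 <= s by apply: Ex_ge0 => x; rewrite /= indicE.
have nf : nrm pi f = s.
  congr Ex; apply: bfun_ext => x; rewrite bmulE /= indicE.
  by case: (_ \in _); rewrite ?mulr0 ?mulr1.
(* On [A] the holding probability is 1, so [K f >= f] there; off [A] the product with [f] is 0. *)
have fK : s <= dot pi f (K f).
  apply: Ex_le => x; rewrite kop_accept_reject bmulE bfunD bmulE.
  have f0 : nonneg f by move=> y; rewrite /= indicE.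
  have w0 := opw_pos (move_sd q a) f0 x.
  have -> : f x = (x \in A)%:R by rewrite /= indicE.
  have [|_] := boolP (x \in A); last by rewrite mul0r.
  rewrite inE => /AB cx.
  by rewrite mul1r mulr1 cx lerDr.
have := @gap_dot _ _ _ pi K sK K1 r 1 (centered pi f) (ltW r0) gK (Ex_center _ _).
rewrite /= -[K (centered _ _)]/(iter 1 K (centered pi f)).
rewrite (dot_iter_center sK K1) nrm_center nf expr1 /= => H.
have := le_trans (ler_norm _) H => {}H.
(* The gap applied to the centered indicator reads [s - s^2 <= r (s - s^2)] with [r < 1], which
   leaves only [s = 0] or [s = 1]. *)
have ss : s * (1 - s) <= 0.
  have : (1 - r) * (s - s ^+ 2) <= 0 by nra.
  by rewrite pmulr_rle0 ?subr_gt0//; nra.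
rewrite -(Ex_ind pi mA) -/f -/s.
have /orP[/eqP->|/eqP s1] : (s == 0) || (s == 1); [|by left|right].
  have s1 : s <= 1.
    rewrite /s -(Ex_cst pi 1); apply: Ex_le => x.
    by rewrite /= indicE; case: (_ \in _).
  have /eqP : s * (1 - s) = 0 by apply/le_anti; rewrite ss mulr_ge0// subr_ge0.
  by rewrite mulf_eq0 subr_eq0 [1 == s]eq_sym.
rewrite probability_setC// -(Ex_ind pi mA) -/f -/s s1.
by rewrite subee.
Qed.

End rejection_lt1.

Section euclidean.
Context (R : realType).
Local Open Scope ereal_scope.

(** On Borel sets the completed measure is the product measure, and the hyperplane is a point times
    the whole space; the other factor may be infinite, and [0 * +oo = 0]. *)
Lemma lebesgue_hyperplane n (t : R) :
  lebesgue [set y : euclidean R n.+1 | thead (y : n.+1.-tuple R) = t] = 0.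
Proof.
have mH : measurable [set y : n.+1.-tuple (measurableTypeR R) | thead y = t].
  rewrite [X in measurable X](_ : _ =
    (fun y : n.+1.-tuple (measurableTypeR R) => thead y) @^-1` [set t])//.
  rewrite -[X in measurable X]setTI.
  exact: (measurable_tnth ord0).
rewrite /lebesgue /completed_measure_extension measurable_mu_extE//=.
rewrite /lebesgue_step /pushforward.
rewrite (_ : _ @^-1` _ = [set t] `*` setT).
  rewrite product_measure1E//.
  by rewrite [X in X * _](lebesgue_measure_set1 t) mul0e.
apply/seteqP; split => -[x y] /=; rewrite /tuple_cons theadE //.
by case.
Qed.

Variables (n : nat) (X : state_space R n.+1).

Definition coordinate (x : X) : R := thead (state_val x : n.+1.-tuple R).

Lemma coordinate_measurable : measurable_fun setT coordinate.
Proof.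
move=> _ A mA; rewrite setTI.
exists [set y : euclidean R n.+1 | A (thead (y : n.+1.-tuple R))]; last first.
  by rewrite setTI.
apply: caratheodory_measurable_mu_ext.
rewrite [X in measurable X](_ : _ =
  (fun y : n.+1.-tuple (measurableTypeR R) => thead y) @^-1` A)//.
rewrite -[X in measurable X]setTI.
exact: (measurable_tnth ord0).
Qed.

Lemma law_coordinate (p : density (lebesgue_on X)) t :
  law p (coordinate @^-1` [set t]) = 0.
Proof.
have mA : measurable (coordinate @^-1` [set t]).
  by rewrite -[X in measurable X]setTI; exact: coordinate_measurable.
apply: null_set_integral => //.
  apply/measurable_EFinP; apply: measurable_funTS; exact: measurable_density.
apply/eqP; rewrite -measure_le0 -(lebesgue_hyperplane n t).
apply: le_outer_measure => _ [x /= xt <-].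
exact: xt.
Qed.

End euclidean.

(** * The law of the chain *)

Section simple_approximation.
Context d (T : measurableType d) (R : realType).
Local Notation V := (bfun T R).

Lemma bfun_level_measurable (f : V) (a : R) : measurable [set x | a <= f x].
Proof.
rewrite (_ : [set _ | _] = f @^-1` [set` `[a, +oo[]).
  by rewrite -[X in measurable X]setTI; exact: (bfun_measurable f).
by apply/seteqP; split => x /=; rewrite in_itv/= andbT.
Qed.

(** For nonnegative [f] and [e > 0] this is [e] times the integer part of [f x / e], capped at [n]:
    a staircase written as a combination of indicators. *)
Definition level_sum (f : V) (e : R) (n : nat) : V :=
  \sum_(i < n) e *: bind R (bfun_level_measurable f (i.+1%:R * e)).

Lemma level_sum_close (f : V) (e : R) n : 0 < e -> nonneg f ->
  (forall x, f x < n.+1%:R * e) -> forall x, `|f x - level_sum f e n x| <= e.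
Proof.
move=> e0 f0 fn x.
have H m : (m%:R * e <= f x -> level_sum f e m x = m%:R * e) /\
    (f x < m%:R * e -> 0 <= f x - level_sum f e m x <= e).
  elim: m => [|m [IH1 IH2]].
    rewrite /level_sum big_ord0 mul0r bfun0; split => //.
    by rewrite ltNge f0.
  rewrite /level_sum big_ord_recr bfunD bfunZ -/(level_sum f e m) /= indicE.
  split => [fm|fm].
    rewrite mem_set//= mulr1 IH1; first by rewrite -natr1 mulrDl mul1r.
    by apply: le_trans fm; rewrite ler_pM2r// ler_nat.
  rewrite memNset/= ?mulr0 ?addr0; last by apply/negP; rewrite -ltNge.
  have [mf|/IH2//] := leP (m%:R * e) (f x).
  by rewrite IH1//; rewrite -natr1 mulrDl mul1r in fm; lra.
have [H1 H2] := H n.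
have [nf|/H2/andP[? ?]] := leP (n%:R * e) (f x); last by rewrite ger0_norm.
rewrite H1// ger0_norm ?subr_ge0//.
by have := fn x; rewrite -natr1 mulrDl mul1r; lra.
Qed.

(** Both functionals are continuous for the sup norm, and the staircases [level_sum] approximate
    nonnegative bounded functions uniformly. *)
Lemma eq_scalar_indicator (A B : {scalar V}) (C : R) :
  (forall (f : V) a, (forall x, `|f x| <= a) -> `|A f| <= C * a) ->
  (forall (f : V) a, (forall x, `|f x| <= a) -> `|B f| <= C * a) ->
  (forall D (mD : measurable D), A (bind R mD) = B (bind R mD)) ->
  A =1 B.
Proof.
move=> bA bB AB f.
suff {f} H f : nonneg f -> A f = B f.
  have [g [a [g0 a0 ->]]] := bfun_shift f.
  by rewrite !linearB/= !H.
move=> f0; have [M M0 fM] := bfunB f.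
have C0 : 0 <= C.
  have := bA (bcst 1) 1; rewrite mulr1 => H; apply: le_trans (H _) => // x.
  by rewrite bfunE normr1.
have close e : 0 < e -> `|A f - B f| <= 2 * C * e.
  move=> e0; pose n := Num.bound (M / e).
  have := @level_sum_close f e n e0 f0 => /(_ _) sc.
  have {}sc : forall x, `|(f - level_sum f e n) x| <= e.
    move=> x; rewrite bfunE; apply: sc => y.
    apply: (le_lt_trans (le_trans (ler_norm _) (fM y))).
    rewrite -ltr_pdivrMr// (lt_le_trans (unstable.ltr_bound _))// ler_nat.
    exact: leqnSn.
  have ABs : A (level_sum f e n) = B (level_sum f e n).
    rewrite /level_sum !linear_sum; apply: eq_bigr => i _.
    by rewrite !linearZ/= AB.
  have -> : A f - B f = A (f - level_sum f e n) - B (f - level_sum f e n).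
    by rewrite !linearB/= ABs; ring.
  apply: (le_trans (ler_normB _ _)).
  have := bA _ _ sc; have := bB _ _ sc; lra.
apply/eqP; rewrite -subr_eq0 -normr_le0; apply/ler_addgt0Pr => e e0.
rewrite add0r; have C1 : 0 < 2 * C + 1 by lra.
apply: (le_trans (close (e / (2 * C + 1)) _)); first by rewrite divr_gt0.
rewrite mulrA ler_pdivrMr// mulrC ler_pM2l//; lra.
Qed.

Lemma eq_linear_indicator (A_ B_ : V -> R) (C : R) :
  linear_for *%R A_ -> linear_for *%R B_ ->
  (forall (f : V) a, (forall x, `|f x| <= a) -> `|A_ f| <= C * a) ->
  (forall (f : V) a, (forall x, `|f x| <= a) -> `|B_ f| <= C * a) ->
  (forall D (mD : measurable D), A_ (bind R mD) = B_ (bind R mD)) ->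
  A_ =1 B_.
Proof.
move=> linA linB.
pose lA := GRing.isLinear.Build R V R *%R A_ linA.
pose A : {linear V -> R | *%R} := HB.pack A_ lA.
pose lB := GRing.isLinear.Build R V R *%R B_ linB.
pose B : {linear V -> R | *%R} := HB.pack B_ lB.
exact: (@eq_scalar_indicator A B).
Qed.

End simple_approximation.

Lemma Ex_norm_le d (T : measurableType d) (R : realType) (P : probability T R)
    (f : bfun T R) (a : R) :
  (forall x, `|f x| <= a) -> `|Ex P f| <= 1 * a.
Proof.
move=> fa; rewrite mul1r -[leRHS](Ex_cst P) (le_trans (Ex_abs _ _))//.
exact: Ex_le.
Qed.

Section chain_step_operator.
Context d0 d (S : measurableType d0) (T : measurableType d) (R : realType).
Context {n : nat}.
Variables (k1 : R.-pker S ~> T) (k2 : R.-pker T ~> n.-tuple T).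
Local Open Scope ereal_scope.

Let cons_measurable y :
  measurable_fun setT (fun t : n.-tuple T => tuple_cons (y, t)).
Proof.
exact: (measurableT_comp (@measurable_tuple_cons _ T n) (pair1_measurable y)).
Qed.

(** Law of the path that starts with the state [y] itself. With it [chain_step] becomes [k1]
    followed by a kernel, so path expectations are products of operators. *)
Definition cons_law (y : T) (A : set (n.+1.-tuple T)) : \bar R :=
  k2 y [set t | A (tuple_cons (y, t))].

Let preimage_measurable y (A : set (n.+1.-tuple T)) : measurable A ->
  measurable [set t | A (tuple_cons (y, t))].
Proof.
move=> mA; rewrite -[X in measurable X]setTI.
exact: (cons_measurable y measurableT mA).
Qed.

Let cons_law0 y : cons_law y set0 = 0.
Proof. exact: (measure0 (k2 y)). Qed.

Let cons_law_ge0 y A : 0 <= cons_law y A.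
Proof. exact: measure_ge0. Qed.

Let cons_law_sigma_additive y : semi_sigma_additive (cons_law y).
Proof.
move=> F mF tF mUF; apply: (@measure_semi_sigma_additive _ _ _ (k2 y)
    (fun i => [set t | F i (tuple_cons (y, t))])).
- by move=> i; exact: preimage_measurable.
- by move=> i j _ _ [t [Fi Fj]]; apply: tF => //; exists (tuple_cons (y, t)).
- exact: (preimage_measurable y mUF).
Qed.

HB.instance Definition _ y := isMeasure.Build _ _ _ (cons_law y)
  (cons_law0 y) (cons_law_ge0 y) (@cons_law_sigma_additive y).

Definition cons_kernel : T -> {measure set n.+1.-tuple T -> \bar R} := cons_law.

Let measurable_cons_kernel A : measurable A ->
  measurable_fun setT (cons_kernel ^~ A).
Proof.
move=> mA; rewrite (_ : cons_kernel ^~ A =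
  (fun y => k2 y (xsection (@tuple_cons T n @^-1` A) y))).
  apply: measurable_fun_xsection_finite_kernel.
  rewrite inE -[X in measurable X]setTI.
  exact: measurable_tuple_cons.
by apply/funext => y; rewrite xsectionE.
Qed.

HB.instance Definition _ := isKernel.Build _ _ _ _ _ cons_kernel
  measurable_cons_kernel.
HB.instance Definition _ := Kernel_isProbability.Build _ _ _ _ _
  cons_kernel (fun y => prob_kernel y : cons_kernel y setT = 1).

Local Close Scope ereal_scope.

Lemma cons_bfun_subproof (F : bfun (n.+1.-tuple T) R) y :
  exists M, forall t, `|F (tuple_cons (y, t))| <= M.
Proof. by have [M _ FM] := bfunB F; exists M. Qed.

Definition cons_bfun (F : bfun (n.+1.-tuple T) R) y : bfun (n.-tuple T) R :=
  BFun (measurableT_comp (bfun_measurable F) (cons_measurable y))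
    (cons_bfun_subproof F y).

Lemma kop_cons_kernel (F : bfun (n.+1.-tuple T) R) y :
  kop cons_kernel F y = Ex (kernel_at k2 y) (cons_bfun F y).
Proof.
move: F; apply: (@eq_linear_indicator _ _ _ _ _ 1%R).
- by move=> a f g; rewrite linearP.
- move=> a f g; rewrite (_ : cons_bfun _ _ = a *: cons_bfun f y + cons_bfun g y).
    by rewrite linearP.
  exact: bfun_ext.
- by move=> f a fa; exact: Ex_norm_le.
- by move=> f a fa; apply: Ex_norm_le => t; exact: fa.
move=> D mD; apply/EFin_inj; rewrite kopE integral_indic// setIT.
rewrite (_ : cons_bfun _ _ = bind R (preimage_measurable y mD)).
  by rewrite Ex_ind.
exact: bfun_ext.
Qed.

Lemma Ex_chain_step (x : S) (F : bfun (n.+1.-tuple T) R) :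
  Ex (chain_step k1 k2 x) F = kop k1 (kop cons_kernel F) x.
Proof.
move: F; apply: (@eq_linear_indicator _ _ _ _ _ 1%R).
- by move=> a f g; rewrite linearP.
- by move=> a f g; rewrite !linearP.
- by move=> f a fa; exact: Ex_norm_le.
- move=> f a fa; rewrite mul1r -[leRHS](Ex_cst (kernel_at k1 x)).
  apply: (le_trans (Ex_abs _ _)); apply: Ex_le => y.
  by rewrite bcstE -[leRHS]mul1r; exact: Ex_norm_le.
move=> D mD; apply/EFin_inj; rewrite Ex_ind kopE.
by apply: eq_integral => y _; rewrite kopE integral_indic// setIT.
Qed.

End chain_step_operator.

Section coordinate_functions.
Context d (T : measurableType d) (R : realType).

Lemma bcoord_subproof n (i : 'I_n) (f : bfun T R) :
  exists M, forall t : n.-tuple T, `|f (tnth t i)| <= M.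
Proof. by have [M _ fM] := bfunB f; exists M. Qed.

Definition bcoord n (i : 'I_n) (f : bfun T R) : bfun (n.-tuple T) R :=
  BFun (measurableT_comp (bfun_measurable f) (measurable_tnth i))
    (bcoord_subproof i f).

Variables (pi : probability T R) (P : R.-pker T ~> T).
Local Notation K := (kop P).

(** Induction peels off the first state. The outer exponent is [i.+1] because coordinate 0 of the
    path is already one step away from [x]. *)
Lemma Ex_path_pair n (i j : 'I_n) (f g : bfun T R) x : (i <= j)%N ->
  Ex (kernel_at (chain_path P n) x) (bmul (bcoord i f) (bcoord j g)) =
  iter i.+1 K (bmul f (iter (j - i) K g)) x.
Proof.
elim: n i j f g x => [[]//|n IH] i j f g x.
have E F : Ex (kernel_at (chain_path P n.+1) x) F =
    kop P (kop (cons_kernel (chain_path P n)) F) x by exact: Ex_chain_step.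
rewrite E iterS => ij; congr (kop P _ x); apply: bfun_ext => y.
rewrite kop_cons_kernel.
have [i' i0|i0] := unliftP ord0 i; have [j' j0|j0] := unliftP ord0 j.
- rewrite i0 j0 !lift0 subSS -IH; last by move: ij; rewrite i0 j0 !lift0.
  by congr Ex; apply: bfun_ext => t; rewrite /= !tnthS.
- by move: ij; rewrite i0 j0.
- rewrite i0 j0 [RHS](_ : _ = f y * iter j'.+1 K g y)//.
  rewrite (_ : cons_bfun _ _ = f y *: bcoord j' g); last first.
    by apply: bfun_ext => t; rewrite /= !tnthS tnth0.
  (* A one-coordinate moment is treated as a pair at equal times whose other function is 1. *)
  rewrite ExZ (_ : bcoord j' g = bmul (bcoord j' (bcst 1)) (bcoord j' g)).
    rewrite IH// subnn iterS; congr (_ * kop P _ y).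
    by congr iter; apply: bfun_ext => z; rewrite !bfunE mul1r.
  by apply: bfun_ext => t; rewrite bfunE mul1r.
- rewrite i0 j0 (_ : cons_bfun _ _ = bcst (f y * g y)) ?Ex_cst//.
  exact: bfun_ext.
Qed.

Hypotheses (sK : symop pi K).

Let K1 : K (bcst 1) = bcst 1.
Proof. exact: kop_cst. Qed.

Lemma Ex_chain_law_cons n (F : bfun (n.+1.-tuple T) R) :
  Ex (chain_law pi P n) F = Ex pi (kop (cons_kernel (chain_path P n)) F).
Proof. exact: Ex_chain_step. Qed.

(** The same peeling, now from the initial law: the outer iterate disappears under [Ex pi] by
    stationarity. *)
Lemma Ex_chain_pair n (i j : 'I_n.+1) (f g : bfun T R) : (i <= j)%N ->
  Ex (chain_law pi P n) (bmul (bcoord i f) (bcoord j g)) =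
  dot pi f (iter (j - i) K g).
Proof.
move=> ij; rewrite Ex_chain_law_cons -[RHS](Ex_iter_markov sK K1 i).
congr Ex; apply: bfun_ext => y; rewrite kop_cons_kernel.
have [i' i0|i0] := unliftP ord0 i; have [j' j0|j0] := unliftP ord0 j.
- rewrite i0 j0 !lift0 subSS -Ex_path_pair; last by move: ij; rewrite i0 j0 !lift0.
  by congr Ex; apply: bfun_ext => t; rewrite /= !tnthS.
- by move: ij; rewrite i0 j0.
- rewrite i0 j0 [RHS](_ : _ = f y * iter j'.+1 K g y)//.
  rewrite (_ : cons_bfun _ _ = f y *: bcoord j' g); last first.
    by apply: bfun_ext => t; rewrite /= !tnthS tnth0.
  rewrite ExZ (_ : bcoord j' g = bmul (bcoord j' (bcst 1)) (bcoord j' g)).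
    rewrite Ex_path_pair// subnn iterS; congr (_ * kop P _ y).
    by congr iter; apply: bfun_ext => z; rewrite !bfunE mul1r.
  by apply: bfun_ext => t; rewrite bfunE mul1r.
- rewrite i0 j0 (_ : cons_bfun _ _ = bcst (f y * g y)) ?Ex_cst//.
  exact: bfun_ext.
Qed.

Lemma Ex_chain_coord n (i : 'I_n.+1) (f : bfun T R) :
  Ex (chain_law pi P n) (bcoord i f) = Ex pi f.
Proof.
have -> : bcoord i f = bmul (bcoord i (bcst 1)) (bcoord i f).
  by apply: bfun_ext => t; rewrite bfunE mul1r.
by rewrite Ex_chain_pair// subnn dot1l.
Qed.

Lemma chain_law_coord n (i : 'I_n.+1) (A : set T) : measurable A ->
  chain_law pi P n [set t | A (tnth t i)] = pi A.
Proof.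
move=> mA.
have mB : measurable [set t : n.+1.-tuple T | A (tnth t i)].
  by rewrite -[X in measurable X]setTI; exact: (measurable_tnth i measurableT mA).
rewrite -(Ex_ind _ mB) -(Ex_ind _ mA) -(Ex_chain_coord i); congr (Ex _ _)%:E.
exact: bfun_ext.
Qed.

Lemma integral_chain_coord n (i : 'I_n.+1) (h : T -> \bar R) :
  measurable_fun setT h -> (forall x, 0 <= h x)%E ->
  (\int[chain_law pi P n]_t h (tnth t i) = \int[pi]_x h x)%E.
Proof.
move=> mh h0.
rewrite -(@ge0_integral_pushforward _ _ _ _ _ _ (measurable_tnth i)
  (chain_law pi P n) setT h)//.
apply: eq_measure_integral => [|mf A mA _].
  exact: measurable_tnth.
exact: (chain_law_coord i mA).
Qed.

End coordinate_functions.

(** * From geometric ergodicity to a spectral gap *)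

Section joint_measure.
Context d (T : measurableType d) (R : realType).
Variables (pi : probability T R) (k : R.-spker T ~> T).
Local Open Scope ereal_scope.

(* The law of (X, Y) where X has law pi and Y has law k X given X. *)
Definition joint (E : set (T * T)) : \bar R := \int[pi]_x k x (xsection E x).

Lemma joint_section_measurable E : measurable E ->
  measurable_fun setT (fun x => k x (xsection E x)).
Proof.
by move=> mE; apply: measurable_fun_xsection_finite_kernel; rewrite inE.
Qed.

Let joint0 : joint set0 = 0.
Proof.
by rewrite /joint; apply: integral0_eq => x _; rewrite xsection0 measure0.
Qed.

Let joint_ge0 E : 0 <= joint E.
Proof. exact: integral_ge0. Qed.

Let joint_sigma_additive : semi_sigma_additive joint.
Proof.
move=> F mF tF mUF.
have -> : joint (\bigcup_i F i) = \sum_(i <oo) joint (F i).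
  rewrite /joint -integral_nneseries//; last first.
    by move=> i; exact: joint_section_measurable.
  apply: eq_integral => x _; rewrite xsection_bigcup measure_semi_bigcup//.
  - by move=> i; exact: measurable_xsection.
  - exact: trivIset_xsection.
  - by rewrite -xsection_bigcup; exact: measurable_xsection.
by apply: is_cvg_nneseries => i _ _; exact: joint_ge0.
Qed.

HB.instance Definition _ := isMeasure.Build _ _ _ joint
  joint0 joint_ge0 joint_sigma_additive.

Let joint_finite : fin_num_fun joint.
Proof.
apply: lty_fin_num_fun; rewrite /joint (@le_lt_trans _ _ (\int[pi]_x cst 1 x))//.
  apply: ge0_le_integral => //; first exact: joint_section_measurable.
  by move=> x _; rewrite xsectionE preimage_setT; exact: sprob_kernel_le1.
by rewrite integral_cst// mul1e (le_lt_trans (probability_le1 _ _))// ltry.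
Qed.

HB.instance Definition _ := @Measure_isFinite.Build _ _ _ joint joint_finite.

End joint_measure.

Section hahn_comparison.
Context d (T : measurableType d) (R : realType).
Variables (m1 m2 : {finite_measure set T -> \bar R}).
Local Open Scope ereal_scope.

Lemma hahn_comparison : exists2 A, measurable A &
  (forall E, measurable E -> E `<=` A -> m2 E <= m1 E) /\
  (forall E, measurable E -> E `<=` ~` A -> m1 E <= m2 E).
Proof.
pose nu := cadd (charge_of_finite_measure m1)
  (cscale (-1) (charge_of_finite_measure m2)).
have nuE E : measurable E -> nu E = m1 E - m2 E.
  by move=> mE; rewrite /nu/= /cadd/= cscaleN1.
have [A [N [[mA posA] [mN negN] AN AN0]]] := Hahn_decomposition nu.
exists A => //; split => E mE EA.
  have : 0 <= nu E := posA _ mE EA.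
  by rewrite nuE// sube_ge0 ?fin_num_measure// orbT.
have : nu E <= 0.
  apply: negN => // x /EA nAx.
  have : (A `|` N) x by rewrite AN.
  by case.
by rewrite nuE// sube_le0.
Qed.

(** The excess [m1 - m2] is nonnegative on [C], so its value on [B] is at most that on the union of
    [B] and [C]; adding [A], where it is nonpositive, cannot increase it. *)
Lemma measure_exchange (A B C : set T) (e : R) :
  measurable A -> measurable B -> measurable C ->
  A `&` B = set0 -> B `&` C = set0 ->
  m1 A <= m2 A -> m2 C <= m1 C -> m1 (B `|` C) <= m2 (B `|` C) + e%:E ->
  m1 (A `|` B) <= m2 (A `|` B) + e%:E.
Proof.
move=> mA mB mC AB BC.
have -> : m1 (A `|` B) = m1 A + m1 B by exact: measureU.
have -> : m1 (B `|` C) = m1 B + m1 C by exact: measureU.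
have -> : m2 (A `|` B) = m2 A + m2 B by exact: measureU.
have -> : m2 (B `|` C) = m2 B + m2 C by exact: measureU.
have f1 S : measurable S -> m1 S = (fine (m1 S))%:E.
  by move=> mS; rewrite fineK// fin_num_measure.
have f2 S : measurable S -> m2 S = (fine (m2 S))%:E.
  by move=> mS; rewrite fineK// fin_num_measure.
rewrite (f1 A)// (f1 B)// (f1 C)// (f2 A)// (f2 B)// (f2 C)//.
rewrite -!EFinD !lee_fin; lra.
Qed.

End hahn_comparison.

Section geometric_to_gap.
Context d (T : measurableType d) (R : realType).
Variables (pi : probability T R) (P : R.-pker T ~> T).
Local Notation V := (bfun T R).
Local Notation K := (kop P).

Fixpoint nstep_kernel (n : nat) : R.-spker T ~> T :=
  if n is n'.+1 then mkcomp_noparam P (nstep_kernel n')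
  else kdirac (@measurable_id _ T setT).

Lemma nstep_kernelE n x A : nstep_kernel n x A = nstep P n x A.
Proof.
elim: n x => [//|n IH] x /=; rewrite /mkcomp_noparam /kcomp_noparam.
by apply: eq_integral => y _; exact: IH.
Qed.

Hypothesis sK : symop pi K.

Let pK : posop K. Proof. exact: kop_pos. Qed.
Let K1 : K (bcst 1) = bcst 1. Proof. exact: kop_cst. Qed.

Definition pi_kernel : R.-spker T ~> T :=
  kprobability (measurable_cst (pi : pprobability T R)).

Lemma joint_setX_nstep n E (mE : measurable E) :
  joint pi (nstep_kernel n) (E `*` E) =
  (dot pi (bind R mE) (iter n K (bind R mE)))%:E.
Proof.
rewrite ExE; apply: eq_integral => x _; rewrite bmulE EFinM -nstepE /= indicE.
have [xE|xE] := boolP (x \in E).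
  by rewrite in_xsectionX// mul1e nstep_kernelE.
by rewrite notin_xsectionX// measure0 mul0e.
Qed.

Lemma joint_setX_pi E (mE : measurable E) :
  joint pi pi_kernel (E `*` E) = (Ex pi (bind R mE) ^+ 2)%:E.
Proof.
rewrite expr2 -ExZ ExE; apply: eq_integral => x _.
rewrite bfunZ EFinM Ex_ind /= indicE.
have [xE|xE] := boolP (x \in E).
  by rewrite in_xsectionX// mule1.
by rewrite notin_xsectionX// measure0 mule0.
Qed.

Variables (rho : R) (M : T -> \bar R).
Hypothesis rho01 : 0 < rho < 1.
Hypothesis Mfin : {ae pi, forall x, (M x < +oo)%E}.
Hypothesis geo : forall (n : nat) (x : T) (A : set T), measurable A ->
  (`|nstep P n x A - pi A| <= M x * (rho ^+ n)%:E)%E.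

Let hahn n := hahn_comparison (joint pi (nstep_kernel n)) (joint pi pi_kernel).
Let H n : set (T * T) := s2val (cid2 (hahn n)).
Let mH n : measurable (H n). Proof. exact: (s2valP (cid2 (hahn n))). Qed.
Let posH n E : measurable E -> E `<=` H n ->
  (joint pi pi_kernel E <= joint pi (nstep_kernel n) E)%E.
Proof. exact: (s2valP' (cid2 (hahn n))).1. Qed.
Let negH n E : measurable E -> E `<=` ~` H n ->
  (joint pi (nstep_kernel n) E <= joint pi pi_kernel E)%E.
Proof. exact: (s2valP' (cid2 (hahn n))).2. Qed.

(* The bound M need not be measurable; the Hahn sections H_n(x) turn it into a
   countable family of measurable conditions. *)
Let B (k : nat) : set T := \bigcap_n [set x |
  (nstep_kernel n x (xsection (H n) x) <=
   pi_kernel x (xsection (H n) x) + (k%:R * rho ^+ n)%:E)%E].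

Let mB k : measurable (B k).
Proof.
apply: bigcapT_measurable => n.
have m1 := joint_section_measurable (nstep_kernel n) (mH n).
have m2 : measurable_fun setT (fun x => pi_kernel x (xsection (H n) x) +
    (k%:R * rho ^+ n)%:E)%E.
  apply: emeasurable_funD => //.
  exact: (joint_section_measurable pi_kernel (mH n)).
rewrite -[X in measurable X]setTI.
exact: (measurable_lee measurableT m1 m2).
Qed.

Let B_mono k l : (k <= l)%N -> B k `<=` B l.
Proof.
move=> kl x Bx n _; apply: (le_trans (Bx n I)) => /=.
rewrite leeD2l// lee_fin ler_wpM2r ?ler_nat//.
by rewrite exprn_ge0// ltW//; case/andP: rho01.
Qed.

Let B_ae : {ae pi, forall x, exists k, B k x}.
Proof.
have [r0 _] := andP rho01.
apply: filterS Mfin => x Mx.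
exists (Num.bound (fine (M x))) => n _ /=.
have mA : measurable (xsection (H n) x) by exact: measurable_xsection.
have := geo n x mA; rewrite nstep_kernelE.
set a := nstep P n x _ => ab.
have fp : pi (xsection (H n) x) \is a fin_num by exact: fin_num_measure.
have rn : 0 < rho ^+ n by exact: exprn_gt0.
rewrite -leeBlDl//; apply: (le_trans (lee_abs _)); apply: (le_trans ab).
have M0 : (0 <= M x)%E.
  have := le_trans (abse_ge0 _) ab; rewrite pmule_lge0//.
rewrite EFinM lee_wpmul2r ?lee_fin ?ltW//.
have -> : M x = (fine (M x))%:E by rewrite fineK// ge0_fin_numE.
by rewrite lte_fin unstable.ltr_bound.
Qed.

(** Among subsets of [B k] times the whole space, the part inside the Hahn set [H n] has the largest
    excess of the law of the chain over the product law. That excess is controlled section by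
    section by the definition of [B k], whence a bound uniform in [E]. *)
Let joint_diff_le k n E : measurable E -> E `<=` B k ->
  (joint pi (nstep_kernel n) (E `*` E) <=
   joint pi pi_kernel (E `*` E) + (k%:R * rho ^+ n)%:E)%E.
Proof.
move=> mE EB.
pose EE := E `*` E; have mEE : measurable EE by exact: measurableX.
pose BT := B k `*` [set: T]; have mBT : measurable BT by exact: measurableX.
have EEB : EE `<=` BT by move=> [x y] [Ex Ey]; split => //; exact: EB.
pose S0 := EE `\` H n; pose S1 := EE `&` H n; pose S2 := (BT `&` H n) `\` EE.
have m0 : measurable S0 by exact: measurableD.
have m1 : measurable S1 by exact: measurableI.
have m2 : measurable S2 by apply: measurableD => //; exact: measurableI.
have EES : EE = S0 `|` S1 by rewrite /S0 /S1 setUC setUIDK.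
have BTS : BT `&` H n = S1 `|` S2.
  rewrite /S1 /S2 -[LHS](setUIDK _ EE) setIAC; congr (_ `|` _).
  by rewrite (setIidr EEB).
have d01 : S0 `&` S1 = set0.
  by apply/seteqP; split => // z [[_ nz] [_ /nz]].
have d12 : S1 `&` S2 = set0.
  by apply/seteqP; split => // z [[zE _] [_ /(_ zE)]].
have h0 : (joint pi (nstep_kernel n) S0 <= joint pi pi_kernel S0)%E.
  by apply: negH => // z [].
have h2 : (joint pi pi_kernel S2 <= joint pi (nstep_kernel n) S2)%E.
  by apply: posH => // z [[]].
have h12 : (joint pi (nstep_kernel n) (S1 `|` S2) <=
    joint pi pi_kernel (S1 `|` S2) + (k%:R * rho ^+ n)%:E)%E.
  rewrite -BTS.
  have c0 : (0 <= (k%:R * rho ^+ n)%:E)%E.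
    by rewrite lee_fin mulr_ge0// exprn_ge0// ltW//; case/andP: rho01.
  have -> : ((k%:R * rho ^+ n)%:E = \int[pi]_x cst (k%:R * rho ^+ n)%:E x)%E.
    by rewrite integral_cst// -[LHS]mule1; congr (_ * _)%E; rewrite /= probability_setT.
  have mBH : measurable (BT `&` H n) by exact: measurableI.
  rewrite /joint -ge0_integralD//; last exact: joint_section_measurable.
  apply: ge0_le_integral => //.
  - exact: joint_section_measurable.
  - by apply: emeasurable_funD => //; exact: joint_section_measurable.
  move=> x _; have [Bx|Bx] := pselect (B k x).
    rewrite (_ : xsection _ x = xsection (H n) x); first exact: (Bx n I).
    by apply/seteqP; split => y; rewrite /xsection/= !inE /BT/=; tauto.
  rewrite (_ : xsection _ x = set0) ?measure0 ?add0e//.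
  by apply/seteqP; split => y //; rewrite /xsection/= !inE /BT/=; tauto.
rewrite -/EE EES.
exact: (@measure_exchange _ _ _ (joint pi (nstep_kernel n))
  (joint pi pi_kernel) S0 S1 S2).
Qed.

Let decaying (f : V) := exists C, forall n,
  nrm pi (iter n K (centered pi f)) <= C * (rho ^+ 2) ^+ n.

(** By symmetry the squared norm after [n] steps is the covariance at lag [2 n], so squares [E * E]
    are enough and the rate is [rho ^+ (2 n)]. *)
Let decaying_bind k E (mE : measurable E) : E `<=` B k -> decaying (bind R mE).
Proof.
move=> EB; exists k%:R => n.
have -> : nrm pi (iter n K (centered pi (bind R mE))) =
    dot pi (bind R mE) (iter (n + n) K (bind R mE)) - Ex pi (bind R mE) ^+ 2.
  rewrite expr2 -(dot_iter_center sK K1) iterD.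
  by rewrite (iter_symop n sK (centered pi _)).
have := joint_diff_le (n + n) mE EB.
rewrite joint_setX_nstep joint_setX_pi -EFinD lee_fin -exprM mul2n addnn.
by rewrite lerBlDl.
Qed.

Let decayingD f g : decaying f -> decaying g -> decaying (f + g).
Proof.
move=> [C HC] [D HD]; exists (2 * C + 2 * D) => n.
have -> : centered pi (f + g) = centered pi f + centered pi g.
  by apply: bfun_ext => x; rewrite /centered !bfunE ExD; ring.
rewrite linearD; apply: (le_trans (nrmD_le _ _ _)).
move: (HC n) (HD n); move: (nrm _ _) (nrm _ _) (_ ^+ n) => *; lra.
Qed.

Let decayingZ a f : decaying f -> decaying (a *: f).
Proof.
move=> [C HC]; exists (a ^+ 2 * C) => n.
have -> : centered pi (a *: f) = a *: centered pi f.
  by apply: bfun_ext => x; rewrite /centered !bfunE ExZ; ring.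
by rewrite linearZ/= nrmZ -[leRHS]mulrA ler_wpM2l// sqr_ge0.
Qed.

Let decaying0 : decaying 0.
Proof.
have c0 : centered pi (0 : V) = 0.
  by apply: bfun_ext => x; rewrite bfunB_ bcstE raddf0 bfun0 subrr.
by exists 0 => n; rewrite c0 linear0 /nrm dot0l mul0r.
Qed.

(** The sets [B k] exhaust the space almost everywhere: half of the error cuts [f] off outside some
    [B k], the other half replaces it by a staircase, a combination of indicators of subsets of
    [B k]. *)
Let decaying_approx f (e : R) : nonneg f -> 0 < e ->
  exists2 s, decaying s & nrm pi (f - s) <= e ^+ 2.
Proof.
move=> f0 e0.
have [C C0 fC] := bfunB f.
pose g k := bmul (bind R (mB k)) f.
have gf : Ex pi (bmul (f - g k) (f - g k)) @[k --> \oo] --> Ex pi (0 : V).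
  apply: (@Ex_bounded_cvg _ _ _ _ _ _ (C * C)).
    move=> k x; rewrite bmulE normrM bfunB_ bmulE /= indicE.
    have H0 : `|f x - (x \in B k)%:R * f x| <= C.
      by case: (_ \in _); rewrite ?mul1r ?subrr ?normr0// mul0r subr0.
    exact: ler_pM.
  apply: filterS B_ae => x [k Bx].
  apply: cvg_near_cst; exists k => // l kl.
  have gl : g l x = f x by rewrite /= indicE mem_set ?mul1r//; exact: B_mono Bx.
  by rewrite bmulE bfunB_ gl subrr mul0r.
have e2 : 0 < (e / 2) ^+ 2 by rewrite exprn_gt0// divr_gt0.
rewrite raddf0 in gf; have /cvgrPdist_le/(_ _ e2)[k _ Hk] := gf.
have {Hk gf} := Hk k (leqnn k); rewrite /= sub0r normrN ger0_norm ?nrm_ge0// => gk.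
have e4 : 0 < e / 2 by rewrite divr_gt0.
pose N := Num.bound (C / (e / 2)).
pose s := bmul (bind R (mB k)) (level_sum f (e / 2) N).
exists s.
  pose t i := bind R (measurableI _ _ (mB k)
    (bfun_level_measurable f (i.+1%:R * (e / 2)))).
  have -> : s = \sum_(i < N) (e / 2) *: t i.
    apply: bfun_ext => x; rewrite bfun_sum /s bmulE bfun_sum big_distrr.
    apply: eq_bigr => i _; rewrite [LHS]mulrCA; congr (_ * _).
    by rewrite /= !indicE in_setI; case: (_ \in _); case: (_ \in _);
      rewrite ?mulr1 ?mulr0.
  elim/big_ind: _ => [|u v|i _]; [exact: decaying0|exact: decayingD|].
  apply: decayingZ; apply: (decaying_bind (k := k)).
  exact: subIsetl.
have -> : f - s = (f - g k) + bmul (bind R (mB k)) (f - level_sum f (e / 2) N).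
  by apply: bfun_ext => x; rewrite /s /g !bfunE; ring.
rewrite [X in _ <= X ^+ 2]splitr.
apply: nrm_triangle; [exact: ltW|exact: ltW|exact: gk|].
have sc : forall x, `|f x - level_sum f (e / 2) N x| <= e / 2.
  apply: level_sum_close => // x.
  apply: (le_lt_trans (le_trans (ler_norm _) (fC x))).
  rewrite -ltr_pdivrMr// (lt_le_trans (unstable.ltr_bound _))// ler_nat.
  exact: leqnSn.
apply: (@le_trans _ _ (nrm pi (bcst (e / 2)))).
  apply: nrm_le => x; rewrite bmulE bfunB_ bcstE normrM (gtr0_norm e4).
  rewrite -[leRHS]mul1r ler_pM//.
  by rewrite /= indicE; case: (_ \in _); rewrite ?normr1 ?normr0.
by rewrite /nrm dot_cstl Ex_cst expr2.
Qed.

(** The constant of a decaying approximant may blow up, but [symop_decay] turns its rate into a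
    bound on one step that is free of this constant and therefore passes to the limit. The shift by
    [C] makes the function nonnegative and is removed by centering. *)
Lemma geometric_gap_aux : gap pi K rho.
Proof.
have [r0 r1] := andP rho01.
move=> f fm; have [C C0 fC] := bfunB f.
pose g := f + bcst C.
have g0 : nonneg g.
  by move=> x; rewrite !bfunE; have := fC x; rewrite ler_norml => /andP[]; lra.
pose a := Num.sqrt (nrm pi f).
have a2 : a ^+ 2 = nrm pi f by rewrite sqr_sqrtr ?nrm_ge0.
have key e : 0 < e -> nrm pi (K f) <= (rho * a + 2 * e) ^+ 2.
  move=> e0; have [s [D sD] se] := decaying_approx g0 e0.
  have cs := symop_decay r0 sK sD.
  set u := centered pi s in cs *.
  have fu : f - u = centered pi (g - s).
    apply: bfun_ext => x; rewrite /u /centered !bfunE ExB ExD Ex_cst fm; ring.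
  have nfu : nrm pi (f - u) <= e ^+ 2.
    by rewrite fu nrm_center (le_trans _ se)// gerBl sqr_ge0.
  have nu : nrm pi u <= (a + e) ^+ 2.
    have -> : u = f + - (f - u) by rewrite opprB addrC subrK.
    apply: nrm_triangle; [exact: sqrtr_ge0|exact: ltW|by rewrite a2|].
    by rewrite nrmN.
  have -> : K f = K u + K (f - u) by rewrite -linearD addrC subrK.
  apply: (@le_trans _ _ ((rho * (a + e) + e) ^+ 2)).
    apply: nrm_triangle.
    - by rewrite mulr_ge0 ?addr_ge0 ?sqrtr_ge0// ltW.
    - exact: ltW.
    - by rewrite (le_trans cs)// exprMn ler_wpM2l// sqr_ge0.
    - exact: le_trans (nrm_markov pK sK K1 _) nfu.
  rewrite lerXn2r ?nnegrE//.
  - by rewrite !addr_ge0 ?mulr_ge0 ?addr_ge0 ?sqrtr_ge0 ?ltW.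
  - by rewrite !addr_ge0 ?mulr_ge0 ?sqrtr_ge0 ?ltW.
  - nra.
rewrite -a2 -exprMn; set b := rho * a.
have b0 : 0 <= b by rewrite mulr_ge0 ?sqrtr_ge0 ?ltW.
apply/ler_addgt0Pr => e e0.
(* As [d0 <= 1], the increase [4 b d0 + 4 d0^2] of the square is at most [d0 (4 b + 4) <= e]. *)
pose d0 := Num.min 1 (e / (4 * b + 4)).
have b4 : 0 < 4 * b + 4 by lra.
have d00 : 0 < d0 by rewrite lt_min ltr01 divr_gt0.
have d01 : d0 <= 1 by rewrite ge_min lexx.
have d0e : d0 * (4 * b + 4) <= e by rewrite -ler_pdivlMr// ge_min lexx orbT.
apply: (le_trans (key _ d00)); rewrite -/b; nra.
Qed.

End geometric_to_gap.

Theorem geometric_gap d (T : measurableType d) (R : realType)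
    (pi : probability T R) (P : R.-pker T ~> T) :
  symop pi (kop P) -> geometrically_ergodic pi P ->
  exists2 rho : R, 0 < rho < 1 & gap pi (kop P) rho.
Proof.
move=> sK [rho [M [r01 M0 Mf geo]]]; exists rho => //.
exact: geometric_gap_aux Mf geo.
Qed.

(** * Asymptotic variance *)

Section truncation.
Context d (T : measurableType d) (R : realType).
Variables (h : T -> R).
Hypothesis mh : measurable_fun setT h.

Definition clip (m : nat) (x : T) : R := Num.max (- m%:R) (Num.min m%:R (h x)).

Lemma clip_measurable m : measurable_fun setT (clip m).
Proof. by apply: measurable_maxr => //; exact: measurable_minr. Qed.

Lemma clip_bounded m : exists M, forall x, `|clip m x| <= M.
Proof.
exists m%:R => x; rewrite ler_norml /clip le_max lexx/= ge_max ge_min lexx andbT.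
by rewrite (@le_trans _ _ 0)// oppr_le0.
Qed.

Definition bclip m : bfun T R := BFun (clip_measurable m) (clip_bounded m).

Lemma bclip_le m x : `|bclip m x| <= `|h x|.
Proof.
have m0 : 0 <= m%:R :> R by [].
rewrite /= /clip; have [h0|h0] := leP 0 (h x).
  rewrite max_r; last by rewrite le_min; apply/andP; split; lra.
  by rewrite !ger0_norm ?ge_min ?lexx ?orbT// le_min m0.
rewrite min_r; last lra.
have [hm|hm] := leP (- m%:R) (h x); first by [].
by rewrite !ler0_norm; lra.
Qed.

Lemma bclip_cvg x : bclip m x @[m --> \oo] --> h x.
Proof.
apply: cvg_near_cst; near=> m; rewrite /= /clip.
have : `|h x| <= m%:R by near: m; exact: nbhs_infty_ger.
by rewrite ler_norml => /andP[h1 h2]; rewrite min_r// max_r.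
Unshelve. all: by end_near. Qed.

End truncation.

Lemma Ex_dominated_cvg d (T : measurableType d) (R : realType)
    (P : probability T R) (f_ : nat -> bfun T R) (f : T -> R) (g : T -> \bar R) :
  measurable_fun setT f -> P.-integrable setT g ->
  (forall n x, (`|f_ n x|%:E <= g x)%E) ->
  (forall x, f_ n x @[n --> \oo] --> f x) ->
  P.-integrable setT (EFin \o f) /\
  Ex P (f_ n) @[n --> \oo] --> \int[P]_x f x.
Proof.
move=> mf ig fg ff.
have mef : measurable_fun setT (EFin \o f) by exact/measurable_EFinP.
have [|||||i _ c] := @dominated_convergence _ T R P setT measurableT
  (fun n => EFin \o f_ n) (EFin \o f) g => //.
- by move=> n; exact/measurable_EFinP/bfun_measurable.
- by apply: aeW => x _; apply/cvgn_EFinP; exact: ff.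
- by apply: aeW => x n _; exact: fg.
split => //; apply/cvgn_EFinP.
rewrite /Rintegral fineK; last exact: integrable_fin_num.
by under eq_fun do rewrite ExE.
Qed.

Section sums.
Context (R : realType).

Lemma sqr_sum_le (I : finType) (u : I -> R) :
  (\sum_i u i) ^+ 2 <= #|I|%:R * \sum_i u i ^+ 2.
Proof.
have [I0|I0] := posnP #|I|.
  rewrite big1 ?expr0n/= ?I0 ?mul0r// => i _.
  by have := fintype0 i I0.
set N := #|I|%:R : R; set S := \sum_i u i; set Q := \sum_i u i ^+ 2.
have N0 : 0 < N by rewrite ltr0n.
rewrite -subr_ge0 -(pmulr_rge0 _ N0).
have -> : N * (N * Q - S ^+ 2) = \sum_i (N * u i - S) ^+ 2.
  rewrite (eq_bigr (fun i => N ^+ 2 * u i ^+ 2 + (- (2 * N * S) * u i + S ^+ 2))).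
    by rewrite !big_split/= -!mulr_sumr sumr_const -mulr_natl -/N -/S -/Q; ring.
  by move=> i _; ring.
by apply: sumr_ge0 => i _; exact: sqr_ge0.
Qed.

End sums.

Lemma cvgn_sum (R : realType) (I : Type) (r : seq I) (u : I -> nat -> R)
    (l : I -> R) : (forall i, u i m @[m --> \oo] --> l i) ->
  \sum_(i <- r) u i m @[m --> \oo] --> \sum_(i <- r) l i.
Proof.
move=> ul; elim: r => [|i r IH].
  by under eq_fun do rewrite big_nil; rewrite big_nil; exact: cvg_cst.
under eq_fun do rewrite big_cons; rewrite big_cons; exact: cvgD.
Qed.

Section scaled_variance_formula.
Context d (T : measurableType d) (R : realType).
Variables (pi : probability T R) (P : R.-pker T ~> T).
Local Notation K := (kop P).
Hypothesis sK : symop pi K.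
Variable h : T -> R.
Hypothesis mh : measurable_fun setT h.
Hypothesis h2 : pi.-integrable setT (fun x => (h x ^+ 2)%:E).
Local Notation hm := (bclip mh).

Let ih n (i : 'I_n.+1) :
  (chain_law pi P n).-integrable setT (fun t => (h (tnth t i) ^+ 2)%:E).
Proof.
have mh2 : measurable_fun setT (fun x => (h x ^+ 2)%:E).
  by apply/measurable_EFinP; exact: measurable_funX.
apply/integrableP; split.
  exact: (measurableT_comp mh2 (measurable_tnth i)).
under eq_integral do rewrite gee0_abs ?lee_fin ?sqr_ge0//.
rewrite (integral_chain_coord sK i mh2); last by move=> x; rewrite lee_fin sqr_ge0.
have /integrableP[_] := h2; apply: le_lt_trans.
by apply: ge0_le_integral => //; [move=> x _; rewrite lee_fin sqr_ge0|
  exact: measurableT_comp|move=> x _; rewrite lee_abs].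
Qed.

Let one_plus_sq n (i : 'I_n.+1) : (chain_law pi P n).-integrable setT
  (fun t => (1 + h (tnth t i) ^+ 2)%:E).
Proof.
rewrite (_ : (fun _ => _) =
    (fun t => (EFin \o cst 1%R) t + (h (tnth t i) ^+ 2)%:E))%E.
  by apply: integrableD => //; exact: finite_measure_integrable_cst.
by apply/funext => t; rewrite EFinD.
Qed.

Let abs_le_sq (a : R) : `|a| <= 1 + a ^+ 2.
Proof.
rewrite -(real_normK (num_real a)); have := sqr_ge0 (`|a| - 1); nra.
Qed.

Lemma chain_mean_cvg n (i : 'I_n.+1) : Ex pi (hm m) @[m --> \oo] -->
  \int[chain_law pi P n]_t h (tnth t i).
Proof.
have [|||_] := @Ex_dominated_cvg _ _ _ (chain_law pi P n)
  (fun m => bcoord i (hm m)) (fun t => h (tnth t i)) _ _ (one_plus_sq i).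
- exact: (measurableT_comp mh (measurable_tnth i)).
- move=> m t; rewrite lee_fin; apply: le_trans (abs_le_sq _).
  exact: (bclip_le mh).
- by move=> t; exact: (bclip_cvg mh).
by under eq_fun do rewrite (Ex_chain_coord sK).
Qed.

Lemma chain_pair_cvg n (i j : 'I_n.+1) : (i <= j)%N ->
  dot pi (hm m) (iter (j - i) K (hm m)) @[m --> \oo] -->
  \int[chain_law pi P n]_t (h (tnth t i) * h (tnth t j)).
Proof.
move=> ij; have [|||_] := @Ex_dominated_cvg _ _ _ (chain_law pi P n)
  (fun m => bmul (bcoord i (hm m)) (bcoord j (hm m)))
  (fun t => h (tnth t i) * h (tnth t j)) _ _ (integrableD measurableT (ih i) (ih j)).
- apply: measurable_funM.
    exact: (measurableT_comp mh (measurable_tnth i)).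
  exact: (measurableT_comp mh (measurable_tnth j)).
- move=> m t; rewrite -EFinD lee_fin bmulE normrM.
  apply: (@le_trans _ _ (`|h (tnth t i)| * `|h (tnth t j)|)).
    by apply: ler_pM => //; exact: (bclip_le mh).
  rewrite -[in leRHS](real_normK (num_real (h (tnth t i)))).
  rewrite -[in leRHS](real_normK (num_real (h (tnth t j)))).
  have := normr_ge0 (h (tnth t i)); have := normr_ge0 (h (tnth t j)).
  have := sqr_ge0 (`|h (tnth t i)| - `|h (tnth t j)|); nra.
- by move=> t; apply: cvgM; exact: (bclip_cvg mh).
by under eq_fun do rewrite (Ex_chain_pair sK)//.
Qed.

Definition mean_L2 : R := \int[chain_law pi P 0]_t h (tnth t ord0).

(** The value of [(h, K^k h)], read off the chain because [K] acts on bounded functions only. *)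
Definition moment_L2 k : R :=
  \int[chain_law pi P k]_t (h (tnth t ord0) * h (tnth t ord_max)).

Lemma mean_L2_cvg : Ex pi (hm m) @[m --> \oo] --> mean_L2.
Proof. exact: chain_mean_cvg. Qed.

Lemma moment_L2_cvg k :
  dot pi (hm m) (iter k K (hm m)) @[m --> \oo] --> moment_L2 k.
Proof.
have := @chain_pair_cvg k ord0 ord_max (leq0n _).
by rewrite /= subn0.
Qed.

Definition time_average n (g : T -> R) (t : n.+1.-tuple T) : R :=
  n.+1%:R^-1 * \sum_(i < n.+1) g (tnth t i).

Definition baverage n (f : bfun T R) : bfun (n.+1.-tuple T) R :=
  n.+1%:R^-1 *: \sum_(i < n.+1) bcoord i f.

Lemma baverageE n f t : baverage n f t = time_average f t.
Proof. by rewrite /baverage bfunZ bfun_sum. Qed.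

Lemma Ex_baverage n f : Ex (chain_law pi P n) (baverage n f) = Ex pi f.
Proof.
rewrite ExZ raddf_sum/=; under eq_bigr do rewrite (Ex_chain_coord sK).
by rewrite sumr_const card_ord -(mulr_natl (Ex pi f)) mulKf.
Qed.

Lemma nrm_baverage n f : nrm (chain_law pi P n) (baverage n f) =
  n.+1%:R^-1 ^+ 2 * \sum_(i < n.+1) \sum_(j < n.+1)
    dot pi f (iter `|i - j|%N K f).
Proof.
rewrite nrmZ; congr (_ * _); rewrite /nrm /dot.
rewrite (_ : bmul _ _ = \sum_(i < n.+1) \sum_(j < n.+1)
  bmul (bcoord i f) (bcoord j f)); last first.
  apply: bfun_ext => t; rewrite bmulE !bfun_sum mulr_suml.
  apply: eq_bigr => i _; rewrite bfun_sum mulr_sumr.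
  by apply: eq_bigr => j _.
rewrite raddf_sum/=; apply: eq_bigr => i _; rewrite raddf_sum/=.
apply: eq_bigr => j _.
have [ij|/ltnW ji] := leqP i j.
  by rewrite (Ex_chain_pair sK)// distnC distnEl.
rewrite (distnEl ji) -[RHS](Ex_chain_pair sK f f ji).
by congr Ex; apply: bfun_ext => t; rewrite !bmulE mulrC.
Qed.

Definition lag_sum (c : nat -> R) n : R :=
  \sum_(i < n) \sum_(j < n) c `|i - j|%N.

Lemma lag_sumS c n : lag_sum c n.+1 =
  lag_sum c n + (c 0%N + 2 * \sum_(k < n) c k.+1).
Proof.
rewrite /lag_sum big_ord_recr/=.
under eq_bigr do rewrite big_ord_recr/=.
rewrite big_split/= -addrA; congr (_ + _); rewrite big_ord_recr/= distnn.
have -> : \sum_(i < n) c `|i - n|%N = \sum_(k < n) c k.+1.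
  rewrite (reindex_inj rev_ord_inj)/=; apply: eq_bigr => i _.
  congr c; rewrite distnC distnEl ?leq_subr// subKn//.
have -> : \sum_(j < n) c `|n - j|%N = \sum_(k < n) c k.+1.
  rewrite (reindex_inj rev_ord_inj)/=; apply: eq_bigr => i _.
  congr c; rewrite distnEl ?leq_subr// subKn//.
ring.
Qed.

Lemma scaled_varianceE n : scaled_variance pi P h n =
  (n.+1%:R^-1 * lag_sum (fun k => moment_L2 k - mean_L2 ^+ 2) n.+1)%:E.
Proof.
rewrite /scaled_variance; set Q := chain_law pi P n.
set Z := (fun t => _ : R).
have ZE : Z = time_average h by [].
have mZ : measurable_fun setT (time_average (n := n) h).
  apply: measurable_funM => //; apply: measurable_sum => i.
  exact: (measurableT_comp mh (measurable_tnth i)).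
have N0 : 0 < n.+1%:R :> R by [].
(* A common integrable bound for the squares of the centered time averages of [h] and of all its
   clipped versions, from [(u - a)^2 <= 2 a^2 + 2 u^2] and the convexity of the square. *)
pose G (a : R) t := (2 * a ^+ 2 + 2 * (n.+1%:R^-1 * \sum_(i < n.+1) h (tnth t i) ^+ 2)).
have iG a : Q.-integrable setT (fun t => (G a t)%:E).
  rewrite (_ : (fun _ => _) = (fun t => (EFin \o cst (2 * a ^+ 2)%R) t +
      (2 * n.+1%:R^-1)%:E * \sum_(i < n.+1) (h (tnth t i) ^+ 2)%:E))%E.
    apply: integrableD => //; first exact: finite_measure_integrable_cst.
    by apply: integrableZl => //; apply: integrable_sum.
  by apply/funext => t; rewrite /G sumEFin -EFinM -EFinD mulrA.
have ZG (g : T -> R) a t : (forall x, `|g x| <= `|h x|) ->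
    (time_average g t - a) ^+ 2 <= G a t.
  move=> gh; apply: (@le_trans _ _ (2 * a ^+ 2 + 2 * (time_average g t ^+ 2))).
    by have := sqr_ge0 (time_average g t + a); nra.
  rewrite lerD2l ler_pM2l// /time_average exprMn expr2 -mulrA ler_pM2l ?invr_gt0//.
  rewrite ler_pdivrMl//; apply: (le_trans (sqr_sum_le _)).
  rewrite card_ord ler_pM2l//; apply: ler_sum => i _.
  by rewrite -(real_normK (num_real (g _))) -(real_normK (num_real (h _)))
    lerXn2r ?nnegrE.
have Zc : forall t, baverage n (hm m) t @[m --> \oo] --> time_average h t.
  move=> t; rewrite (_ : (fun _ => _) = fun m => time_average (hm m) t).
    2: by apply/funext => m; rewrite baverageE.
  apply: cvgM; first exact: cvg_cst.
  apply: cvgn_sum => i; exact: (bclip_cvg mh).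
have Zint : Q.-integrable setT (EFin \o time_average (n := n) h) /\
    Ex Q (baverage n (hm m)) @[m --> \oo] --> \int[Q]_t time_average h t.
  apply: (@Ex_dominated_cvg _ _ _ _ _ _ (fun t => (1 + G 0 t)%:E)) => //.
    rewrite (_ : (fun _ => _) = (fun t => (EFin \o cst 1%R) t + (G 0 t)%:E))%E.
      by apply: integrableD => //; exact: finite_measure_integrable_cst.
    by apply/funext => t; rewrite EFinD.
  move=> m t; rewrite lee_fin baverageE (le_trans (abs_le_sq _))// lerD2l.
  rewrite -[X in X ^+ 2]subr0; apply: ZG => x; exact: (bclip_le mh).
have zE : \int[Q]_t time_average h t = mean_L2.
  move: Zint.2; under eq_fun do rewrite Ex_baverage.
  by move=> /(cvg_unique _ mean_L2_cvg) <-.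
set z := mean_L2 in zE *.
have [iV cV] : Q.-integrable setT (EFin \o (fun t => (time_average h t - z) ^+ 2)) /\
    Ex Q (bmul (baverage n (hm m) - bcst z) (baverage n (hm m) - bcst z))
      @[m --> \oo] --> \int[Q]_t ((time_average h t - z) ^+ 2).
  apply: (@Ex_dominated_cvg _ _ _ _ _ _ (fun t => (G z t)%:E)) => //.
  - by apply: measurable_funX; exact: measurable_funB.
  - move=> m t; rewrite lee_fin bmulE bfunB_ bcstE baverageE -expr2.
    rewrite ger0_norm ?sqr_ge0//; apply: ZG => x; exact: (bclip_le mh).
  - move=> t.
    have H : (baverage n (hm m) t - z) @[m --> \oo] --> time_average h t - z.
      by apply: cvgB => //; exact: cvg_cst.
    have E : (fun m => bmul (baverage n (hm m) - bcst z)
        (baverage n (hm m) - bcst z) t) = fun m =>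
        (baverage n (hm m) t - z) * (baverage n (hm m) t - z).
      by apply/funext => m; rewrite bmulE bfunB_ bcstE.
    rewrite expr2 E; exact: (cvgM H H).
have i1 : Q.-integrable setT (EFin \o time_average (n := n) h).
  by case: Zint.
have EZ : ('E_Q[Z] = z%:E)%E.
  rewrite unlock -zE /Rintegral fineK//.
  exact: (integrable_fin_num _ i1).
have -> : ('V_Q[Z] = (\int[Q]_t ((time_average h t - z) ^+ 2))%R%:E)%E.
  rewrite /variance covariance.unlock EZ /Rintegral fineK; last first.
    exact: (integrable_fin_num _ iV).
  by rewrite unlock; apply: eq_integral => t _; rewrite expr2.
have : Ex Q (bmul (baverage n (hm m) - bcst z) (baverage n (hm m) - bcst z))
    @[m --> \oo] --> n.+1%:R^-1 ^+ 2 * lag_sum moment_L2 n.+1 - 2 * (z * z) + z ^+ 2.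
  have E m : Ex Q (bmul (baverage n (hm m) - bcst z) (baverage n (hm m) - bcst z))
      = n.+1%:R^-1 ^+ 2 * lag_sum (fun k => dot pi (hm m) (iter k K (hm m))) n.+1
        - 2 * (z * Ex pi (hm m)) + z ^+ 2.
    rewrite -/(dot Q _ _) -/(nrm Q _) nrmB nrm_baverage dot_cstr Ex_baverage.
    by rewrite /nrm dot_cstl Ex_cst expr2.
  under eq_fun do rewrite E.
  apply: cvgD; last exact: cvg_cst.
  apply: cvgB; apply: cvgM; try exact: cvg_cst.
    apply: cvgn_sum => i; apply: cvgn_sum => j; exact: moment_L2_cvg.
  apply: cvgM; [exact: cvg_cst|exact: mean_L2_cvg].
move=> /(cvg_unique _ cV) -> //.
rewrite -EFinM; congr EFin.
have -> : lag_sum (fun k => moment_L2 k - z ^+ 2) n.+1 =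
    lag_sum moment_L2 n.+1 - n.+1%:R ^+ 2 * z ^+ 2.
  rewrite /lag_sum; under eq_bigr do rewrite sumrB sumr_const card_ord.
  rewrite sumrB sumr_const card_ord -mulr_natl -(mulr_natl (z ^+ 2)); ring.
by move: N0; set N := n.+1%:R => N0; field; rewrite gt_eqF.
Qed.

End scaled_variance_formula.

(** Passing from size [n] to [n.+1] adds [s n = c 0 + 2 (c 1 + ... + c n)] to the double sum, so the
    sequence is the Cesaro mean of the convergent sequence [s]. *)
Lemma lag_mean_cvg (R : realType) (c : nat -> R) (g C : R) : 0 <= g < 1 ->
  (forall k, `|c k| <= C * g ^+ k) ->
  cvgn (fun n => n.+1%:R^-1 * lag_sum c n.+1).
Proof.
move=> /andP[g0 g1] cg.
pose s n := c 0%N + 2 * series (fun k => c k.+1) n.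
have lagE n : lag_sum c n = series s n.
  elim: n => [|n IH]; first by rewrite seriesEnat/= /lag_sum big_ord0 big_geq.
  by rewrite lag_sumS IH seriesSr; congr (_ + _); rewrite /s seriesEord.
have c0 k : 0 <= C * g ^+ k by exact: le_trans (cg k).
have cs : cvgn (series (fun k => c k.+1)).
  apply: normed_cvg; apply: (@series_le_cvg _ _ (geometric (C * g) g)).
  - by move=> n; rewrite normr_ge0.
  - by move=> n; rewrite /= -mulrA -exprS.
  - by move=> n; rewrite /= -mulrA -exprS.
  - by apply: is_cvg_geometric_series; rewrite ger0_norm.
have : cvgn (arithmetic_mean s).
  apply/cvg_ex; exists (c 0%N + 2 * limn (series (fun k => c k.+1))).
  by apply: cesaro; apply: cvgD; [exact: cvg_cst|apply: cvgMr].
rewrite (_ : arithmetic_mean s = fun n => n.+1%:R^-1 * lag_sum c n.+1)//.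
by apply/funext => n; rewrite lagE.
Qed.

Section gap_to_variance_bounding.
Context d (T : measurableType d) (R : realType).
Variables (pi : probability T R) (P : R.-pker T ~> T).
Local Notation K := (kop P).
Hypothesis sK : symop pi K.

Lemma gap_covariance_le (g : R) (h : T -> R) k : 0 <= g -> gap pi K g ->
  measurable_fun setT h -> pi.-integrable setT (fun x => (h x ^+ 2)%:E) ->
  `|moment_L2 pi P h k - mean_L2 pi P h ^+ 2| <=
    (moment_L2 pi P h 0 - mean_L2 pi P h ^+ 2) * g ^+ k.
Proof.
move=> g0 gK mh h2.
have K1 : K (bcst 1) = bcst 1 by exact: kop_cst.
have H l : dot pi (bclip mh m) (iter l K (bclip mh m)) - Ex pi (bclip mh m) ^+ 2
    @[m --> \oo] --> moment_L2 pi P h l - mean_L2 pi P h ^+ 2.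
  apply: cvgB; first exact: moment_L2_cvg.
  by rewrite expr2; under eq_fun do rewrite expr2; apply: cvgM; exact: mean_L2_cvg.
have Hg : (dot pi (bclip mh m) (bclip mh m) - Ex pi (bclip mh m) ^+ 2) * g ^+ k
    @[m --> \oo] --> (moment_L2 pi P h 0 - mean_L2 pi P h ^+ 2) * g ^+ k.
  by apply: cvgM; [exact: (H 0%N)|exact: cvg_cst].
apply: (ler_cvg_to (cvg_norm (H k)) Hg).
apply: nearW => m /=; rewrite expr2 -dot_iter_center// mulrC.
rewrite -nrm_center; apply: gap_dot => //; exact: Ex_center.
Qed.

Theorem gap_variance_bounding (g : R) : 0 <= g < 1 -> gap pi K g ->
  variance_bounding pi P.
Proof.
move=> g01 gK h hL; have /andP[g0 g1] := g01.
have mh : measurable_fun setT h.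
  by move: hL; rewrite inE => /andP[]; rewrite inE.
have h2 := Lfun2_integrable_sqr hL.
pose c k := moment_L2 pi P h k - mean_L2 pi P h ^+ 2.
have /cvg_ex[l cl] : cvgn (fun n => n.+1%:R^-1 * lag_sum c n.+1).
  by apply: lag_mean_cvg g01 _ => k; exact: gap_covariance_le.
have vl : scaled_variance pi P h n @[n --> \oo] --> l%:E.
  have -> : scaled_variance pi P h =
      EFin \o (fun n => n.+1%:R^-1 * lag_sum c n.+1).
    by apply/funext => n; rewrite (scaled_varianceE sK mh h2).
  by apply/cvgn_EFinP.
split; first by apply/cvg_ex; exists l%:E.
by rewrite /asymptotic_variance (cvg_lim _ vl)// ltry.
Qed.

End gap_to_variance_bounding.

(** * Time averages and L^2 limits of bounded functions *)

Section baverage_bounds.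
Context d (T : measurableType d) (R : realType).
Variables (pi : probability T R) (P : R.-pker T ~> T).
Local Notation K := (kop P).
Hypothesis sK : symop pi K.

Lemma dot_iter_le k (f : bfun T R) : dot pi f (iter k K f) <= nrm pi f.
Proof.
have := nrm_ge0 pi (f - iter k K f); rewrite nrmB.
have := @nrm_iter_markov _ _ _ pi K (@kop_pos _ _ _ _ _ P) sK (kop_cst P 1) k f.
lra.
Qed.

Lemma baverageD n (f g : bfun T R) :
  baverage n (f + g) = baverage n f + baverage n g.
Proof.
apply: bfun_ext => t; rewrite bfunD !baverageE /time_average -mulrDr -big_split.
by congr (_ * _); apply: eq_bigr => i _; rewrite bfunD.
Qed.

Lemma baverageB n (f g : bfun T R) :
  baverage n (f - g) = baverage n f - baverage n g.
Proof.
apply: bfun_ext => t; rewrite bfunB_ !baverageE /time_average -mulrBr -sumrB.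
by congr (_ * _); apply: eq_bigr => i _; rewrite bfunB_.
Qed.

Lemma nrm_baverage_le n (f : bfun T R) :
  nrm (chain_law pi P n) (baverage n f) <= nrm pi f.
Proof.
rewrite (nrm_baverage sK) exprVn ler_pdivrMl ?exprn_gt0//.
apply: (@le_trans _ _ (\sum_(i < n.+1) \sum_(j < n.+1) nrm pi f)).
  by apply: ler_sum => i _; apply: ler_sum => j _; exact: dot_iter_le.
rewrite !sumr_const !card_ord -(mulr_natl (nrm pi f)) -(mulr_natl (_ * _)).
by rewrite mulrA expr2.
Qed.

Lemma nrm_baverage_ge n (f : bfun T R) (c : R) :
  (forall k, (k <= n)%N -> c <= dot pi f (iter k K f)) ->
  c <= nrm (chain_law pi P n) (baverage n f).
Proof.
move=> fc; rewrite (nrm_baverage sK) exprVn ler_pdivlMl ?exprn_gt0//.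
apply: (@le_trans _ _ (\sum_(i < n.+1) \sum_(j < n.+1) c)).
  rewrite !sumr_const !card_ord -(mulr_natl c) -(mulr_natl (_ * _)).
  by rewrite mulrA expr2.
apply: ler_sum => i _; apply: ler_sum => j _; apply: fc.
have := ltn_ord i; have := ltn_ord j; rewrite !ltnS => jn i_n.
have [ij|/ltnW ji] := leqP i j.
  by rewrite distnEr// (leq_trans (leq_subr _ _)).
by rewrite distnEl// (leq_trans (leq_subr _ _)).
Qed.

(** It transfers a lower bound from a bounded approximation [x] to [h]: averaging contracts the
    norm, so replacing [x] by the centered [h] costs at most [n.+1] times the squared distance, up
    to the factor 2. *)
Lemma nrm_baverage_le_scaled_variance n (h : T -> R) (x : bfun T R) :
  measurable_fun setT h -> pi.-integrable setT (fun t => (h t ^+ 2)%:E) ->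
  Ex pi x = 0 ->
  ((n.+1%:R * nrm (chain_law pi P n) (baverage n x))%:E <=
   (2 * n.+1%:R * \int[pi]_t (h t - x t) ^+ 2)%:E +
   2%:E * scaled_variance pi P h n)%E.
Proof.
move=> mh h2 x0.
rewrite (scaled_varianceE sK mh h2) -EFinM -EFinD lee_fin.
set N := n.+1%:R; have N0 : 0 < N by rewrite ltr0n.
have [M xM] := bfun_bounded x.
have cI : nrm pi (x - bclip mh m) @[m --> \oo] --> \int[pi]_t (h t - x t) ^+ 2.
  have [||||_ H] := @Ex_dominated_cvg _ T R pi
    (fun m => bmul (x - bclip mh m) (x - bclip mh m)) (fun t => (h t - x t) ^+ 2)
    (fun t => (2 * M ^+ 2)%:E + 2%:E * (h t ^+ 2)%:E)%E.
  - by apply: measurable_funX; apply: measurable_funB => //; exact: bfun_measurable.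
  - apply: integrableD => //; first exact: finite_measure_integrable_cst.
    exact: integrableZl.
  - move=> m t; rewrite -EFinM -EFinD lee_fin bmulE bfunB_ -expr2.
    rewrite ger0_norm ?sqr_ge0//.
    have : (bclip mh m t) ^+ 2 <= h t ^+ 2.
      rewrite -(real_normK (num_real (bclip mh m t))).
      rewrite -(real_normK (num_real (h t))) lerXn2r ?nnegrE//; exact: bclip_le.
    have : x t ^+ 2 <= M ^+ 2.
      rewrite -(real_normK (num_real (x t))) lerXn2r ?nnegrE//.
      exact: le_trans (xM t).
    have := sqr_ge0 (x t + bclip mh m t); nra.
  - move=> t.
    have H : (x t - bclip mh m t) @[m --> \oo] --> x t - h t.
      by apply: cvgB; [exact: cvg_cst|exact: bclip_cvg].
    have E : (fun m => bmul (x - bclip mh m) (x - bclip mh m) t) =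
        fun m => (x t - bclip mh m t) * (x t - bclip mh m t).
      by apply/funext => m; rewrite bmulE bfunB_.
    rewrite -sqrrN opprB expr2 E; exact: (cvgM H H).
  - exact: H.
have cV : N^-1 ^+ 2 * lag_sum (fun k => dot pi (bclip mh m) (iter k K (bclip mh m))
      - Ex pi (bclip mh m) ^+ 2) n.+1 @[m --> \oo] -->
    N^-1 ^+ 2 * lag_sum (fun k => moment_L2 pi P h k - mean_L2 pi P h ^+ 2) n.+1.
  apply: cvgM; first exact: cvg_cst.
  apply: cvgn_sum => i; apply: cvgn_sum => j.
  apply: cvgB; first exact: moment_L2_cvg.
  by rewrite expr2; under eq_fun do rewrite expr2; apply: cvgM; exact: mean_L2_cvg.
set I := \int[pi]_t _ in cI *; set L := lag_sum _ _ in cV *.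
suff H : nrm (chain_law pi P n) (baverage n x) <= 2 * I + 2 * (N^-1 ^+ 2 * L).
  rewrite -ler_pdivlMl//; apply: (le_trans H); rewrite le_eqVlt; apply/orP; left.
  by apply/eqP; field; rewrite gt_eqF.
have cR : (2 * nrm pi (x - bclip mh m) + 2 * (N^-1 ^+ 2 *
    lag_sum (fun k => dot pi (bclip mh m) (iter k K (bclip mh m))
      - Ex pi (bclip mh m) ^+ 2) n.+1)) @[m --> \oo] --> 2 * I + 2 * (N^-1 ^+ 2 * L).
  by apply: cvgD; apply: cvgM => //; exact: cvg_cst.
apply: (ler_cvg_to (cvg_cst _) cR); apply: nearW => m /=.
set c := bclip mh m.
have -> : N^-1 ^+ 2 * lag_sum (fun k => dot pi c (iter k K c) - Ex pi c ^+ 2) n.+1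
    = nrm (chain_law pi P n) (baverage n (centered pi c)).
  rewrite (nrm_baverage sK); congr (_ * _).
  apply: eq_bigr => i _; apply: eq_bigr => j _.
  by rewrite dot_iter_center ?expr2//; exact: kop_cst.
rewrite -[x in baverage n x](subrK (centered pi c)) baverageD.
apply: le_trans (nrmD_le _ _ _) _; rewrite lerD2r ler_pM2l//.
apply: le_trans (nrm_baverage_le _ _) _.
rewrite (_ : x - centered pi c = centered pi (x - c)); last first.
  rewrite /centered ExB x0; apply: bfun_ext => t.
  by rewrite !(bfunB_, bcstE); lra.
by rewrite nrm_center lerBlDr lerDl sqr_ge0.
Qed.

End baverage_bounds.

Section L2_limit.
Context d (T : measurableType d) (R : realType) (pi : probability T R).

Lemma Lfun2_of_integrable_sqr (h : T -> R) : measurable_fun setT h ->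
  pi.-integrable setT (fun x => (h x ^+ 2)%:E) -> h \in Lfun pi 2%:E.
Proof.
move=> mh h2; rewrite inE/=; apply/andP; split; rewrite inE//=.
rewrite /finite_norm unlock poweR_lty//.
under eq_integral do rewrite /= powR_mulrn// -normrX.
by have /integrableP[] := h2.
Qed.

Lemma fatou_bound (f : nat -> T -> \bar R) (c : \bar R) :
  (forall n, measurable_fun setT (f n)) -> (forall n x, (0 <= f n x)%E) ->
  (forall n, (\int[pi]_x f n x <= c)%E) ->
  (\int[pi]_x limn_einf (f^~ x) <= c)%E.
Proof.
move=> mf f0 fc; apply: le_trans (fatou _ _ _ _) _ => //.
rewrite limn_einf_lim; apply: lime_le; first exact: is_cvg_einfs.
apply: nearW => n; apply: le_trans (fc n).
by apply: ereal_inf_lbound; exists n => //=.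
Qed.

Variable x : nat -> bfun T R.
Hypothesis xS : forall k, nrm pi (x k.+1 - x k) <= (4^-1 ^+ k) ^+ 2.

(** 4/3 is the sum of the powers of 1/4; the induction keeps the exact partial sum, which the
    triangle inequality extends by one term. *)
Lemma nrm_geometric_tail k i :
  nrm pi (x (i + k)%N - x k) <= (4 / 3 * 4^-1 ^+ k) ^+ 2.
Proof.
have p0 j : 0 <= 4^-1 ^+ j :> R by rewrite exprn_ge0// invr_ge0.
have p1 j : 4^-1 ^+ (j + k) <= 4^-1 ^+ k :> R.
  by rewrite exprD ler_piMl// exprn_ile1// ?invr_ge0// invf_le1// ler1n.
have q0 : 0 <= 4 / 3 :> R by rewrite divr_ge0.
apply: (@le_trans _ _ ((4 / 3 * (4^-1 ^+ k - 4^-1 ^+ (i + k))) ^+ 2)); last first.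
  rewrite lerXn2r ?nnegrE ?mulr_ge0 ?subr_ge0//.
  by rewrite ler_wpM2l// gerBl.
elim: i => [|i IH].
  rewrite add0n subrr -(scale0r 0) nrmZ expr0n mul0r; exact: sqr_ge0.
rewrite -[_ - _](subrKA (x (i + k)%N)) addSn.
have -> : 4 / 3 * (4^-1 ^+ k - 4^-1 ^+ (i + k).+1) =
    4^-1 ^+ (i + k) + 4 / 3 * (4^-1 ^+ k - 4^-1 ^+ (i + k)) :> R.
  by rewrite (exprS _ (i + k)); field.
apply: nrm_triangle => //; by rewrite mulr_ge0 ?subr_ge0.
Qed.

Lemma ae_cvg_geometric : {ae pi, forall t, cvgn (fun n => x n t)}.
Proof.
have p0 n : 0 <= 4^-1 ^+ n :> R by rewrite exprn_ge0// invr_ge0.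
have : {ae pi, forall t, (\sum_(n <oo) (babs (x n.+1 - x n) t)%:E < +oo)%E}.
  apply: (@ae_summable _ _ _ _ _ 1 4^-1).
  - by rewrite invr_ge0 ler0n invf_lt1// ltr1n.
  - by move=> n t; rewrite babsE.
  - move=> n; rewrite mul1r -ler_sqr ?nnegrE//; last first.
      by apply: Ex_ge0 => t; rewrite babsE.
    apply: le_trans (Ex_sqr_le _ _) _; apply: le_trans (xS n).
    by apply: nrm_le => t; rewrite babsE normr_id.
apply: filterS => t H.
have : cvgn (series (fun n => x n.+1 t - x n t)).
  apply: normed_cvg; apply: nnseries_is_cvg => //=.
  by under eq_eseriesr do rewrite -bfunB_ -babsE.
move=> /cvg_ex[l cl]; apply/cvg_ex; exists (l + x 0%N t).
rewrite (_ : (fun n => x n t) =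
    fun n => series (fun n => x n.+1 t - x n t) n + x 0%N t).
  by apply: cvgD => //; exact: cvg_cst.
by apply/funext => n; rewrite /series/= telescope_sumr// subrK.
Qed.

(** Completeness of L^2 for a fast sequence of bounded functions: increments are almost surely
    summable, and Fatou's lemma carries the tail bounds to the limit. *)
Lemma L2_limit : exists h : T -> R, [/\ measurable_fun setT h,
  pi.-integrable setT (fun t => (h t ^+ 2)%:E) &
  forall k, \int[pi]_t (h t - x k t) ^+ 2 <= (4 / 3 * 4^-1 ^+ k) ^+ 2].
Proof.
(* The upper limit is measurable without any convergence; [fine] sends infinite values to 0, which
   can only occur on the null set of divergence. *)
pose h t := fine (limn_esup (fun n => (x n t)%:E)).
have mh : measurable_fun setT h.
  apply: measurableT_comp => //; apply: measurable_fun_limn_esup => n.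
  exact/measurable_EFinP/bfun_measurable.
have mhx k : measurable_fun setT (fun t => ((h t - x k t) ^+ 2)%:E).
  apply/measurable_EFinP; apply: measurable_funX; apply: measurable_funB => //.
  exact: bfun_measurable.
have hx k : (\int[pi]_t ((h t - x k t) ^+ 2)%:E <= ((4 / 3 * 4^-1 ^+ k) ^+ 2)%:E)%E.
  pose f n t := ((x (n + k)%N t - x k t) ^+ 2)%:E.
  have mf n : measurable_fun setT (f n).
    apply/measurable_EFinP; apply: measurable_funX.
    by apply: measurable_funB => //; exact: bfun_measurable.
  have f0 n t : (0 <= f n t)%E by rewrite lee_fin sqr_ge0.
  have fc n : (\int[pi]_t f n t <= ((4 / 3 * 4^-1 ^+ k) ^+ 2)%:E)%E.
    have := nrm_geometric_tail k n; rewrite -lee_fin /nrm /dot ExE.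
    by under eq_integral do rewrite bmulE bfunB_ -expr2.
  apply: le_trans (fatou_bound mf f0 fc).
  apply: ae_ge0_le_integral => //.
  - by move=> t _; rewrite lee_fin sqr_ge0.
  - move=> t _; rewrite limn_einf_lim; apply: lime_ge; first exact: is_cvg_einfs.
    by apply: nearW => n; apply: le_ereal_inf_tmp => _ [m _ <-].
  - rewrite /limn_einf; apply: measurableT_comp => //.
    by apply: measurable_fun_limn_esup => n; exact: measurableT_comp.
  - apply: filterS ae_cvg_geometric => t /cvg_ex[l cl] _.
    have hl : h t = l.
      rewrite /h is_cvg_limn_esupE; last first.
        by apply/cvg_ex; exists l%:E; apply/cvgn_EFinP.
      by rewrite (cvg_lim _ (_ : _ --> l%:E))//; apply/cvgn_EFinP.
    have H : (x (n + k)%N t - x k t) @[n --> \oo] --> l - x k t.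
      by apply: cvgB; [rewrite (cvg_shiftn k (fun n => x n t))|exact: cvg_cst].
    have fl : f n t @[n --> \oo] --> ((l - x k t) ^+ 2)%:E.
      by apply/cvgn_EFinP; rewrite expr2; under eq_fun do rewrite expr2; exact: (cvgM H H).
    rewrite is_cvg_limn_einfE; last by apply/cvg_ex; exists ((l - x k t) ^+ 2)%:E.
    by rewrite (cvg_lim _ fl)// hl.
have ihx k : pi.-integrable setT (fun t => ((h t - x k t) ^+ 2)%:E).
  apply/integrableP; split => //; apply: le_lt_trans (ltry _).
  by under eq_integral do rewrite gee0_abs ?lee_fin ?sqr_ge0//; exact: hx.
exists h; split => //.
  apply: (le_integrable measurableT (g := fun t =>
    2%:E * ((h t - x 0%N t) ^+ 2)%:E + 2%:E * (bmul (x 0%N) (x 0%N) t)%:E)%E).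
  - by apply/measurable_EFinP; exact: measurable_funX.
  - move=> t _; rewrite bmulE -!EFinM -EFinD !abse_EFin lee_fin.
    rewrite !ger0_norm ?sqr_ge0//.
      by have := sqr_ge0 (h t - 2 * x 0%N t); nra.
    by rewrite addr_ge0// mulr_ge0// ?sqr_ge0// -expr2 sqr_ge0.
  - apply: integrableD => //; apply: integrableZl => //.
    exact: bfun_integrable.
move=> k; rewrite -lee_fin; apply: le_trans (hx k).
by rewrite /Rintegral fineK//; exact: (integrable_fin_num _ (ihx k)).
Qed.

End L2_limit.

(** * From variance bounding to a one-sided gap *)

Section variance_bounding_to_right_gap.
Context d (T : measurableType d) (R : realType).
Variables (pi : probability T R) (P : R.-pker T ~> T).
Local Notation K := (kop P).
Hypothesis sK : symop pi K.

Definition no_right_gap := forall a : R, 0 <= a < 1 ->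
  exists2 f : bfun T R, Ex pi f = 0 & a * nrm pi f < dot pi f (K f).

Lemma almost_fixed_function (N : nat) (c : R) : 0 < c -> no_right_gap ->
  (* Time horizon [N] is reached with [1 - e] close enough to 1 that [2 k^2 e <= 1/4] for every
     [k <= N], as [iter_almost_fixed] requires. *)
  exists f : bfun T R, [/\ Ex pi f = 0, nrm pi f = c ^+ 2 &
    forall k, (k <= N)%N -> 2^-1 * c ^+ 2 <= dot pi f (iter k K f)].
Proof.
move=> c0 H; pose e : R := (8 * N.+1%:R ^+ 2)^-1.
have N1 : 1 <= N.+1%:R ^+ 2 :> R by rewrite exprn_ege1// ler1n.
have e0 : 0 < e by rewrite invr_gt0 mulr_gt0// (lt_le_trans ltr01).
have e1 : e <= 1.
  rewrite /e; move: (N.+1%:R ^+ 2) N1 => n2 N1.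
  by rewrite invf_le1 ?mulr_gt0//; lra.
have [|f f0 fK] := H (1 - e); first by rewrite subr_ge0 e1 gtrBl.
have nf : 0 < nrm pi f.
  have fle : dot pi f (K f) <= nrm pi f := dot_iter_le sK 1 f.
  rewrite lt_neqAle nrm_ge0 andbT eq_sym; apply/eqP => nf0.
  by move: fK fle; rewrite nf0; lra.
pose t := c / Num.sqrt (nrm pi f).
have nt : nrm pi (t *: f) = c ^+ 2.
  by rewrite nrmZ exprMn exprVn sqr_sqrtr ?ltW// mulfVK// gt_eqF.
exists (t *: f); split => //; first by rewrite ExZ f0 mulr0.
move=> k kN; rewrite -nt; apply: (iter_almost_fixed _ sK (kop_cst P 1) (e := e)).
- exact: kop_pos.
- rewrite /e invfM mulrA ler_pdivrMr ?(lt_le_trans ltr01)//.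
  have : k%:R ^+ 2 <= N.+1%:R ^+ 2 :> R.
    by rewrite lerXn2r ?nnegrE// ler_nat (leq_trans kN).
  lra.
- rewrite (linearZZ K) dotZl dotZr nrmZ.
  by have := ler_wpM2l (sqr_ge0 t) (ltW fK); rewrite expr2; nra.
Qed.

(** The predecessor is there because [chain_law pi P n] describes [n.+1] states: the path has length
    [32 ^ k]. *)
Let Q k := chain_law pi P (32 ^ k).-1.
Let A k (f : bfun T R) := baverage (32 ^ k).-1 f.

Section condensation.
Variable f : nat -> bfun T R.
Hypothesis f0 : forall k, Ex pi (f k) = 0.
Hypothesis nf : forall k, nrm pi (f k) = (4^-1 ^+ k) ^+ 2.

(* The sign is chosen so that adding [f k] does not decrease the k-th
   quadratic form (parallelogram law). *)
Fixpoint signed_sum k : bfun T R := match k with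
  | 0 => 0
  | k'.+1 => if nrm (Q k') (A k' (f k')) <=
                nrm (Q k') (A k' (signed_sum k' + f k'))
             then signed_sum k' + f k' else signed_sum k' - f k'
  end.

Lemma nrm_signed_sumB k :
  nrm pi (signed_sum k.+1 - signed_sum k) <= (4^-1 ^+ k) ^+ 2.
Proof.
rewrite /=; case: ifP => _; rewrite addrAC subrr add0r ?nrmN nf//.
Qed.

Lemma Ex_signed_sum k : Ex pi (signed_sum k) = 0.
Proof.
elim: k => [|k IH]; first exact: raddf0.
by rewrite /=; case: ifP => _; rewrite ?ExB ?ExD IH f0 ?addr0 ?subr0.
Qed.

Lemma nrm_signed_sum_ge k :
  nrm (Q k) (A k (f k)) <= nrm (Q k) (A k (signed_sum k.+1)).
Proof.
rewrite /=; case: ifPn => //; rewrite -ltNge /A baverageD baverageB nrmB nrmD.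
have := nrm_ge0 (Q k) (A k (signed_sum k)); rewrite /A.
by move: (nrm _ _) (nrm _ _) (dot _ _ _) => *; lra.
Qed.

End condensation.

(** At scale [32 ^ k] an almost invariant function of squared norm [16^-k] contributes at least
    [2^k / 2] to the length times the squared norm of the average. The later terms have squared norm
    at most [16^-k / 9], hence cost at most [2/9 * 2^k], and half of [1/2 - 2/9] still exceeds
    1/8. *)
Lemma scaled_variance_unbounded : no_right_gap ->
  exists2 h, h \in Lfun pi 2%:E & forall k,
    ((8^-1 * 2 ^+ k)%:E <= scaled_variance pi P h (32 ^ k).-1)%E.
Proof.
move=> H.
have /choice[f Hf] k := @almost_fixed_function (32 ^ k).-1 (4^-1 ^+ k)
  (ltac:(by rewrite exprn_gt0// invr_gt0)) H.
have f0 k : Ex pi (f k) = 0 by case: (Hf k).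
have nf k : nrm pi (f k) = (4^-1 ^+ k) ^+ 2 by case: (Hf k).
have fK k : 2^-1 * (4^-1 ^+ k) ^+ 2 <= nrm (Q k) (A k (f k)).
  by apply: (nrm_baverage_ge sK) => j jk; case: (Hf k) => _ _; exact.
have [h [mh h2 hx]] := L2_limit (nrm_signed_sumB nf).
exists h; first exact: Lfun2_of_integrable_sqr.
move=> k; set x := signed_sum f k.+1.
have := nrm_baverage_le_scaled_variance sK (32 ^ k).-1 mh h2 (Ex_signed_sum f0 k.+1).
rewrite (scaled_varianceE sK mh h2) -EFinM -EFinD !lee_fin.
have := le_trans (fK k) (nrm_signed_sum_ge f k); rewrite -/x /A /Q.
have := hx k.+1; rewrite -/x.
set I := \int[pi]_t _; set q := nrm _ _; set v := _ * lag_sum _ _.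
have -> : (32 ^ k).-1.+1%:R = 32 ^+ k :> R by rewrite prednK ?expn_gt0// natrX.
have -> : 2 ^+ k = 32 ^+ k * (4^-1 ^+ k) ^+ 2 :> R.
  by rewrite -exprM mulnC exprM -exprMn; congr (_ ^+ k); field.
have : 0 < 32 ^+ k :> R by rewrite exprn_gt0.
rewrite (exprS 4^-1); move: (32 ^+ k) (4^-1 ^+ k) I q v => N c I q v N0 h1 h2' h3.
have {}h1 : N * I <= N * (9^-1 * c ^+ 2).
  by rewrite ler_pM2l// (le_trans h1)// le_eqVlt; apply/orP; left; apply/eqP; field.
have {}h2' : N * (2^-1 * c ^+ 2) <= N * q by rewrite ler_pM2l.
have : 0 <= N * c ^+ 2 by rewrite mulr_ge0 ?sqr_ge0// ltW.
lra.
Qed.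

Theorem variance_bounding_right_gap : variance_bounding pi P ->
  exists2 a : R, 0 <= a < 1 & forall f : bfun T R, Ex pi f = 0 ->
    dot pi f (K f) <= a * nrm pi f.
Proof.
move=> VB; apply: contrapT => /forall2NP N.
have [a a01|h hL hv] := scaled_variance_unbounded.
  have [//|/existsNP[f /not_implyP[f0 /negP]]] := N a.
  by rewrite -ltNge => fK; exists f.
have [cv ltv] := VB h hL.
(* Only [+oo] is excluded for the limit, so the value [-oo] is given a real upper bound as well. *)
have [L vL] : exists L : R, (limn (scaled_variance pi P h) < L%:E)%E.
  move: ltv; rewrite /asymptotic_variance; case: (limn _) => [r| |]// _.
    by exists (r + 1); rewrite lte_fin ltrDl.
  by exists 0; rewrite ltNyr.
have [n0 _ Hn] := cv _ (open_ereal_lt' vL).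
pose k := maxn n0 (Num.bound (8 * L)).
have k1 : (n0 <= (32 ^ k).-1)%N.
  rewrite (@leq_trans k) ?leq_maxl// -ltnS prednK ?expn_gt0//.
  exact: ltn_expl.
have := le_lt_trans (hv k) (Hn _ k1); rewrite lte_fin.
have : 8 * L < k%:R.
  apply: lt_le_trans (unstable.ltr_bound _) _; rewrite ler_nat leq_maxr//.
have : k%:R <= 2 ^+ k :> R by rewrite -natrX ler_nat ltnW// ltn_expl.
lra.
Qed.

End variance_bounding_to_right_gap.

(** * Equivalence for delayed acceptance *)

Lemma singleton_geometrically_ergodic d (T : measurableType d) (R : realType)
    (pi : probability T R) (P : R.-pker T ~> T) :
  (forall x y : T, x = y) -> geometrically_ergodic pi P.
Proof.
move=> T1; exists 2^-1, (fun=> 0%E); split => //.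
- by apply/andP; split; lra.
- exact: aeW.
move=> n x A mA; rewrite nstepE.
have bE : bind R mA = bcst (bind R mA x).
  by apply: bfun_ext => y; rewrite bcstE (T1 y x).
have K1 : iter n (kop P) (bcst (bind R mA x)) = bcst (bind R mA x).
  by elim: n => //= n ->; exact: kop_cst.
by rewrite -(Ex_ind pi mA) bE Ex_cst K1 bcstE subee// abse0 mul0e.
Qed.

Theorem proposition1 (R : realType) (d : nat) (X : state_space R d)
    (pi pihat : density (lebesgue_on X)) (q : proposal (lebesgue_on X)) :
  geometrically_ergodic (law pi) (mh_kernel pi q) ->
  (geometrically_ergodic (law pi) (da_kernel pi pihat q) <->
   variance_bounding (law pi) (da_kernel pi pihat q)).
Proof.
move=> /(geometric_gap (mh_op_sym pi q))[s /andP[s0 s1] mhs].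
have sK := da_op_sym pi pihat q.
split=> [/(geometric_gap sK)[r /andP[r0 r1] gr]|VB].
  by apply: gap_variance_bounding gr => //; rewrite ltW.
have [a a01 aK] := variance_bounding_right_gap sK VB.
have lK (f : bfun X R) : Ex (law pi) f = 0 ->
    - s * nrm (law pi) f <= dot (law pi) f (da_op pi pihat q f).
  move=> f0; apply: le_trans (dot_mh_le_da _ _ _ _).
  have := gap_dot (mh_op_sym pi q) (kop_cst _ 1) 1 (ltW s0) mhs f0.
  by rewrite expr1 ler_norml mulNr => /andP[].
have [|r r01 gr] := two_sided_gap sK (kop_cst _ 1) a01 _ aK lK.
  by rewrite ltW.
(* In dimension 0 there is no coordinate function to rule out atoms, but all functions on the single
   point are constant. *)
case: d X pi pihat q s s0 s1 mhs sK VB a a01 aK lK r r01 gr =>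
    [|d] X pi pihat q s s0 s1 mhs sK VB a a01 aK lK r r01 gr.
  apply: singleton_geometrically_ergodic => x y; apply: val_inj.
  by rewrite [LHS]tuple0 [RHS]tuple0.
(* That moves are possible from almost every state is not assumed: it is a consequence of the
   gap. *)
have sp : {ae law pi, forall x, rejection q (da_acceptance pi pihat q) x < 1}.
  apply: (@gap_rejection_lt1 _ _ _ _ pi q (da_acceptance pi pihat q) r
    (@coordinate R d X) r01 sK gr).
    exact: coordinate_measurable.
  exact: law_coordinate.
apply: (@gap_geometrically_ergodic _ _ _ _ pi q (da_acceptance pi pihat q)
  _ _ r r01 gr sp).
  exact: da_balance.
by move=> x y; exact: da_zero.
Qed.
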